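(* Let $\mathfrak g=\mathfrak{so}(2r+1)$, $r\geq 2$ (type $\mathrm B_r$), let $\lambda$ be a dominant integral weight, and put $\boldsymbol\Lambda=(\lambda,\omega_1)$, $\boldsymbol z=(0,1)$. Let $\boldsymbol l$ be an admissible $r$-tuple, and $l=l_1+\dots+l_r\in\{0,1,\dots,2r\}$ its length. Then the Bethe ansatz equation associated to $\boldsymbol\Lambda,\boldsymbol z,\boldsymbol l$ has exactly one solution. The $r$-tuple of monic polynomials $\boldsymbol y^{(l)}=(y_1^{(l)},\dots,y_r^{(l)})$ representing it is the following (empty sums are $0$, empty products are $1$). (i) If $l\leq r-1$: $y_j^{(l)}=x-c_j^{(l)}$ for $1\leq j\leq l$ and $y_j^{(l)}=1$ for $j>l$, where $$c_j^{(l)}=\prod_{i=1}^j\frac{\lambda_i+\dots+\lambda_l+l-i}{\lambda_i+\dots+\lambda_l+l-i+1}.$$ (ii) If $l=r$: $y_j^{(r)}=x-c_j^{(r)}$ for $1\leq j\leq r$, where $$c_j^{(r)}=\prod_{i=1}^j\frac{\lambda_i+\dots+\lambda_{r-1}+\lambda_r/2+r-i}{\lambda_i+\dots+\lambda_{r-1}+\lambda_r/2+r-i+1}.$$ (iii) If $r+1\leq l\leq 2r$: $y_k^{(l)}=x-c_k^{(l)}$ for $1\leq k\leq 2r-l$ and $y_k^{(l)}=(x-a_k^{(l)})(x-b_k^{(l)})$ for $2r-l+1\leq k\leq r$. Write $$p_j=\sum_{i=j}^{2r-l}\lambda_i+2\sum_{i=2r-l+1}^{r-1}\lambda_i+\lambda_r+l-j-1,\qquad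 P_j=\frac{p_j}{p_j+1}\qquad(1\leq j\leq 2r-l),$$ $$q_j=\sum_{i=2r-l+1}^{j}\lambda_i+2\sum_{i=j+1}^{r-1}\lambda_i+\lambda_r+l-j-2,\qquad Q_j=\frac{q_j}{q_j+1}\qquad(2r-l+1\leq j\leq r-1),$$ $$\rho_i=\sum_{m=2r-l+1}^{r-i}\lambda_m+l-r-i-1,\qquad R_i=\frac{\rho_i}{\rho_i+1}\qquad(1\leq i\leq l-r-1),$$ $$M=2\sum_{i=2r-l+1}^{r-1}\lambda_i+\lambda_r+2l-2r.$$ Then $c_k^{(l)}=\prod_{j=1}^kP_j$ for $1\leq k\leq 2r-l$, and for $2r-l+1\leq k\leq r$ $$a_k^{(l)}b_k^{(l)}=\Big(\prod_{j=1}^{2r-l}P_j\Big)^2\ \prod_{j=2r-l+1}^{r-1}Q_j\ \prod_{j=2r-l+1}^{k-1}Q_j\ \prod_{i=1}^{r-k}R_i\ \cdot\ \frac{M-3}{M-1},$$ $$a_k^{(l)}+b_k^{(l)}=\frac{M-3}{M-2}\ \prod_{j=1}^{2r-l}P_j\ \Big(\prod_{j=2r-l+1}^{k-1}Q_j+\prod_{j=2r-l+1}^{r-1}Q_j\ \prod_{i=1}^{r-k}R_i\Big).$$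
   Context: Type $\mathrm B_r$ conventions: simple roots $\alpha_1,\dots,\alpha_r$ (standard numbering, $\alpha_r$ short), coroots $\alpha_i^\vee$, fundamental weights $\omega_i$ with $\langle\omega_j,\alpha_i^\vee\rangle=\delta_{ij}$. The invariant form on $\mathfrak h^*$ is normalized by $(\alpha_i,\alpha_i)=4$ for $i<r$ and $(\alpha_r,\alpha_r)=2$, so $(\alpha_i,\alpha_{i+1})=-2$; $\langle\lambda,\alpha_i^\vee\rangle=2(\lambda,\alpha_i)/(\alpha_i,\alpha_i)$. Write $\lambda_i=\langle\lambda,\alpha_i^\vee\rangle$. $V_\mu$ is the irreducible module of highest weight $\mu$. Bethe ansatz equation. Given weights $\boldsymbol\Lambda=(\Lambda_1,\dots,\Lambda_n)$, distinct complex numbers $\boldsymbol z=(z_1,\dots,z_n)$ and nonnegative integers $\boldsymbol l=(l_1,\dots,l_r)$, let $l=l_1+\dots+l_r$, and let $c:\{1,\dots,l\}\to\{1,\dots,r\}$ be the non-decreasing function with $\#c^{-1}(i)=l_i$. The Bethe ansatz equation associated to $\boldsymbol\Lambda,\boldsymbol z,\boldsymbol l$ is the system for $\boldsymbol t=(t_1,\dots,t_l)\in\mathbb C^l$ $$-\sum_{s=1}^n\frac{(\alpha_{c(i)},\Lambda_s)}{t_i-z_s}+\sum_{j\ne i}\frac{(\alpha_{c(i)},\alpha_{c(j)})}{t_i-t_j}=0,\qquad i=1,\dots,l,$$ where terms with zero numerator are omitted and all denominators with nonzero numerator are required to be nonzero. Solutions that differ by a permutation of coordinates preserving $c$ are identified.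 A solution $\boldsymbol t$ is represented by the $r$-tuple $\boldsymbol y=(y_1,\dots,y_r)$, $y_i(x)=\prod_{j:\,c(j)=i}(x-t_j)$. Admissibility. Put $\alpha(\boldsymbol l)=\sum_i l_i\alpha_i$. The tuple $\boldsymbol l$ is admissible if $V_{\lambda+\omega_1-\alpha(\boldsymbol l)}$ is a summand of $V_\lambda\otimes V_{\omega_1}$. Admissible tuples have the form $(1,\dots,1,0,\dots,0)$ or $(1,\dots,1,2,\dots,2)$ with $k$ ones, $0\leq k\leq r$; their length is $l=k$, respectively $l=2r-k$, and the length determines the tuple. A tuple of this form of length $l$ is admissible iff $l=0$, or $1\leq l\leq r$ and $\lambda_l>0$, or $l=r+1$ and $\lambda_r>1$, or $r+1<l\leq 2r$ and $\lambda_{2r-l+1}>0$. *)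

(* Defs.v *)
From HB Require Import structures.
From mathcomp Require Import all_boot all_order all_fingroup all_algebra.
From mathcomp Require Import complex mxtens.
From mathcomp Require Import reals.

Set Implicit Arguments.
Unset Strict Implicit.
Unset Printing Implicit Defensive.

Import Order.TTheory GRing.Theory Num.Theory.
Local Open Scope ring_scope.

(* Indexing: the ordinal i : 'I_r stands for the node i.+1 of the Dynkin      *)
(* diagram B_r, so that the short simple root alpha_r is the one with         *)
(* i.+1 = r.                                                                  *)

(* (alpha_i, alpha_j) *)
Definition root_form r (i j : 'I_r) : int :=
  if i == j then (if i.+1 == r then 2%:Z else 4%:Z)
  else if (i.+1 == j) || (j.+1 == i) then (- 2%:Z) else 0.

(* An integral weight mu is encoded by its coordinates in the basis of        *)
(* fundamental weights: mu 0 i = <mu, alpha_i^vee>.                           *)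
Definition weight r := 'rV[int]_r.

Definition dominant r (mu : weight r) : Prop := forall i, 0 <= mu 0 i.

(* Here k is the usual number of the node, 1 <= k <= r. *)
Definition fundamental_weight r (k : nat) : weight r :=
  \row_i (i.+1 == k)%:R.

(* <alpha_j, alpha_i^vee> = 2 (alpha_j, alpha_i) / (alpha_i, alpha_i); the    *)
(* integer division is exact.                                                 *)
Definition simple_root r (j : 'I_r) : weight r :=
  \row_i (2 * root_form j i %/ root_form i i)%Z.

(* (alpha_i, mu) = <mu, alpha_i^vee> (alpha_i, alpha_i) / 2 *)
Definition root_weight_form r (i : 'I_r) (mu : weight r) : int :=
  mu 0 i * (root_form i i %/ 2)%Z.

(* alpha(l) = l_1 alpha_1 + ... + l_r alpha_r *)
Definition root_comb r (l : 'I_r -> nat) : weight r :=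
  \sum_i simple_root i *+ l i.

Section Modules.
Variables (F : fieldType) (r : nat).

(* so(2r+1) in its split form, for the symmetric bilinear form with           *)
(* antidiagonal Gram matrix: the diagonal matrices form a Cartan subalgebra   *)
(* and the strictly upper triangular ones the sum of the positive root        *)
(* spaces.                                                                    *)
Local Notation N := (2 * r).+1%N.

Definition antidiag_mx : 'M[F]_N := \matrix_(i, j) ((i + j)%N == (2 * r)%N)%:R.

Definition in_so (X : 'M[F]_N) : Prop :=
  X^T *m antidiag_mx + antidiag_mx *m X = 0.

Definition lie_bracket d (X Y : 'M[F]_d) : 'M[F]_d := X *m Y - Y *m X.

(* The basis dual to epsilon_1, ..., epsilon_r (k counted from 0), where      *)
(* alpha_i = epsilon_i - epsilon_{i+1} for i < r and alpha_r = epsilon_r.     *)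
Definition cartan_mx (k : nat) : 'M[F]_N :=
  diag_mx (\row_(a < N) ((a == k :> nat)%:R - ((a + k)%N == (2 * r)%N)%:R)).

Definition coroot (i : 'I_r) : 'M[F]_N :=
  if i.+1 == r then cartan_mx i *+ 2 else cartan_mx i - cartan_mx i.+1.

(* A finite-dimensional module is given by the matrices rho X acting on       *)
(* column vectors; only the values of rho on so(2r+1) are relevant.           *)
Definition so_module d (rho : 'M[F]_N -> 'M[F]_d) : Prop :=
  (forall (a : F) X Y, in_so X -> in_so Y ->
     rho (a *: X + Y) = a *: rho X + rho Y) /\
  (forall X Y, in_so X -> in_so Y ->
     rho (lie_bracket X Y) = lie_bracket (rho X) (rho Y)).

(* A subspace of column vectors is encoded by the row space of U, whence the  *)
(* transpose.                                                                 *)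
Definition irreducible_module d (rho : 'M[F]_N -> 'M[F]_d) : Prop :=
  (0 < d)%N /\
  forall U : 'M[F]_d,
    (forall X, in_so X -> (U *m (rho X)^T <= U)%MS) -> U = 0 \/ row_full U.

Definition has_highest_weight d (rho : 'M[F]_N -> 'M[F]_d) (mu : weight r) :
    Prop :=
  exists v : 'cV[F]_d,
    [/\ v != 0,
        forall X, in_so X -> (forall i j : 'I_N, (j <= i)%N -> X i j = 0) ->
          rho X *m v = 0
      & forall i : 'I_r, rho (coroot i) *m v = (mu 0 i)%:~R *: v].

(* rho is (a matrix form of) V_mu *)
Definition is_V (mu : weight r) d (rho : 'M[F]_N -> 'M[F]_d) : Prop :=
  [/\ so_module rho, irreducible_module rho & has_highest_weight rho mu].

Definition tensor_module d1 d2 (rho1 : 'M[F]_N -> 'M[F]_d1)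
    (rho2 : 'M[F]_N -> 'M[F]_d2) (X : 'M[F]_N) : 'M[F]_(d1 * d2) :=
  tensmx (rho1 X) 1%:M + tensmx 1%:M (rho2 X).

Definition direct_summand d d' (sigma : 'M[F]_N -> 'M[F]_d)
    (rho : 'M[F]_N -> 'M[F]_d') : Prop :=
  exists (inc : 'M[F]_(d', d)) (proj : 'M[F]_(d, d')),
    [/\ proj *m inc = 1%:M,
        forall X, in_so X -> inc *m sigma X = rho X *m inc
      & forall X, in_so X -> sigma X *m proj = proj *m rho X].

(* V_(lambda + omega_1 - alpha(l)) is a summand of V_lambda (x) V_(omega_1);  *)
(* V_mu being unique up to isomorphism, the choice of the matrix forms is     *)
(* immaterial.                                                                *)
Definition admissible (lambda : weight r) (l : 'I_r -> nat) : Prop :=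
  exists d d1 d2 (sigma : 'M[F]_N -> 'M[F]_d)
         (rho1 : 'M[F]_N -> 'M[F]_d1) (rho2 : 'M[F]_N -> 'M[F]_d2),
    [/\ is_V (lambda + fundamental_weight r 1 - root_comb l) sigma,
        is_V lambda rho1,
        is_V (fundamental_weight r 1) rho2
      & direct_summand sigma (tensor_module rho1 rho2)].

End Modules.

(* c is the non-decreasing function with #c^-1(i) = l_i *)
Definition is_coloring r (l : 'I_r -> nat) m (c : 'I_m -> 'I_r) : Prop :=
  (forall a b : 'I_m, (a <= b)%N -> (c a <= c b)%N) /\
  (forall i : 'I_r, #|[set a | c a == i]| = l i).

Section Bethe.
Variables (F : fieldType) (r m : nat) (c : 'I_m -> 'I_r).

Definition bethe_solution n (Lambda : n.-tuple (weight r)) (z : n.-tuple F)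
    (t : 'I_m -> F) : Prop :=
  forall i : 'I_m,
    [/\ forall s : 'I_n, root_weight_form (c i) (tnth Lambda s) != 0 ->
          t i - tnth z s != 0,
        forall j : 'I_m, j != i -> root_form (c i) (c j) != 0 ->
          t i - t j != 0
      & - \sum_(s < n | root_weight_form (c i) (tnth Lambda s) != 0)
            (root_weight_form (c i) (tnth Lambda s))%:~R / (t i - tnth z s)
        + \sum_(j < m | (j != i) && (root_form (c i) (c j) != 0))
            (root_form (c i) (c j))%:~R / (t i - t j) = 0].

Definition same_solution (t t' : 'I_m -> F) : Prop :=
  exists s : 'S_m, forall i, c (s i) = c i /\ t' i = t (s i).

Definition ypoly (t : 'I_m -> F) (k : 'I_r) : {poly F} :=
  \prod_(j < m | c j == k) ('X - (t j)%:P).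

End Bethe.

(* lambda_i as an element of F, with the usual numbering 1 <= i <= r *)
Definition weight_coord (F : fieldType) r (lambda : weight r) (i : nat) : F :=
  if insub i.-1 is Some k then (lambda 0 k)%:~R else 0.

(* From here on all indices are the usual ones, counted from 1, and           *)
(* lam i = lambda_i.                                                          *)
Section Formulas.
Variables (F : fieldType) (r l : nat) (lam : nat -> F).

Definition succ_ratio (x : F) : F := x / (x + 1).

(* l <= r - 1 *)
Definition c_short (j : nat) : F :=
  \prod_(1 <= i < j.+1)
    ((\sum_(i <= m < l.+1) lam m + l%:R - i%:R) /
     (\sum_(i <= m < l.+1) lam m + l%:R - i%:R + 1)).

(* l = r *)
Definition c_mid (j : nat) : F :=
  \prod_(1 <= i < j.+1)
    ((\sum_(i <= m < r) lam m + lam r / 2 + r%:R - i%:R) /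
     (\sum_(i <= m < r) lam m + lam r / 2 + r%:R - i%:R + 1)).

(* r + 1 <= l <= 2r: k0 = 2r - l is the number of linear polynomials *)
Local Notation k0 := (2 * r - l)%N.

Definition p_ (j : nat) : F :=
  \sum_(j <= i < k0.+1) lam i + 2 * (\sum_(k0.+1 <= i < r) lam i) + lam r
  + l%:R - j%:R - 1.

Definition q_ (j : nat) : F :=
  \sum_(k0.+1 <= i < j.+1) lam i + 2 * (\sum_(j.+1 <= i < r) lam i) + lam r
  + l%:R - j%:R - 2.

Definition rho_ (i : nat) : F :=
  \sum_(k0.+1 <= m < (r - i).+1) lam m + l%:R - r%:R - i%:R - 1.

Definition M_ : F :=
  2 * (\sum_(k0.+1 <= i < r) lam i) + lam r + 2 * l%:R - 2 * r%:R.

Definition prodP (k : nat) : F := \prod_(1 <= j < k.+1) succ_ratio (p_ j).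
Definition prodQ (k : nat) : F := \prod_(k0.+1 <= j < k.+1) succ_ratio (q_ j).
Definition prodR (k : nat) : F := \prod_(1 <= i < k.+1) succ_ratio (rho_ i).

Definition ab_prod (k : nat) : F :=
  prodP k0 ^+ 2 * prodQ r.-1 * prodQ k.-1 * prodR (r - k)
  * ((M_ - 3) / (M_ - 1)).

Definition ab_sum (k : nat) : F :=
  (M_ - 3) / (M_ - 2) * prodP k0
  * (prodQ k.-1 + prodQ r.-1 * prodR (r - k)).

End Formulas.

(* Main.v *)
Require Import Defs.
From HB Require Import structures.
From mathcomp Require Import all_boot all_order all_fingroup all_algebra.
From mathcomp Require Import complex mxtens.
From mathcomp Require Import boolp reals.
From mathcomp Require Import ring zify.

(* Necessity of the conditions on l. A singular vector of V_lambda (x)         *)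
(* V_(omega_1) is determined by its component v (x) u, v being the highest     *)
(* weight vector, and u inherits the relations e_i^(lambda_i + 1) = 0 of the   *)
(* lowest weight vector of the dual of V_lambda. As V_(omega_1) is the vector  *)
(* representation, u is one of its 2r + 1 basis vectors e_a; then l has length *)
(* a, and the relations for the two smallest exponents give the conditions on  *)
(* lambda.                                                                     *)
(*                                                                             *)
(* The Bethe equations. While the y_k are linear, the equations are solved     *)
(* recursively starting from the last one. A quadratic y_k following a linear  *)
(* y_(k-1) is treated by a reflection: a polynomial z of degree 1 with         *)
(* Wr(y_k, x^(w+1) z) = x^w y_(k-1) y_(k+1) is found by interpolation at the   *)
(* roots of y_k, the Bethe equations saying that the error term, a cubic, has  *)
(* two double roots. Replacing y_k by z and the weight by its image under the  *)
(* simple reflection shortens l by one, so that any solution is determined     *)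
(* recursively. Conversely the Wronskian identities hold for the polynomials   *)
(* of the statement and give back the Bethe equations; what remains is that    *)
(* the roots involved are distinct and nonzero. In the proof n = M - 2.        *)

Set Implicit Arguments.
Unset Strict Implicit.
Unset Printing Implicit Defensive.

Import Order.TTheory GRing.Theory Num.Theory.
Local Open Scope ring_scope.

(** * The orthogonal Lie algebra *)

(** A summand V_mu of V_lambda (x) V_(omega_1) yields a singular vector of the tensor product. Its
    component u along the highest weight vector of V_lambda is nonzero, has weight mu - lambda, and
    is killed by the simple raising operator e_i when lambda_i = 0, and by e_r^2 when lambda_r = 1
    ([singular_vector_component]). Since V_(omega_1) is the vector representation, u is a basis
    vector e_a up to scale; comparing weights gives l, and the relations give the positivity of
    certain lambda_i ([admissible_weight], [admissible_shape], [quad_W_gt1]).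

    Divided by 2, the Bethe equations become conditions on the roots of the y_k, with y_0 = x - 1
    ([bethe_normalized]). When all y_k have degree at most 1, the last equation gives the ratio of
    the last two roots, and going back one colour at a time gives (A_k + 1) c_k = A_k c_(k-1)
    ([linear_chain_unique], [linear_chain_eq]).

    When l > r, the quadratic colours start at k0 + 1 with k0 = 2r - l. Suppose the left neighbour
    of y_k is x - u and the weight at 0 is W_k. The equations of colour k then produce x - u' such
    that the Wronskian of y_k and x^(W_k + 1) (x - u') is proportional to x^(W_k) (x - u) y_(k+1)
    ([reflection]). At the roots of y_(k+1) the logarithmic derivative of y_k is therefore that of
    x^(W_k + 1) (x - u'), so colour k + 1 satisfies a system of the same kind, with left neighbour x
    - u' and weight W_(k+1) = w_(k+1) + W_k + 1. Multiplying the equations by their roots and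
    summing gives u y_k'(u) / y_k(u) = n + 1 with n = 2 W_r ([state_left_sum]). This determines u'
    from u ([next_state]) and closes the chain of linear colours. Colour r is solved directly
    ([short_reflection]), and the relations read backwards give n (a_k + b_k) = (n - 1) (u_k + v_k)
    and (n + 1) a_k b_k = (n - 1) u_k v_k ([quad_chain_unique]).

    Conversely, these values satisfy the Wronskian relations ([chain_reflection]), which return the
    Bethe equations once the roots are nonzero and suitably distinct. That follows from the
    positivity of u and v and from the inequality (n + 1) v_k < (n - 1) u_k for k < r
    ([chain_v_bounds], [chain_roots_distinct], [chain_nbr_neq]). *)

Section OrthogonalLieAlgebra.
Variables (F : numFieldType) (r : nat).
Local Notation N := (2 * r).+1%N.
Implicit Types X Y H : 'M[F]_N.

Lemma add_rev_ord_eq (i k : 'I_N) : (i + k == 2 * r)%N = (k == rev_ord i).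
Proof. by rewrite -val_eqE /=; have := ltn_ord i; have := ltn_ord k; lia. Qed.

Lemma antidiag_mulE X i j : (antidiag_mx F r *m X) i j = X (rev_ord i) j.
Proof.
rewrite mxE (bigD1 (rev_ord i)) //= big1 => [|k /negbTE kNi].
  by rewrite mxE add_rev_ord_eq eqxx mul1r addr0.
by rewrite mxE add_rev_ord_eq kNi mul0r.
Qed.

Lemma mul_antidiagE X i j : (X *m antidiag_mx F r) i j = X i (rev_ord j).
Proof.
rewrite mxE (bigD1 (rev_ord j)) //= big1 => [|k /negbTE kNi].
  by rewrite mxE addnC add_rev_ord_eq eqxx mulr1 addr0.
by rewrite mxE addnC add_rev_ord_eq kNi mulr0.
Qed.

(** Multiplying by the antidiagonal matrix reverses rows or columns, which turns the defining
    equation into antisymmetry about the antidiagonal. *)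
Lemma in_soP X :
  in_so X <-> forall i j, X i j = - X (rev_ord j) (rev_ord i).
Proof.
split=> [soX i j|XE].
  have /matrixP/(_ j (rev_ord i)) := soX.
  rewrite mxE mul_antidiagE antidiag_mulE !mxE rev_ordK => /eqP.
  by rewrite addr_eq0 => /eqP.
apply/matrixP => i j; rewrite mxE mul_antidiagE antidiag_mulE !mxE.
by rewrite [X in X + _]XE rev_ordK addNr.
Qed.

Lemma in_so_lin (a : F) X Y : in_so X -> in_so Y -> in_so (a *: X + Y).
Proof.
move=> /in_soP hX /in_soP hY; apply/in_soP => i j.
by rewrite !mxE (hX i) (hY i) mulrN opprD.
Qed.

Lemma in_so0 : in_so (0 : 'M[F]_N).
Proof. by apply/in_soP => i j; rewrite !mxE oppr0. Qed.

Lemma in_soD X Y : in_so X -> in_so Y -> in_so (X + Y).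
Proof. by rewrite -[X in in_so (X + _)]scale1r; apply: in_so_lin. Qed.

Lemma in_soZ (a : F) X : in_so X -> in_so (a *: X).
Proof. by move=> hX; rewrite -[X in in_so X]addr0; apply: in_so_lin in_so0. Qed.

Lemma in_so_tr X : in_so X -> in_so X^T.
Proof. by move=> /in_soP hX; apply/in_soP => i j; rewrite !mxE hX. Qed.

Lemma in_so_bracket X Y : in_so X -> in_so Y -> in_so (lie_bracket X Y).
Proof.
rewrite /in_so /lie_bracket => /eqP; rewrite addr_eq0 => /eqP hX.
move=> /eqP; rewrite addr_eq0 => /eqP hY.
rewrite linearB /= !trmx_mul mulmxBl mulmxBr -[Y^T *m _ *m _]mulmxA hX.
rewrite -[X^T *m _ *m _]mulmxA hY !mulmxN !mulmxA hX hY !mulNmx !opprK.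
by rewrite addrA subrK subrr.
Qed.

Definition upper_tri X : Prop := forall i j : 'I_N, (j <= i)%N -> X i j = 0.
Definition lower_tri X : Prop := forall i j : 'I_N, (i <= j)%N -> X i j = 0.
Definition diagonal X : Prop := forall i j : 'I_N, i != j -> X i j = 0.

Lemma upper_tri_tr X : upper_tri X^T <-> lower_tri X.
Proof. by split=> hX i j ij; move: (hX j i ij); rewrite mxE. Qed.

Lemma diagonal_tr X : diagonal X -> X^T = X.
Proof.
move=> dX; apply/matrixP => i j; rewrite mxE.
by have [->//|ij] := eqVneq i j; rewrite !dX // eq_sym.
Qed.

Definition mx_part (P : nat -> nat -> bool) X : 'M[F]_N :=
  \matrix_(i, j) if P i j then X i j else 0.

Lemma in_so_part (P : nat -> nat -> bool) X : (forall i j : 'I_N,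
  P i j = P (rev_ord j) (rev_ord i)) ->
  in_so X -> in_so (mx_part P X).
Proof.
move=> hP /in_soP hX; apply/in_soP => i j; rewrite !mxE hP hX.
by case: ifP => // _; rewrite oppr0.
Qed.

Lemma triangular_decomposition X : in_so X -> exists Xm X0 Xp,
  [/\ X = Xm + X0 + Xp, in_so Xm /\ lower_tri Xm, in_so X0 /\ diagonal X0
    & in_so Xp /\ upper_tri Xp].
Proof.
move=> soX; exists (mx_part (fun i j => j < i)%N X).
exists (mx_part (fun i j => i == j) X), (mx_part (fun i j => i < j)%N X); split.
- by apply/matrixP => i j; rewrite !mxE; case: ltngtP; rewrite ?addr0 ?add0r.
- split; first by apply: in_so_part => // i j; have := ltn_ord i;
  have := ltn_ord j; rewrite /=; lia.
  by move=> i j ij; rewrite mxE ltnNge ij.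
- split; first by apply: in_so_part => // i j; have := ltn_ord i;
  have := ltn_ord j; rewrite /=; lia.
  by move=> i j ij; rewrite mxE -val_eqE /= in ij *; rewrite (negbTE ij).
- split; first by apply: in_so_part => // i j; have := ltn_ord i;
  have := ltn_ord j; rewrite /=; lia.
  by move=> i j ij; rewrite mxE ltnNge ij.
Qed.

Lemma diagonal_bracket H X : diagonal H ->
  forall i j, lie_bracket H X i j = (H i i - H j j) * X i j.
Proof.
move=> dH i j; rewrite !mxE (bigD1 i) //= big1 => [|k ki]; last first.
  by rewrite dH ?mul0r // eq_sym.
rewrite (bigD1 j) //= big1 => [|k kj]; last by rewrite dH ?mulr0.
by rewrite !addr0 mulrBl; congr (_ - _); rewrite mulrC.
Qed.

(* The grading element: X_ij has degree j - i. *)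
Definition grading_mx : 'M[F]_N := diag_mx (\row_a (r%:R - a%:R)).

Lemma grading_mxE i : grading_mx i i = r%:R - i%:R.
Proof. by rewrite !mxE eqxx. Qed.

Lemma grading_diagonal : diagonal grading_mx.
Proof. by move=> i j ij; rewrite mxE (negbTE ij). Qed.

Lemma in_so_grading : in_so grading_mx.
Proof.
apply/in_soP => i j; rewrite !mxE (inj_eq rev_ord_inj) eq_sym.
have [->|_] := eqVneq j i; rewrite ?oppr0 //= !mulr1n.
rewrite subSS natrB ?leq_ord // natrM; ring.
Qed.

Definition band (k : nat) X : 'M[F]_N := mx_part (fun i j => i == j + k.+1)%N X.

Lemma in_so_band k X : in_so X -> in_so (band k X).
Proof. by apply: in_so_part => i j; have := ltn_ord i; have := ltn_ord j;
  rewrite /=; lia. Qed.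

Lemma lower_tri_band k X : lower_tri (band k X).
Proof. by move=> i j ij; rewrite mxE; case: eqP => //; lia. Qed.

Lemma sum_band X : lower_tri X -> X = \sum_(k < N) band k X.
Proof.
move=> lX; apply/matrixP => i j; rewrite summxE.
have [ij|ji] := leqP i j.
  by rewrite lX // big1 // => k _; rewrite lower_tri_band.
have h : (i - j.+1 < N)%N by have := ltn_ord i; lia.
rewrite (bigD1 (Ordinal h)) //= big1 => [|k kn].
  by rewrite mxE ifT ?addr0 //; apply/eqP; lia.
rewrite mxE ifF //; apply: contraNF kn => /eqP e.
by apply/eqP/val_inj => /=; lia.
Qed.

Lemma bracket_grading_band k X :
  lie_bracket grading_mx (band k X) = - k.+1%:R *: band k X.
Proof.
apply/matrixP => i j; rewrite diagonal_bracket; last exact: grading_diagonal.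
rewrite !grading_mxE !mxE; case: eqP => [->|]; last by rewrite !mulr0.
by congr (_ * _); rewrite natrD; ring.
Qed.

End OrthogonalLieAlgebra.

(** * Highest weight modules *)

Section HighestWeightModules.
Variables (F : numFieldType) (r : nat).
Local Notation N := (2 * r).+1%N.

Section Module.
Variables (d : nat) (rho : 'M[F]_N -> 'M[F]_d).
Hypothesis rho_mod : so_module rho.

Lemma so_moduleD X Y : in_so X -> in_so Y -> rho (X + Y) = rho X + rho Y.
Proof.
by move=> sX sY; have := rho_mod.1 1 X Y sX sY; rewrite !scale1r.
Qed.

Lemma so_module0 : rho 0 = 0.
Proof.
have := so_moduleD (in_so0 F r) (in_so0 F r).
by rewrite addr0 -[LHS]addr0 => /addrI/esym.
Qed.

Lemma so_moduleZ a X : in_so X -> rho (a *: X) = a *: rho X.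
Proof.
by move=> sX; have := rho_mod.1 a X 0 sX (in_so0 F r);
  rewrite !addr0 so_module0 addr0.
Qed.

Lemma so_module_sum (I : finType) (Y : I -> 'M[F]_N) :
  (forall i, in_so (Y i)) -> rho (\sum_i Y i) = \sum_i rho (Y i).
Proof.
move=> sY; pose K X M := in_so X /\ rho X = M.
suff [] : K (\sum_i Y i) (\sum_i rho (Y i)) by [].
apply: (big_ind2 K) => [|X M Z P [sX <-] [sZ <-]|i _] //.
- by split; [exact: in_so0 | exact: so_module0].
- by split; [exact: in_soD | exact: so_moduleD].
Qed.

Lemma so_module_mulC X Y (x : 'cV_d) : in_so X -> in_so Y ->
  rho X *m (rho Y *m x) = rho Y *m (rho X *m x) + rho (lie_bracket X Y) *m x.
Proof.
move=> sX sY; rewrite rho_mod.2 // /lie_bracket mulmxBl !mulmxA.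
by rewrite addrC subrK.
Qed.

Definition subspace (P : 'cV[F]_d -> Prop) : Prop :=
  P 0 /\ forall a x y, P x -> P y -> P (a *: x + y).

Definition invariant (P : 'cV[F]_d -> Prop) : Prop :=
  forall X x, in_so X -> P x -> P (rho X *m x).

(** Subspaces are handled as predicates, whereas irreducibility is stated for row spaces. A matrix
    of maximal rank with row space inside P contains every x in P, since adjoining the row x would
    otherwise raise the rank. *)
Lemma subspace_mx P : subspace P ->
  exists U : 'M[F]_d, forall x : 'cV_d, P x <-> (x^T <= U)%MS.
Proof.
move=> [P0 Plin].
pose Q n := `[< exists U : 'M[F]_d,
  \rank U = n /\ forall x : 'cV_d, (x^T <= U)%MS -> P x >].
have exQ : exists n, Q n.
  exists 0%N; apply/asboolP; exists 0; rewrite mxrank0; split=> // x.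
  by rewrite submx0 => /eqP/(congr1 trmx); rewrite trmxK trmx0 => ->.
have Qd n : Q n -> (n <= d)%N.
  by move=> /asboolP[U [<- _]]; exact: rank_leq_row.
case: (ex_maxnP exQ Qd) => n /asboolP[U [rU UP]] nmax.
exists U => x; split=> [Px|]; last exact: UP.
have QUx : Q (\rank (U + x^T)%MS).
  apply/asboolP; exists (U + x^T)%MS; split=> // y /sub_addsmxP[[u c] /= ye].
  have -> : y = c 0 0 *: x + (u *m U)^T.
    apply: trmx_inj; rewrite ye linearD /= linearZ /= trmxK addrC.
    congr (_ + _); rewrite [c]mx11_scalar mul_scalar_mx !mxE mulr1n;
      congr (_ *: _).
  by apply: Plin => //; apply: UP; rewrite trmxK submxMl.
have := nmax _ QUx; rewrite -rU => le_rk.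
have : (U == U + x^T)%MS by rewrite -(geq_leqif (mxrank_leqif_eq (addsmxSl _
  _))).
by move=> /andP[_]; rewrite addsmx_sub => /andP[].
Qed.

Lemma irreducible_subspace P : irreducible_module rho ->
  subspace P -> invariant P -> (forall x, P x -> x = 0) \/ (forall x, P x).
Proof.
move=> [_ irr] subP invP; have [U PU] := subspace_mx subP.
case: (irr U) => [X sX|U0|Ufull].
- apply/row_subP => i; rewrite row_mul -[row i U *m _]trmxK; apply/PU.
  by rewrite trmx_mul !trmxK; apply: invP => //; apply/PU;
    rewrite trmxK row_sub.
- left=> x /PU; rewrite U0 submx0 => /eqP/(congr1 trmx).
  by rewrite trmxK trmx0.
- by right=> x; apply/PU/submx_full.
Qed.

(** A highest weight vector whose weight is recorded on all diagonal matrices of the algebra. The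
    zero vector is allowed, so that singular vectors can be proved to vanish. *)
Definition extremal (v : 'cV[F]_d) (chi : 'M[F]_N -> F) : Prop :=
  (forall X, in_so X -> upper_tri X -> rho X *m v = 0) /\
  (forall H, in_so H -> diagonal H -> rho H *m v = chi H *: v).

(** Only lower triangular elements are used for the closure; stability under the whole algebra is
    then proved without ordering products of root vectors. *)
Inductive generated (v : 'cV[F]_d) : 'cV[F]_d -> Prop :=
| generated_base : generated v v
| generated_lin a x y :
    generated v x -> generated v y -> generated v (a *: x + y)
| generated_lower Y x :
    in_so Y -> lower_tri Y -> generated v x -> generated v (rho Y *m x).

Lemma generated0 v : generated v 0.
Proof.
have := generated_lin (-1) (generated_base v) (generated_base v).
by rewrite scaleN1r addNr.
Qed.

Lemma subspace_generated v : subspace (generated v).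
Proof. by split; [exact: generated0 | exact: generated_lin]. Qed.

Lemma generatedD v x y : generated v x -> generated v y -> generated v (x + y).
Proof. by move=> gx gy; rewrite -[x]scale1r; exact: generated_lin. Qed.

Lemma generatedZ v a x : generated v x -> generated v (a *: x).
Proof.
by move=> gx; rewrite -[_ *: _]addr0; apply: generated_lin => //;
  apply: generated0.
Qed.

(** Induction on the generation with X arbitrary: X Y x = Y X x + [X, Y] x, and [X, Y] lies in the
    algebra, so the hypothesis for x covers both terms. *)
Lemma invariant_generated v chi : extremal v chi -> invariant (generated v).
Proof.
move=> [vup vdg] X x + gx; elim: gx X => {x}.
- move=> X sX; have [Xm [X0 [Xp [-> [sm lm] [s0 d0] [sp up]]]]] :=
    triangular_decomposition sX.
  rewrite !so_moduleD ?mulmxDl //; last exact: in_soD.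
  rewrite (vup Xp) // (vdg X0) // addr0; apply: generatedD.
    by apply: generated_lower => //; apply: generated_base.
  by apply: generatedZ; apply: generated_base.
- move=> a x y _ hx _ hy X sX; rewrite mulmxDr -scalemxAr.
  by apply: generated_lin; [apply: hx | apply: hy].
- move=> Y x sY lY _ hx X sX; rewrite so_module_mulC //; apply: generatedD.
    by apply: generated_lower => //; apply: hx.
  by apply: hx; apply: in_so_bracket.
Qed.

Lemma irreducible_generated v chi : irreducible_module rho ->
  extremal v chi -> v != 0 -> forall x, generated v x.
Proof.
move=> irr ev v0; have [h|//] := irreducible_subspace irr
  (subspace_generated v) (invariant_generated ev).
by move: v0; rewrite (h v) ?eqxx //; apply: generated_base.
Qed.

Section LowerPart.
Variables (v : 'cV[F]_d) (chi : 'M[F]_N -> F).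
Hypotheses (rho_irr : irreducible_module rho) (v_ext : extremal v chi).
Hypothesis v_neq0 : v != 0.
Local Notation h0 := (grading_mx F r).

(** The grading element minus the eigenvalue lying [m.+1] below that of v; these operators
    commute. *)
Let shift (m : nat) (x : 'cV[F]_d) : 'cV[F]_d :=
  rho h0 *m x - (chi h0 - m.+1%:R) *: x.
Let shifts (s : seq nat) (x : 'cV[F]_d) : 'cV[F]_d := foldr shift x s.

(* The sum of the generalized eigenspaces of the grading element for the      *)
(* eigenvalues chi h0 - m, m > 0: all the weight spaces but that of v.        *)
Definition low (x : 'cV[F]_d) : Prop := exists s, shifts s x = 0.

Let shift_lin m a x y : shift m (a *: x + y) = a *: shift m x + shift m y.
Proof.
rewrite /shift mulmxDr -scalemxAr scalerDr scalerBr !scalerA opprD addrACA.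
by rewrite mulrC.
Qed.

Let shifts_lin s a x y : shifts s (a *: x + y) = a *: shifts s x + shifts s y.
Proof. by elim: s => //= m s ->; rewrite shift_lin. Qed.

Let shiftC m n x : shift m (shift n x) = shift n (shift m x).
Proof.
rewrite /shift !mulmxBr -!scalemxAr.
set z := _ *m (_ *m x); set y := _ *m x.
by apply/matrixP => i j; rewrite !mxE; ring.
Qed.

Let shifts_shift s m x : shifts s (shift m x) = shift m (shifts s x).
Proof. by elim: s => //= n s ->; rewrite shiftC. Qed.

Let shifts_cat s t x : shifts (s ++ t) x = shifts s (shifts t x).
Proof. exact: foldr_cat. Qed.

Let shiftsC s t x : shifts s (shifts t x) = shifts t (shifts s x).
Proof. by elim: s => //= m s ->; rewrite shifts_shift. Qed.

Let shifts0 s : shifts s 0 = 0.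
Proof. by elim: s => //= m s ->; rewrite /shift mulmx0 scaler0 subrr. Qed.

Lemma low0 : low 0.
Proof. by exists [::]. Qed.

Lemma low_lin a x y : low x -> low y -> low (a *: x + y).
Proof.
move=> [s hx] [t hy]; exists (s ++ t).
by rewrite shifts_lin !shifts_cat hy shiftsC hx !shifts0 scaler0 addr0.
Qed.

Lemma lowD x y : low x -> low y -> low (x + y).
Proof. by move=> lx ly; rewrite -[x]scale1r; exact: low_lin. Qed.

Lemma lowZ a x : low x -> low (a *: x).
Proof. by move=> lx; rewrite -[_ *: _]addr0; apply: low_lin => //;
  apply: low0. Qed.

Lemma low_sum (I : finType) (x : I -> 'cV_d) :
  (forall i, low (x i)) -> low (\sum_i x i).
Proof. by move=> lx; apply: big_ind => //; [exact: low0 | exact: lowD]. Qed.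

Let shifts_v s : shifts s v = (\prod_(m <- s) m.+1%:R) *: v.
Proof.
elim: s => [|m s ih]; first by rewrite big_nil scale1r.
rewrite big_cons /= ih /shift -scalemxAr v_ext.2; first last.
- exact: grading_diagonal.
- exact: in_so_grading.
by rewrite !scalerA -scalerBl; congr (_ *: _); ring.
Qed.

(** Each factor of [shifts s] multiplies v by a positive integer [m.+1], which is nonzero in
    characteristic 0. *)
Lemma low_multiple c : low (c *: v) -> c = 0.
Proof.
move=> [s]; rewrite -[c *: v]addr0 shifts_lin shifts0 addr0 shifts_v scalerA.
move=> /eqP; rewrite scaler_eq0 (negbTE v_neq0) orbF mulf_eq0 => /orP[/eqP//|].
by rewrite prodf_seq_eq0 => /hasP[m _]; rewrite pnatr_eq0.
Qed.

(** An element of degree -k lowers the eigenvalues of the grading element by k, so the product of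
    shifts translated by k kills the image. *)
Let low_homogeneous k X x : in_so X -> lie_bracket h0 X = - k%:R *: X ->
  low x -> low (rho X *m x).
Proof.
move=> sX hX [s hx]; exists (map (addn k) s).
suff -> y : shifts (map (addn k) s) (rho X *m y) = rho X *m shifts s y.
  by rewrite hx mulmx0.
elim: s {hx} => //= m s ->; rewrite {1}/shift so_module_mulC //; last first.
  exact: in_so_grading.
rewrite hX so_moduleZ // -scalemxAl -addrA -scalerBl mulmxBr -scalemxAr.
congr (_ + _); rewrite -scaleNr; congr (_ *: _).
rewrite -addnS natrD; ring.
Qed.

Lemma low_lower Y x : in_so Y -> lower_tri Y -> low x -> low (rho Y *m x).
Proof.
move=> sY lY lx; rewrite [Y]sum_band // so_module_sum; last first.
  by move=> k; apply: in_so_band.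
rewrite mulmx_suml; apply: low_sum => k.
apply: low_homogeneous (bracket_grading_band _ _) lx; exact: in_so_band.
Qed.

Lemma low_lower_v Y : in_so Y -> lower_tri Y -> low (rho Y *m v).
Proof.
move=> sY lY; rewrite [Y]sum_band // so_module_sum; last first.
  by move=> k; apply: in_so_band.
rewrite mulmx_suml; apply: low_sum => k; exists [:: k : nat].
rewrite /= /shift so_module_mulC; [|exact: in_so_grading|exact: in_so_band].
rewrite v_ext.2; [|exact: in_so_grading|exact: grading_diagonal].
rewrite bracket_grading_band so_moduleZ; last exact: in_so_band.
by by rewrite -scalemxAl -scalemxAr -scalerDl subrr.
Qed.

Lemma low_diagonal H x : in_so H -> diagonal H -> low x -> low (rho H *m x).
Proof.
move=> sH dH; apply: (@low_homogeneous 0) => //.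
apply/matrixP => i j; rewrite diagonal_bracket; last exact: grading_diagonal.
rewrite oppr0 scale0r [RHS]mxE; have [->|ij] := eqVneq i j;
  first by rewrite subrr mul0r.
by rewrite dH ?mulr0.
Qed.

(** v generates the module, and lower triangular elements map both v and [low] into [low]. *)
Lemma low_complement x : exists c, low (x - c *: v).
Proof.
elim: (irreducible_generated rho_irr v_ext v_neq0 x) => {x}.
- by exists 1; rewrite scale1r subrr; apply: low0.
- move=> a x y _ [c hx] _ [c' hy]; exists (a * c + c').
  rewrite scalerDl -scalerA opprD addrACA -scalerBr; exact: low_lin.
- move=> Y x sY lY _ [c hx]; exists 0; rewrite scale0r subr0.
  rewrite -[x](subrK (c *: v)) mulmxDr -scalemxAr.
  apply: lowD; first exact: low_lower.
  by apply: lowZ; apply: low_lower_v.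
Qed.

(** xi is the coefficient of v in the decomposition of the module into the line of v and [low].
    Lower triangular elements map everything into [low], and diagonal ones preserve both
    summands. *)
Lemma dual_highest_weight_vector : exists xi : 'cV[F]_d,
  [/\ xi^T *m v = 1%:M,
      forall Y, in_so Y -> lower_tri Y -> xi^T *m rho Y = 0
    & forall H, in_so H -> diagonal H -> xi^T *m rho H = chi H *: xi^T].
Proof.
have [xi hxi] := fin_all_exists (fun i => low_complement (delta_mx i 0)).
pose f : 'cV[F]_d := \col_i xi i.
have fE x : low (x - (f^T *m x) 0 0 *: v).
  rewrite {1}[x]matrix_sum_delta !mxE scaler_suml -sumrB; apply: low_sum => i.
  by rewrite big_ord1 !mxE mulrC -scalerA -scalerBr; apply: lowZ.
have uniq c x : low (x - c *: v) -> f^T *m x = c%:M.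
  move=> h; rewrite [_ *m _]mx11_scalar; congr (_%:M).
  apply/eqP; rewrite -subr_eq0 -oppr_eq0 opprB; apply/eqP/low_multiple.
  have := lowD (fE x) (lowZ (-1) h).
  by rewrite scaleN1r opprB addrC addrA subrK scalerBl.
have low_ker x : low x -> f^T *m x = 0.
  by move=> lx; rewrite (uniq 0) ?scalar_mx0 ?scale0r ?subr0 // raddf0.
exists f; split.
- by apply: uniq; rewrite scale1r subrr; apply: low0.
- move=> Y sY lY; apply/matrixP => i b.
  have [c hc] := low_complement (delta_mx b 0).
  have : low (rho Y *m delta_mx b 0).
    rewrite -[delta_mx b 0](subrK (c *: v)) mulmxDr -scalemxAr.
    by apply: lowD; [apply: low_lower | apply/lowZ/low_lower_v].
  move=> /low_ker; rewrite mulmxA -colE => /matrixP/(_ i 0).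
  by rewrite [LHS]mxE [RHS]mxE => ->; rewrite mxE.
- move=> H sH dH; apply/matrixP => i b.
  have [c hc] := low_complement (delta_mx b 0).
  have h1 := uniq _ _ hc.
  have : f^T *m (rho H *m delta_mx b 0) = (chi H * c)%:M.
    apply: uniq; rewrite -[delta_mx b 0](subrK (c *: v)) mulmxDr -scalemxAr.
    by rewrite v_ext.2 // scalerA [c * _]mulrC addrK; apply: low_diagonal.
  rewrite -scale_scalar_mx -h1 mulmxA -!colE => /matrixP/(_ i 0).
  by rewrite [LHS]mxE [X in _ = X -> _]mxE => ->; rewrite !mxE.
Qed.

End LowerPart.

End Module.
End HighestWeightModules.

(** * The contragredient module and its pairing with the module *)

Section Contragredient.
Variables (F : numFieldType) (r d : nat).
Local Notation N := (2 * r).+1%N.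
Variable rho : 'M[F]_N -> 'M[F]_d.
Hypotheses (rho_mod : so_module rho) (rho_irr : irreducible_module rho).

(* The dual module twisted by X |-> - X^T, which exchanges upper and lower    *)
(* triangular matrices: a highest weight vector of it is a lowest weight      *)
(* vector of the dual.                                                        *)
Definition contragredient (X : 'M[F]_N) : 'M[F]_d := (rho X^T)^T.

Lemma contragredient_module : so_module contragredient.
Proof.
split=> [a X Y sX sY|X Y sX sY]; rewrite /contragredient.
  by rewrite linearP /= rho_mod.1 ?linearP //; apply: in_so_tr.
rewrite /lie_bracket linearB /= !trmx_mul -!/(lie_bracket _ _).
by rewrite rho_mod.2 ?[LHS]linearB /= ?trmx_mul //; apply: in_so_tr.
Qed.

(** The annihilator of a submodule of the dual is a submodule, hence zero or everything by
    irreducibility. *)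
Lemma annihilator_dichotomy xi chi : extremal contragredient xi chi ->
  let ann (x : 'cV[F]_d) := forall eta, generated contragredient xi eta ->
    eta^T *m x = 0 in
  (forall x, ann x -> x = 0) \/ (forall x, ann x).
Proof.
move=> ext ann; apply: (irreducible_subspace rho_irr).
  split=> [eta _|a x y hx hy eta ge]; first by rewrite mulmx0.
  by rewrite mulmxDr -scalemxAr hx // hy // scaler0 addr0.
move=> X x sX hx eta ge; rewrite mulmxA.
have -> : eta^T *m rho X = (contragredient X^T *m eta)^T.
  by rewrite trmx_mul /contragredient !trmxK.
apply: hx; apply: (invariant_generated contragredient_module ext) => //.
exact: in_so_tr.
Qed.

Variables (v : 'cV[F]_d) (chi : 'M[F]_N -> F).
Hypotheses (v_ext : extremal rho v chi) (v_neq0 : v != 0).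

Lemma contragredient_highest_weight : exists xi : 'cV[F]_d,
  xi^T *m v = 1%:M /\ extremal contragredient xi chi.
Proof.
have [xi [xiv xilow xidiag]] :=
  dual_highest_weight_vector rho_mod rho_irr v_ext v_neq0.
exists xi; split=> //; split=> [X sX uX|H sH dH]; apply: trmx_inj.
  rewrite trmx_mul /contragredient trmxK trmx0 xilow //; first exact: in_so_tr.
  by apply/upper_tri_tr; rewrite trmxK.
by rewrite trmx_mul /contragredient trmxK diagonal_tr // xidiag // linearZ.
Qed.

Lemma annihilator_trivial xi psi : extremal contragredient xi psi ->
  xi^T *m v = 1%:M -> forall x : 'cV[F]_d,
  (forall eta, generated contragredient xi eta -> eta^T *m x = 0) -> x = 0.
Proof.
move=> ext xiv x annx; have [|annT] := annihilator_dichotomy ext; first exact.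
have := annT v xi (generated_base _ _).
by rewrite xiv => /matrixP/(_ 0 0)/eqP; rewrite !mxE oner_eq0.
Qed.

(** Transposes of lower triangular elements are upper triangular and kill v, so v is annihilated by
    all that eta generates. The annihilator is then nonzero, hence the whole module, and eta = 0. *)
Lemma extremal_orthogonal eta psi : extremal contragredient eta psi ->
  eta^T *m v = 0 -> eta = 0.
Proof.
move=> ext etav; have [ann0|annT] := annihilator_dichotomy ext.
  move: v_neq0; rewrite (ann0 v) ?eqxx // => zeta.
  elim=> {zeta} [//|a x y _ hx _ hy|Y x sY lY _ hx].
    by rewrite linearP /= mulmxDl -scalemxAl hx hy scaler0 addr0.
  rewrite trmx_mul /contragredient trmxK -mulmxA v_ext.1 ?mulmx0 //;
    first exact: in_so_tr.
  exact/upper_tri_tr.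
apply/matrixP => i j; rewrite ord1.
have /matrixP/(_ 0 0) := annT (delta_mx i 0) eta (generated_base _ _).
by rewrite -colE !mxE.
Qed.

End Contragredient.

(** * Coroots and weights of diagonal matrices *)

Section Coroots.
Variables (F : numFieldType) (r : nat).
Local Notation N := (2 * r).+1%N.

Lemma cartan_mxE k (i j : 'I_N) : cartan_mx F r k i j =
  ((i == k :> nat)%:R - ((i + k)%N == (2 * r)%N)%:R) *+ (i == j).
Proof. by rewrite !mxE. Qed.

Lemma cartan_diagonal k : diagonal (cartan_mx F r k).
Proof. by move=> i j ij; rewrite cartan_mxE (negbTE ij). Qed.

Lemma in_so_cartan k : (k <= 2 * r)%N -> in_so (cartan_mx F r k).
Proof.
move=> kr; apply/in_soP => i j; rewrite !cartan_mxE.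
rewrite (inj_eq rev_ord_inj) [j == i]eq_sym; have [<-|] := eqVneq i j;
  last by rewrite oppr0.
rewrite !mulr1n opprB.
by congr (_%:R - _%:R); have := ltn_ord i; rewrite /=; case: eqP; case: eqP;
  lia.
Qed.

(** At the middle index r the two defining entries coincide and cancel. Hence the short coroot is
    twice a difference of the same form as the other coroots. *)
Lemma cartan_mx_r : cartan_mx F r r = 0.
Proof.
apply/matrixP => i j; rewrite cartan_mxE mxE.
have -> : (i + r == 2 * r)%N = (i == r :> nat) by lia.
by rewrite subrr mul0rn.
Qed.

Definition simple_cartan (i : nat) : 'M[F]_N := cartan_mx F r i - cartan_mx F r
  i.+1.

Lemma coroot_simple_cartan (i : 'I_r) :
  coroot F i = simple_cartan i *+ (if i.+1 == r then 2 else 1).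
Proof.
rewrite /coroot /simple_cartan; case: eqP => [->|//].
by rewrite cartan_mx_r subr0.
Qed.

Lemma in_so_simple_cartan i : (i < r)%N -> in_so (simple_cartan i).
Proof.
move=> ir; rewrite /simple_cartan -scaleN1r addrC; apply: in_so_lin;
  apply: in_so_cartan; lia.
Qed.

Lemma simple_cartan_diagonal i : diagonal (simple_cartan i).
Proof. by move=> a b ab; rewrite !mxE (negbTE ab) subr0. Qed.

Lemma in_so_coroot (i : 'I_r) : in_so (coroot F i).
Proof.
rewrite coroot_simple_cartan -scaler_nat; apply/in_soZ/in_so_simple_cartan.
exact: ltn_ord.
Qed.

Lemma coroot_diagonal (i : 'I_r) : diagonal (coroot F i).
Proof.
move=> a b ab; rewrite coroot_simple_cartan mulmxnE.
by rewrite simple_cartan_diagonal ?mul0rn.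
Qed.

Lemma diagonal_cartan_sum (H : 'M[F]_N) : in_so H -> diagonal H ->
  H = \sum_(k < r) H (inord k) (inord k) *: cartan_mx F r k.
Proof.
move=> /in_soP sH dH; apply/matrixP => i j; rewrite summxE.
have [<-|ij] := eqVneq i j; last first.
  by rewrite dH // big1 // => k _; rewrite mxE cartan_diagonal ?mulr0.
case: (ltngtP i r) => ir.
- rewrite (bigD1 (Ordinal ir)) //= big1 => [|k ki].
    rewrite mxE cartan_mxE !eqxx addr0 (_ : (i + i)%N == _ = false); last lia.
    by rewrite subr0 mulr1 inord_val.
  rewrite mxE cartan_mxE eqxx mulr1n.
  rewrite (_ : (i == k :> nat) = false); last first.
    by apply: contraNF ki => /eqP e; apply/eqP/val_inj.
  by rewrite (_ : (i + k)%N == _ = false) ?subrr ?mulr0 //; have := ltn_ord k;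
    lia.
- have hi := ltn_ord i.
  have h : (rev_ord i < r)%N by rewrite /=; lia.
  rewrite (bigD1 (Ordinal h)) //= big1 => [|k ki].
    rewrite mxE cartan_mxE !eqxx addr0 mulr1n.
    have -> : (i == Ordinal h :> nat) = false by rewrite /=; lia.
    have -> : (i + Ordinal h == 2 * r)%N by rewrite /=; lia.
    rewrite sub0r mulrN1 sH; congr (- H _ _); apply/val_inj;
      by rewrite /= inordK //; lia.
  rewrite mxE cartan_mxE eqxx mulr1n.
  rewrite (_ : (i == k :> nat) = false); last by have := ltn_ord k; lia.
  rewrite (_ : (i + k)%N == _ = false) ?subrr ?mulr0 //.
  by apply: contraNF ki => /eqP e; apply/eqP/val_inj => /=; lia.
- rewrite big1 => [|k _]; last first.
    rewrite mxE cartan_mxE eqxx mulr1n.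
    rewrite (_ : (i == k :> nat) = false); last by have := ltn_ord k; lia.
    by rewrite (_ : (i + k)%N == _ = false) ?subrr ?mulr0 //;
      have := ltn_ord k; lia.
  have : H i i = - H i i.
    by rewrite {1}sH; congr (- H _ _); apply/val_inj => /=; lia.
  by move/eqP; rewrite -addr_eq0 -mulr2n mulrn_eq0 /= => /eqP.
Qed.

(** Abel summation of [diagonal_cartan_sum]; the boundary term vanishes by [cartan_mx_r]. *)
Lemma diagonal_simple_cartan_sum (H : 'M[F]_N) : in_so H -> diagonal H ->
  H = \sum_(i < r) (\sum_(k < i.+1) H (inord k) (inord k)) *: simple_cartan i.
Proof.
move=> sH dH; rewrite {1}[H]diagonal_cartan_sum //.
pose g k := H (inord k) (inord k); pose S n := \sum_(k < n) g k.
suff e n : \sum_(i < n) S i.+1 *: simple_cartan i =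
    \sum_(k < n) g k *: cartan_mx F r k - S n *: cartan_mx F r n.
  by have := e r; rewrite cartan_mx_r scaler0 subr0 => ->.
elim: n => [|n ih]; first by rewrite !big_ord0 /S big_ord0 scale0r subrr.
rewrite !big_ord_recr /= ih /simple_cartan scalerBr /S big_ord_recr /= addrA.
by congr (_ - _); rewrite scalerDl -addrA [_ + (S n *: _ + _)]addrA addNr add0r.
Qed.

Section HighestWeight.
Variables (d : nat) (rho : 'M[F]_N -> 'M[F]_d) (mu : weight r).
Hypothesis rho_mod : so_module rho.

(** The definition gives eigenvalues on coroots only; these span the diagonal matrices of the
    algebra, so v is a common eigenvector of all of them. *)
Lemma highest_weight_extremal : has_highest_weight rho mu ->
  exists (v : 'cV[F]_d) (chi : 'M[F]_N -> F),
    [/\ v != 0, extremal rho v chi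
      & forall i, chi (coroot F i) = (mu 0 i)%:~R].
Proof.
move=> [v [v0 vup vmu]].
have eig (i : 'I_r) : exists c, rho (simple_cartan i) *m v = c *: v.
  have := vmu i; rewrite coroot_simple_cartan -scaler_nat so_moduleZ //;
    last first.
    by apply: in_so_simple_cartan.
  rewrite -scalemxAl => /(congr1 (fun x =>
    (if i.+1 == r then 2 else 1)%:R^-1 *: x)).
  rewrite !scalerA mulVf ?scale1r => [->|]; first by eexists.
  by rewrite pnatr_eq0; case: ifP.
have [c cE] := fin_all_exists eig.
pose chi (H : 'M[F]_N) := \sum_(i < r) (\sum_(k < i.+1) H (inord k) (inord k))
  * c i.
have ext : extremal rho v chi.
  split=> // H sH dH; rewrite {1}[H]diagonal_simple_cartan_sum //.
  have sE (i : 'I_r) : in_so ((\sum_(k < i.+1) H (inord k) (inord k)) *: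
    simple_cartan i).
    by apply/in_soZ/in_so_simple_cartan.
  rewrite so_module_sum // mulmx_suml scaler_suml; apply: eq_bigr => i _.
  rewrite so_moduleZ; [|by []|by apply: in_so_simple_cartan].
  by rewrite -scalemxAl cE scalerA.
exists v, chi; split=> // i.
have := ext.2 _ (in_so_coroot i) (@coroot_diagonal i).
rewrite vmu => /eqP; rewrite -subr_eq0 -scalerBl scaler_eq0 (negbTE v0) orbF.
by rewrite subr_eq0 => /eqP.
Qed.

Lemma extremal_scale (v : 'cV[F]_d) chi H (n : nat) : v != 0 ->
  extremal rho v chi -> in_so H -> diagonal H -> chi (H *+ n) = chi H *+ n.
Proof.
move=> v0 ext sH dH; have sHn : in_so (H *+ n) by rewrite -scaler_nat;
  apply: in_soZ.
have dHn : diagonal (H *+ n) by move=> i j ij; rewrite mulmxnE dH ?mul0rn.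
have := ext.2 _ sHn dHn; rewrite -scaler_nat so_moduleZ // -scalemxAl ext.2 //.
rewrite scalerA => /eqP; rewrite -subr_eq0 -scalerBl scaler_eq0 (negbTE v0)
  orbF.
by rewrite subr_eq0 mulr_natl scaler_nat => /eqP.
Qed.

End HighestWeight.
End Coroots.

(** * Lowering along a simple root *)

Section SimpleLowering.
Variables (F : numFieldType) (r : nat).
Local Notation N := (2 * r).+1%N.
Implicit Types X H : 'M[F]_N.

Lemma mul_mx_deltaE m n (X : 'M[F]_(m, n)) k (j : 'I_n) (b : 'I_k) a c :
  (X *m delta_mx j b) a c = X a j * (c == b)%:R.
Proof.
rewrite mxE (bigD1 j) //= big1 => [|i ij]; first by rewrite addr0 mxE eqxx.
by rewrite mxE (negbTE ij) mulr0.
Qed.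

Lemma mul_delta_mxE m n (X : 'M[F]_(m, n)) k (j : 'I_m) (b : 'I_k) a c :
  (delta_mx b j *m X) a c = (a == b)%:R * X j c.
Proof.
rewrite mxE (bigD1 j) //= big1 => [|i ij].
  by rewrite addr0 mxE eqxx andbT.
by rewrite mxE (negbTE ij) andbF mul0r.
Qed.

(** The elementary matrix made antisymmetric about the antidiagonal. For [q = p.+1 <= r],
    [so_delta p q] and [so_delta q p] are the raising and lowering operators of the simple root
    alpha_q. *)
Definition so_delta (j k : 'I_N) : 'M[F]_N :=
  delta_mx j k - delta_mx (rev_ord k) (rev_ord j).

Lemma in_so_delta j k : in_so (so_delta j k).
Proof.
apply/in_soP => a b; rewrite !mxE opprB.
rewrite !(can2_eq rev_ordK rev_ordK) !rev_ordK.
by congr (_%:R - _%:R); rewrite andbC.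
Qed.

Lemma so_delta_tr j k : (so_delta j k)^T = so_delta k j.
Proof. by rewrite /so_delta linearB /= !trmx_delta. Qed.

Variables p q : 'I_N.
Hypotheses (pq : q = p.+1 :> nat) (qr : (q <= r)%N).
Local Notation f := (so_delta q p).
Local Notation h := (simple_cartan F r p).

Lemma so_delta_lower : lower_tri f.
Proof.
move=> a b ab; rewrite !mxE -!val_eqE /=.
have -> : (a == q :> nat) && (b == p :> nat) = false by lia.
have -> : (a == 2 * r - p :> nat)%N && (b == 2 * r - q :> nat)%N = false by lia.
by rewrite subrr.
Qed.

Lemma so_deltaE j k a b : so_delta j k a b =
  ((a == j) && (b == k))%:R - ((a == rev_ord k) && (b == rev_ord j))%:R.
Proof. by rewrite !mxE. Qed.

Lemma diagonal_bracket_lower H : in_so H -> diagonal H ->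
  lie_bracket H f = (H q q - H p p) *: f.
Proof.
move=> /in_soP sH dH; apply/matrixP => a b; rewrite diagonal_bracket //.
rewrite [RHS]mxE so_deltaE !mulrBr; congr (_ - _).
  by case: andP => [[/eqP-> /eqP->]//|_]; rewrite !mulr0.
case: andP => [[/eqP-> /eqP->]|_]; last by rewrite !mulr0.
by rewrite !mulr1 sH [H (rev_ord q) _]sH !rev_ordK opprK addrC.
Qed.

Lemma bracket_lowerE X a b : lie_bracket X f a b =
  X a q * (b == p)%:R - X a (rev_ord p) * (b == rev_ord q)%:R -
  ((a == q)%:R * X p b - (a == rev_ord p)%:R * X (rev_ord q) b).
Proof.
have e (A B : 'M[F]_N) : (A - B) a b = A a b - B a b by rewrite !mxE.
by rewrite /lie_bracket mulmxBr mulmxBl !e !mul_mx_deltaE !mul_delta_mxE.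
Qed.

Lemma simple_cartanE a b : h a b =
  ((a == p)%:R - (a == rev_ord p)%:R - (a == q)%:R + (a == rev_ord q)%:R)
  * (a == b)%:R.
Proof.
have e (A B : 'M[F]_N) : (A - B) a b = A a b - B a b by rewrite !mxE.
rewrite e -pq !cartan_mxE ![(a + _)%N]addnC !add_rev_ord_eq -!val_eqE.
by case: (a == b :> nat); rewrite ?mulr1n ?mulr0n; ring.
Qed.

(** Of the components of X only the one along the simple root vector, with coefficient [X p q], has
    a bracket with f outside the strictly upper triangular part, and that bracket is a multiple of
    h. *)
Lemma bracket_upper_lower X : in_so X -> upper_tri X ->
  upper_tri (lie_bracket X f - X p q *: h).
Proof.
move=> /in_soP sX uX a b ba.
have e (A B : 'M[F]_N) c : (A - c *: B) a b = A a b - c * B a b by rewrite !mxE.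
rewrite e bracket_lowerE simple_cartanE.
have hq := ltn_ord q; have ha := ltn_ord a.
have [ab|ab] := eqVneq a b; last first.
  have {}ba : (b < a)%N by rewrite ltn_neqAle ba andbT eq_sym.
  have -> : X a q * (b == p)%:R = 0.
    by case: eqP => [bp|]; rewrite ?mulr0 // uX ?mul0r // pq -bp.
  have -> : X a (rev_ord p) * (b == rev_ord q)%:R = 0.
    case: eqP => [bp|]; rewrite ?mulr0 // uX ?mul0r //.
    by move: ba; rewrite bp /=; lia.
  have -> : (a == q)%:R * X p b = 0.
    by case: eqP => [aq|]; rewrite ?mul0r // uX ?mulr0 //; move: ba;
      rewrite aq pq.
  have -> : (a == rev_ord p)%:R * X (rev_ord q) b = 0.
    case: eqP => [aq|]; rewrite ?mul0r // uX ?mulr0 //.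
    by move: ba; rewrite aq /=; lia.
  by rewrite !mulr0; ring.
rewrite -ab; have XE : X (rev_ord q) (rev_ord p) = - X p q.
  by rewrite sX !rev_ordK.
have -> : X a q * (a == p)%:R = X p q * (a == p)%:R.
  by case: eqP => [->//|_]; rewrite !mulr0.
have -> : X a (rev_ord p) * (a == rev_ord q)%:R = - X p q * (a == rev_ord q)%:R.
  by case: eqP => [->|_]; rewrite ?XE // !mulr0.
have -> : (a == q)%:R * X p a = (a == q)%:R * X p q.
  by case: eqP => [->//|_]; rewrite !mul0r.
have -> : (a == rev_ord p)%:R * X (rev_ord q) a = - (a == rev_ord p)%:R * X p q.
  by case: eqP => [->|_]; rewrite ?XE ?oppr0 ?mul0r //; ring.
by rewrite mulr1; ring.
Qed.

Section Lowering.
Variables (d : nat) (rho : 'M[F]_N -> 'M[F]_d).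
Hypothesis rho_mod : so_module rho.
Variables (v : 'cV[F]_d) (chi : 'M[F]_N -> F).
Hypothesis v_ext : extremal rho v chi.

Let in_so_f : in_so f := in_so_delta q p.

Let in_so_h : in_so h.
Proof. by apply: in_so_simple_cartan; lia. Qed.

Let bracket_act X (x : 'cV[F]_d) : in_so X -> rho (lie_bracket X f) *m x =
  X p q *: (rho h *m x) + rho (lie_bracket X f - X p q *: h) *m x.
Proof.
move=> sX; have sh : in_so (X p q *: h) by apply: in_soZ.
have sb : in_so (lie_bracket X f - X p q *: h).
  by rewrite -scaleN1r addrC; apply: in_so_lin => //; apply: in_so_bracket.
have := so_moduleD rho_mod sb sh; rewrite subrK (so_moduleZ rho_mod) // => ->.
by rewrite mulmxDl -scalemxAl addrC.
Qed.

Let in_so_rest X : in_so X -> in_so (lie_bracket X f - X p q *: h).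
Proof.
move=> sX; rewrite -scaleN1r addrC; apply: in_so_lin; first exact: in_soZ.
exact: in_so_bracket.
Qed.

Lemma lower_weight H c (x : 'cV[F]_d) : in_so H -> diagonal H ->
  rho H *m x = c *: x ->
  rho H *m (rho f *m x) = (c + (H q q - H p p)) *: (rho f *m x).
Proof.
move=> sH dH hx; rewrite (so_module_mulC rho_mod) //
  hx diagonal_bracket_lower //.
by rewrite (so_moduleZ rho_mod) // -scalemxAl -scalemxAr scalerDl.
Qed.

Lemma upper_lower_v X : in_so X -> upper_tri X ->
  rho X *m (rho f *m v) = (X p q * chi h) *: v.
Proof.
move=> sX uX; rewrite (so_module_mulC rho_mod) // bracket_act // v_ext.1 //
  mulmx0 add0r.
rewrite v_ext.2 //; last exact: simple_cartan_diagonal.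
rewrite v_ext.1 ?addr0 ?scalerA //; first exact: in_so_rest.
exact: bracket_upper_lower.
Qed.

Lemma extremal_lower : chi h = 0 ->
  extremal rho (rho f *m v) (fun H => chi H + (H q q - H p p)).
Proof.
move=> h0; split=> [X sX uX|H sH dH]; first by rewrite upper_lower_v //
  h0 mulr0 scale0r.
by apply: lower_weight => //; apply: v_ext.2.
Qed.

(** The short coroot is 2 h. Raising f f v gives f v with coefficient chi(h) + (chi(h) - 1), up to
    the factor [X p q], because f lowers the eigenvalue of h by 1; this vanishes for chi(h) =
    1/2. *)
Lemma extremal_lower2 : q = r :> nat -> chi h *+ 2 = 1 ->
  extremal rho (rho f *m (rho f *m v))
    (fun H => chi H + (H q q - H p p) + (H q q - H p p)).
Proof.
move=> q_r h1; split=> [X sX uX|H sH dH]; last first.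
  by do 2![apply: lower_weight => //]; apply: v_ext.2.
have qE : rev_ord q = q by apply/val_inj => /=; lia.
rewrite (so_module_mulC rho_mod) // upper_lower_v // bracket_act //.
rewrite (lower_weight in_so_h (@simple_cartan_diagonal _ _ _)
           (v_ext.2 _ in_so_h (@simple_cartan_diagonal _ _ _))).
rewrite upper_lower_v; [|exact: in_so_rest|exact: bracket_upper_lower].
have -> : (lie_bracket X f - X p q *: h) p q = 0.
  have e (A B : 'M[F]_N) c : (A - c *: B) p q = A p q - c * B p q by rewrite
    !mxE.
  have pNq : p != q by rewrite -val_eqE /=; lia.
  have pNp : (p == rev_ord p) = false by rewrite -val_eqE /=; lia.
  have Xpp : X p (rev_ord p) = 0.
    have /in_soP/(_ p (rev_ord p)) := sX; rewrite rev_ordK => /eqP.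
    by rewrite -addr_eq0 -mulr2n mulrn_eq0 /= => /eqP.
  rewrite e bracket_lowerE simple_cartanE Xpp (negbTE pNq) pNp [q == p]eq_sym.
  by rewrite (negbTE pNq) /= !(mulr0, mul0r) !subr0.
rewrite mul0r scale0r addr0 -scalemxAr scalerA -scalerDl.
rewrite !simple_cartanE !eqxx qE.
have -> : (q == p) = false by rewrite -val_eqE /=; lia.
have -> : (p == q) = false by rewrite -val_eqE /=; lia.
have -> : (q == rev_ord p) = false by rewrite -val_eqE /=; lia.
have -> : (p == rev_ord p) = false by rewrite -val_eqE /=; lia.
rewrite eqxx /= (_ : _ + _ = X p q * (chi h *+ 2 - 1)); last by ring.
by rewrite h1 subrr mulr0 scale0r.
Qed.

End Lowering.
End SimpleLowering.

(** * The vector representation *)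

Section VectorModule.
Variables (F : numFieldType) (r : nat).
Hypothesis r_gt0 : (0 < r)%N.
Local Notation N := (2 * r).+1%N.

Lemma extremal_inj d (rho : 'M[F]_N -> 'M[F]_d) v chi c H : v != 0 ->
  extremal rho v chi -> in_so H -> diagonal H -> rho H *m v = c *: v ->
    chi H = c.
Proof.
move=> v0 ext sH dH; rewrite ext.2 // => /eqP; rewrite -subr_eq0 -scalerBl.
by rewrite scaler_eq0 (negbTE v0) orbF subr_eq0 => /eqP.
Qed.

Lemma extremal_coroot_sum d (rho : 'M[F]_N -> 'M[F]_d) v chi : so_module rho ->
  v != 0 -> extremal rho v chi -> forall H, in_so H -> diagonal H ->
  chi H = \sum_(i < r) (\sum_(k < i.+1) H (inord k) (inord k)) *
    (chi (coroot F i) / (if i.+1 == r then 2 else 1)%:R).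
Proof.
move=> sm v0 ext H sH dH; apply: (extremal_inj v0 ext) => //.
rewrite {1}[H]diagonal_simple_cartan_sum // so_module_sum // => [|i];
  last first.
  by apply/in_soZ/in_so_simple_cartan.
rewrite mulmx_suml scaler_suml; apply: eq_bigr => i _.
have sh := in_so_simple_cartan F (ltn_ord i).
have dh := @simple_cartan_diagonal F r i.
rewrite so_moduleZ // -scalemxAl ext.2 // scalerA; congr (_ * _ *: _).
rewrite coroot_simple_cartan (extremal_scale sm _ v0 ext) //.
by rewrite -[X in _ = X / _]mulr_natr mulfK // pnatr_eq0; case: ifP.
Qed.

Lemma so_module_id : so_module (id : 'M[F]_N -> 'M[F]_N).
Proof. by []. Qed.

Local Notation e0 := (delta_mx ord0 0 : 'cV[F]_N).

Lemma e0_neq0 : e0 != 0.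
Proof. by apply/eqP => /matrixP/(_ ord0 0)/eqP; rewrite !mxE eqxx oner_eq0. Qed.

Lemma extremal_id : extremal (id : 'M[F]_N -> 'M[F]_N) e0 (fun H =>
  H ord0 ord0).
Proof.
split=> [X sX uX|H sH dH]; rewrite -colE; apply/matrixP => i j; rewrite !mxE.
  exact: uX.
by rewrite [j]ord1 andbT; have [->|iN0] := eqVneq i ord0; rewrite ?mulr1 //
  mulr0 dH.
Qed.


Variables (d : nat) (rho : 'M[F]_N -> 'M[F]_d).
Hypotheses (rho_mod : so_module rho) (rho_irr : irreducible_module rho).
Variables (v : 'cV[F]_d) (chi : 'M[F]_N -> F).
Hypotheses (v_ext : extremal rho v chi) (v_neq0 : v != 0).
Hypothesis chi_e0 : forall H, in_so H -> diagonal H -> chi H = H ord0 ord0.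

Let sum_rho (X : 'M[F]_N) : 'M[F]_(d + N) := block_mx (rho X) 0 0 X.

Let sum_rhoE X x y : sum_rho X *m col_mx x y = col_mx (rho X *m x) (X *m y) :>
  'cV_(d + N).
Proof. by rewrite mul_block_col !mul0mx addr0 add0r. Qed.

Let sum_rho_mod : so_module sum_rho.
Proof.
split=> [a X Y sX sY|X Y sX sY]; rewrite /sum_rho.
  by rewrite rho_mod.1 // scale_block_mx add_block_mx !scaler0 !addr0.
rewrite rho_mod.2 // /lie_bracket !mulmx_block opp_block_mx add_block_mx.
by rewrite !(mulmx0, mul0mx, addr0, add0r, subr0, oppr0).
Qed.

Let sum_ext : extremal sum_rho (col_mx v e0) chi.
Proof.
split=> [X sX uX|H sH dH]; rewrite sum_rhoE.
  by rewrite v_ext.1 // extremal_id.1 // col_mx0.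
by rewrite v_ext.2 // extremal_id.2 // scale_col_mx chi_e0.
Qed.

(* The submodule of V + F^N generated by the sum of the two highest weight    *)
(* vectors, which turns out to be the graph of an isomorphism.                *)
Let K (x : 'cV[F]_d) (y : 'cV[F]_N) : Prop :=
  generated sum_rho (col_mx v e0) (col_mx x y).

Let K_lin a x y x' y' : K x y -> K x' y' -> K (a *: x + x') (a *: y + y').
Proof.
move=> h h'; have := generated_lin a h h'.
by rewrite scale_col_mx add_col_mx.
Qed.

Let K_act X x y : in_so X -> K x y -> K (rho X *m x) (X *m y).
Proof.
move=> sX h; have := invariant_generated sum_rho_mod sum_ext sX h.
by rewrite sum_rhoE.
Qed.

Let K_total x : exists y, K x y.
Proof.
elim: (irreducible_generated rho_mod rho_irr v_ext v_neq0 x) => {x}.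
- by exists e0; apply: generated_base.
- by move=> a x y _ [x' hx] _ [y' hy]; exists (a *: x' + y'); apply: K_lin.
- by move=> Y x sY lY _ [x' hx]; exists (Y *m x'); apply: K_act.
Qed.

(** The coefficient of v in x equals that of e0 in y throughout the generated submodule. This keeps
    (v, 0) and (0, e0) out of it. *)
Let K_low x y : K x y -> low rho chi (x - y ord0 0 *: v).
Proof.
suff h z : generated sum_rho (col_mx v e0) z ->
    low rho chi (usubmx z - dsubmx z ord0 0 *: v).
  by move/h; rewrite col_mxKu col_mxKd.
elim=> {z}.
- by rewrite col_mxKu col_mxKd mxE eqxx scale1r subrr; exact: low0.
- move=> a z z' _ hz _ hz'; rewrite !linearP /=.
  have -> : (a *: dsubmx z + dsubmx z') ord0 0 =
     a * dsubmx z ord0 0 + dsubmx z' ord0 0 by rewrite [LHS]mxE [in LHS]mxE.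
  rewrite scalerDl -scalerA opprD addrACA -scalerBr; exact: low_lin.
- move=> Y z sY lY _; rewrite -[z]vsubmxK sum_rhoE !col_mxKu !col_mxKd => hz.
  have -> : (Y *m dsubmx z) ord0 0 = 0.
    by rewrite mxE big1 // => j _; rewrite lY ?mul0r.
  rewrite scale0r subr0 -[usubmx z](subrK (dsubmx z ord0 0 *: v)) mulmxDr.
  rewrite -scalemxAr; apply: lowD; first exact: low_lower.
  by apply/lowZ/low_lower_v.
Qed.

Let K0_coord0 y : K 0 y -> y ord0 0 = 0.
Proof.
move=> /K_low; rewrite sub0r -scaleNr => /(low_multiple v_ext v_neq0)/eqP.
by rewrite oppr_eq0 => /eqP.
Qed.

Let K_injl x : K x 0 -> x = 0.
Proof.
have subK : subspace (K^~ 0).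
  split=> [|a z z' hz hz']; first by rewrite /K col_mx0; exact: generated0.
  by have := K_lin a hz hz'; rewrite scaler0 addr0.
have invK : invariant rho (K^~ 0).
  by move=> X z sX Kz; have := K_act sX Kz; rewrite mulmx0.
have [h|h] := irreducible_subspace rho_irr subK invK; first exact: h.
have : low rho chi (1 *: v).
  by have := K_low (h v); rewrite mxE scale0r subr0 scale1r.
by move=> /(low_multiple v_ext v_neq0)/eqP; rewrite oner_eq0.
Qed.

Let so_deltaM (j k : 'I_N) (y : 'cV[F]_N) : (so_delta F j k *m y) ord0 0 =
  (ord0 == j)%:R * y k 0 - (ord0 == rev_ord k)%:R * y (rev_ord j) 0.
Proof.
have e (A B : 'cV[F]_N) : (A - B) ord0 0 = A ord0 0 - B ord0 0 by rewrite !mxE.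
by rewrite mulmxBl e !mul_delta_mxE.
Qed.

Let K_injr y : K 0 y -> y = 0.
Proof.
have step j k z : K 0 z -> K 0 (so_delta F j k *m z).
  by move=> /(K_act (in_so_delta F j k)); rewrite mulmx0.
move=> Ky; apply/matrixP => a b; rewrite [b]ord1 mxE {b}.
(* [so_delta ord0 a] brings coordinate a to position 0, where it must vanish. For the last index
   this matrix is zero, and two steps through index 1 are used instead. *)
have [aT|aN] := eqVneq a (rev_ord ord0); last first.
  have := K0_coord0 (step ord0 a _ Ky); rewrite so_deltaM eqxx mul1r.
  have -> : (ord0 == rev_ord a) = false.
    by apply: contraNF aN => /eqP->; rewrite rev_ordK.
  by rewrite mul0r subr0.
pose j : 'I_N := inord 1; have jE : j = 1%N :> nat by rewrite inordK //; lia.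
have := K0_coord0 (step ord0 j _ (step j a _ Ky)).
rewrite so_deltaM eqxx mul1r (_ : ord0 == rev_ord j = false); last first.
  by rewrite -val_eqE /= jE; lia.
rewrite mul0r subr0 mulmxBl.
have e (A B : 'cV[F]_N) i : (A - B) i 0 = A i 0 - B i 0 by rewrite !mxE.
rewrite e !mul_delta_mxE eqxx mul1r (_ : j == rev_ord a = false).
  by rewrite mul0r subr0.
by rewrite aT rev_ordK -val_eqE /= jE.
Qed.

(** Let y correspond to u under the isomorphism. The grading element has pairwise distinct
    eigenvalues on the basis vectors, so y is a multiple of one of them, and relations for u carry
    over. *)
Lemma vector_module_weight (u : 'cV[F]_d) (nu : 'M[F]_N -> F) : u != 0 ->
  (forall H, in_so H -> diagonal H -> rho H *m u = nu H *: u) ->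
  exists a : 'I_N,
    [/\ forall H, in_so H -> diagonal H -> nu H = H a a,
        forall X, in_so X -> rho X *m u = 0 -> X *m delta_mx a 0 = 0 :> 'cV_N
      & forall X, in_so X -> rho X *m (rho X *m u) = 0 ->
          X *m (X *m delta_mx a 0) = 0 :> 'cV_N].
Proof.
move=> u0 unu; have [y Kuy] := K_total u.
have Hy H : in_so H -> diagonal H -> H *m y = nu H *: y.
  move=> sH dH; apply/eqP; rewrite -subr_eq0; apply/eqP/K_injr.
  have := K_lin (- nu H) Kuy (K_act sH Kuy).
  by rewrite unu // !scaleNr addNr addrC.
have Ha H a : in_so H -> diagonal H -> H a a * y a 0 = nu H * y a 0.
  move=> sH dH; have /matrixP/(_ a 0) := Hy H sH dH.
  rewrite mxE [RHS]mxE (bigD1 a) //= big1 ?addr0 // => i ia.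
  by rewrite dH ?mul0r // eq_sym.
have [a ya] : exists a, y a 0 != 0.
  apply/existsP; rewrite -negb_forall; apply: contra u0 => /forallP y0.
  apply/eqP/K_injl; suff <- : y = 0 by [].
  by apply/matrixP => i j; rewrite [j]ord1 mxE; exact/eqP/y0.
have nuE H : in_so H -> diagonal H -> nu H = H a a.
  by move=> sH dH; apply: (mulIf ya); rewrite Ha.
have yE : delta_mx a 0 = (y a 0)^-1 *: y.
  apply/matrixP => i j; rewrite [j]ord1 !mxE eqxx andbT.
  have [->|ia] := eqVneq i a; first by rewrite mulVf.
  have := Ha _ i (in_so_grading F r) (@grading_diagonal F r).
  rewrite nuE; [|exact: in_so_grading|exact: grading_diagonal].
  move=> /eqP; rewrite -subr_eq0 -mulrBl mulf_eq0 => /orP[|/eqP->]; last first.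
    by rewrite mulr0.
  rewrite !grading_mxE (_ : _ - _ = a%:R - i%:R); last by ring.
  rewrite subr_eq0 eqr_nat.
  by move=> /eqP/val_inj ai; rewrite ai eqxx in ia.
exists a; split=> // X sX Xu; rewrite yE -!scalemxAr.
  by rewrite [X *m y]K_injr ?scaler0 // -Xu; apply: K_act.
by rewrite [X *m (X *m y)]K_injr ?scaler0 // -Xu; apply: K_act => //;
  apply: K_act.
Qed.

End VectorModule.

(** * Singular vectors of the tensor product *)

Section TensorProduct.
Variables (F : numFieldType) (r d1 d2 : nat).
Local Notation N := (2 * r).+1%N.

(** A tensor as a matrix W, on which X acts by W |-> rho1(X) W + W rho2(X)^T. *)
Definition untensor (w : 'cV[F]_(d1 * d2)) : 'M[F]_(d1, d2) :=
  \matrix_(i, j) w (mxtens_index (i, j)) 0.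

Lemma untensor_eq0 w : untensor w = 0 -> w = 0.
Proof.
move=> /matrixP w0; apply/matrixP => k j; rewrite [j]ord1 mxE.
by have := w0 (mxtens_unindex k).1 (mxtens_unindex k).2;
  rewrite !mxE -surjective_pairing mxtens_unindexK.
Qed.

Lemma untensorM (A : 'M[F]_d1) (B : 'M[F]_d2) w :
  untensor (tensmx A B *m w) = A *m untensor w *m B^T.
Proof.
apply/matrixP => i j; rewrite !mxE.
rewrite (reindex (@mxtens_index d1 d2)) /=; last first.
  by exists (@mxtens_unindex d1 d2) => k _;
    rewrite ?mxtens_indexK ?mxtens_unindexK.
under [RHS]eq_bigr => k _ do rewrite mxE mulr_suml.
rewrite exchange_big pair_big /=; apply: eq_bigr => -[k k'] _ /=.
by rewrite tensmxE !mxE; ring.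
Qed.

Lemma untensor_module (rho1 : 'M[F]_N -> 'M[F]_d1) (rho2 : 'M[F]_N ->
  'M[F]_d2) X w :
  untensor (tensor_module rho1 rho2 X *m w) =
  rho1 X *m untensor w + untensor w *m (rho2 X)^T.
Proof.
have uD x y : untensor (x + y) = untensor x + untensor y.
  by apply/matrixP => i j; rewrite !mxE.
by rewrite mulmxDl uD !untensorM trmx1 mulmx1 mul1mx.
Qed.

End TensorProduct.

Section SingularVectors.
Variables (F : numFieldType) (r d1 d2 : nat).
Local Notation N := (2 * r).+1%N.
Variables (rho1 : 'M[F]_N -> 'M[F]_d1) (rho2 : 'M[F]_N -> 'M[F]_d2).
Hypotheses (rho1_mod : so_module rho1) (rho1_irr : irreducible_module rho1).
Variables (v : 'cV[F]_d1) (chi : 'M[F]_N -> F).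
Hypotheses (v_ext : extremal rho1 v chi) (v_neq0 : v != 0).
Variables (W : 'M[F]_(d1, d2)) (psi : 'M[F]_N -> F).
Hypothesis W_upper : forall X, in_so X -> upper_tri X ->
  rho1 X *m W + W *m (rho2 X)^T = 0.
Hypothesis W_diagonal : forall H, in_so H -> diagonal H ->
  rho1 H *m W + W *m (rho2 H)^T = psi H *: W.
Hypothesis W_neq0 : W != 0.

(* The component v (x) u of a singular vector of the tensor product determines *)
(* it, and satisfies the relations of the lowest weight vector of the dual of  *)
(* the first factor.                                                           *)
Lemma singular_vector_component : exists u : 'cV[F]_d2,
  [/\ u != 0,
      forall H, in_so H -> diagonal H -> rho2 H *m u = (psi H - chi H) *: u,
      forall p q : 'I_N, q = p.+1 :> nat -> (q <= r)%N ->
        chi (simple_cartan F r p) = 0 -> rho2 (so_delta F p q) *m u = 0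
    & forall p q : 'I_N, q = p.+1 :> nat -> q = r :> nat ->
        chi (simple_cartan F r p) *+ 2 = 1 ->
        rho2 (so_delta F p q) *m (rho2 (so_delta F p q) *m u) = 0].
Proof.
have [xi [xiv xi_ext]] := contragredient_highest_weight rho1_mod rho1_irr v_ext
  v_neq0.
have W_upper' X : in_so X -> upper_tri X -> rho1 X *m W = - (W *m (rho2 X)^T).
  by move=> sX uX; apply/eqP; rewrite -addr_eq0 W_upper.
have upper_delta (p q : 'I_N) : q = p.+1 :> nat -> (q <= r)%N ->
  upper_tri (so_delta F p q).
  move=> pq qr i j ij; have := @so_delta_lower F r p q pq qr j i ij.
  by rewrite -so_delta_tr mxE.
exists (xi^T *m W)^T; split.
(* If xi^T W = 0, then eta^T W = 0 for every eta generated by xi, since lower triangular elements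
   can be moved through W; such eta separate vectors. *)
- apply: contra W_neq0 => /eqP/(congr1 trmx); rewrite trmxK trmx0 => xiW.
  apply/eqP/matrixP => i j; rewrite mxE.
  suff /matrixP/(_ i 0) : col j W = 0 by rewrite !mxE.
  apply: (annihilator_trivial rho1_mod rho1_irr xi_ext xiv) => eta.
  suff geta : generated (contragredient rho1) xi eta -> eta^T *m W = 0.
    by move=> /geta etaW; rewrite colE mulmxA etaW mul0mx.
  elim=> [//|a x y _ hx _ hy|Y x sY lY _ hx].
    by rewrite linearP /= mulmxDl -scalemxAl hx hy scaler0 addr0.
  rewrite trmx_mul /contragredient trmxK -mulmxA W_upper'; [|exact: in_so_tr|].
    by rewrite mulmxN mulmxA hx mul0mx oppr0.
  exact/upper_tri_tr.
- move=> H sH dH; apply: trmx_inj; rewrite trmx_mul !trmxK linearZ /= trmxK.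
  have -> : xi^T *m W *m (rho2 H)^T = psi H *: (xi^T *m W) - xi^T *m (rho1 H *m
    W).
    by rewrite scalemxAr -W_diagonal // mulmxDr !mulmxA [RHS]addrC addKr.
  rewrite mulmxA scalerBl; congr (_ - _).
  have := xi_ext.2 H sH dH => /(congr1 trmx).
  by rewrite trmx_mul /contragredient trmxK linearZ /= diagonal_tr // => ->;
    rewrite scalemxAl.
(* The lowering operator applied to xi gives an extremal vector orthogonal to v, hence zero; moving
   it through W gives the relation for u. *)
- move=> p q pq qr h0.
  have ext := extremal_lower pq qr (contragredient_module rho1_mod) xi_ext h0.
  have := extremal_orthogonal rho1_mod rho1_irr v_ext v_neq0 ext.
  rewrite trmx_mul /contragredient trmxK so_delta_tr -mulmxA v_ext.1;
    last first.
  + exact: upper_delta.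
  + exact: in_so_delta.
  rewrite mulmx0 => /(_ erefl)/(congr1 trmx);
    rewrite trmx_mul !trmxK trmx0 => e0.
  apply: trmx_inj; rewrite trmx_mul trmxK trmx0 -mulmxA.
  apply: oppr_inj; rewrite oppr0 -mulmxN -W_upper' ?mulmxA ?e0 ?mul0mx //.
    exact: in_so_delta.
  exact: upper_delta.
- move=> p q pq qr h1; have qr' : (q <= r)%N by rewrite qr.
  have ext := extremal_lower2 pq qr' (contragredient_module rho1_mod) xi_ext qr
    h1.
  have := extremal_orthogonal rho1_mod rho1_irr v_ext v_neq0 ext.
  have sd := in_so_delta F p q; have ud := upper_delta p q pq qr'.
  rewrite !trmx_mul /contragredient !trmxK so_delta_tr -!mulmxA v_ext.1 //.
  rewrite !mulmx0 => /(_ erefl)/(congr1 trmx).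
  rewrite !trmx_mul !trmxK trmx0 => e0.
  apply: trmx_inj; rewrite !trmx_mul trmxK trmx0 -!mulmxA.
  have -> : W *m ((rho2 (so_delta F p q))^T *m (rho2 (so_delta F p q))^T) =
     rho1 (so_delta F p q) *m (rho1 (so_delta F p q) *m W).
    by rewrite W_upper' // mulmxN [rho1 _ *m (_ *m _)]mulmxA W_upper' //
      mulNmx opprK mulmxA.
  by rewrite !mulmxA in e0 *; rewrite e0 mul0mx.
Qed.

End SingularVectors.

(** * Necessary conditions for a summand of the tensor product *)

Section Admissible.
Variables (F : numFieldType) (r : nat).
Hypothesis r_ge2 : (2 <= r)%N.
Local Notation N := (2 * r).+1%N.

Lemma coroot_diagE (i : 'I_r) (a : 'I_N) : coroot F i a a =
  (((a == i :> nat) : nat)%:Z - ((a + i == 2 * r)%N : nat)%:Z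
   - ((a == i.+1 :> nat) : nat)%:Z + ((a + i.+1 == 2 * r)%N : nat)%:Z)%:~R
  *+ (if i.+1 == r then 2 else 1).
Proof.
rewrite coroot_simple_cartan mulmxnE /simple_cartan.
have e (A B : 'M[F]_N) : (A - B) a a = A a a - B a a by rewrite !mxE.
by rewrite e !cartan_mxE !eqxx !mulr1n intrD !intrB; congr (_ *+ _); ring.
Qed.

Lemma chi_simple_cartan d (rho : 'M[F]_N ->
  'M[F]_d) v chi (i : 'I_r) (p : 'I_N) :
  so_module rho -> v != 0 -> extremal rho v chi -> p = i :> nat ->
  chi (simple_cartan F r p) *+ (if i.+1 == r then 2 else 1) = chi (coroot F i).
Proof.
move=> sm v0 ext ->; rewrite coroot_simple_cartan (extremal_scale sm _ v0 ext)
  //.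
  exact: in_so_simple_cartan.
exact: simple_cartan_diagonal.
Qed.

Lemma fundamental_weight1_e0 (i : 'I_r) :
  coroot F i ord0 ord0 = (fundamental_weight r 1 0 i)%:~R.
Proof.
rewrite coroot_diagE mxE [nat_of_ord ord0]/=; have ir := ltn_ord i.
have -> : (0 + i == 2 * r)%N = false by lia.
have -> : (0 + i.+1 == 2 * r)%N = false by lia.
have -> : (0 == i.+1) = false by [].
rewrite eqSS eq_sym; case: eqP => [->|_]; last by rewrite mul0rn.
have -> : (1 == r) = false by lia.
by rewrite mulr1n.
Qed.

(** The highest weight vector of the summand becomes a singular vector of the tensor product, and
    its component u corresponds to a basis vector e_a. If [a = i.+1] or [a + i = 2 * r], the raising
    operator of node [i.+1] does not kill e_a, so the coordinate of lambda there is nonzero. If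
    [a = r.+1], the square of the last raising operator does not kill e_a, so this coordinate is not
    1. *)
Lemma admissible_weight (lambda : weight r) (l : 'I_r -> nat) :
  admissible F lambda l -> exists a : 'I_N,
  [/\ forall i : 'I_r, ((lambda + fundamental_weight r 1 - root_comb l) 0 i
        - lambda 0 i)%:~R = coroot F i a a,
      forall i : 'I_r, (a == i.+1 :> nat) || (a + i == 2 * r)%N ->
        lambda 0 i != 0
    & forall i : 'I_r, i.+1 = r -> a = r.+1 :> nat -> lambda 0 i != 1].
Proof.
move=> [d [d1 [d2 [sigma [rho1 [rho2 [[sm _ hs] [m1 irr1 h1] [m2 irr2 h2]
  ds]]]]]]].
have [inc [proj [pinc incE _]]] := ds.
have [vs [psi [vs0 vs_ext psiE]]] := highest_weight_extremal sm hs.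
have [v [chi [v0 v_ext chiE]]] := highest_weight_extremal m1 h1.
have [v2 [chi2 [v20 v2_ext chi2E]]] := highest_weight_extremal m2 h2.
pose W := untensor (inc *m vs).
have W0 : W != 0.
  apply: contra vs0 => /eqP/untensor_eq0 w0.
  by rewrite -[vs]mul1mx -pinc -mulmxA w0 mulmx0.
have WE X : in_so X -> rho1 X *m W + W *m (rho2 X)^T = untensor (inc *m (sigma
  X *m vs)).
  by move=> sX; rewrite -untensor_module !mulmxA -incE.
have Wup X : in_so X -> upper_tri X -> rho1 X *m W + W *m (rho2 X)^T = 0.
  move=> sX uX; rewrite WE // vs_ext.1 // mulmx0.
  by apply/matrixP => i j; rewrite !mxE.
have Wdg H : in_so H -> diagonal H -> rho1 H *m W + W *m (rho2 H)^T = psi H *: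
  W.
  move=> sH dH; rewrite WE // vs_ext.2 // -scalemxAr.
  by apply/matrixP => i j; rewrite !mxE.
have [u [u0 uw u1 u2]] := singular_vector_component m1 irr1 v_ext v0 Wup Wdg W0.
have chi2e H : in_so H -> diagonal H -> chi2 H = H ord0 ord0.
  move=> sH dH; rewrite (extremal_coroot_sum m2 v20 v2_ext) //.
  rewrite (extremal_coroot_sum (so_module_id F r) (e0_neq0 F r) (extremal_id F
    r)) //.
  by apply: eq_bigr => i _; rewrite chi2E fundamental_weight1_e0.
have r_gt0 : (0 < r)%N by apply: ltnW.
have [a [aE a1 a2]] := vector_module_weight r_gt0 m2 irr2 v2_ext v20 chi2e u0
  uw.
have opq (i : 'I_r) : exists p q : 'I_N, [/\ p = i :> nat,
  q = p.+1 :> nat & (q <= r)%N].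
  have hi := ltn_ord i; exists (inord i), (inord i.+1); rewrite !inordK //; lia.
exists a; split=> [i|i ai|i ir ar].
- rewrite -aE; [|exact: in_so_coroot|exact: coroot_diagonal].
  by rewrite psiE chiE rmorphB.
- have [p [q [pi pq qr]]] := opq i.
  apply/eqP => li; have h0 : chi (simple_cartan F r p) = 0.
    have := chi_simple_cartan m1 v0 v_ext pi; rewrite chiE li => /eqP.
    by rewrite mulrn_eq0; case: ifP => _ /eqP.
  have /matrixP ea := a1 _ (in_so_delta F p q) (u1 p q pq qr h0).
  have hE j : so_delta F p q j a = 0 by have := ea j 0; rewrite -colE !mxE.
  have ha := ltn_ord a; have [aq|ap] := orP ai.
    have aqE : a = q by apply/val_inj => /=; rewrite pq pi (eqP aq).
    have := hE p; rewrite so_deltaE aqE !eqxx.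
    have -> : (p == rev_ord q) = false by rewrite -val_eqE /=; lia.
    by rewrite subr0 => /eqP; rewrite oner_eq0.
  have apE : a = rev_ord p by apply/val_inj => /=; rewrite pi; lia.
  have := hE (rev_ord q); rewrite so_deltaE apE !eqxx.
  have -> : (rev_ord q == p) = false by rewrite -val_eqE /=; lia.
  by rewrite sub0r => /eqP; rewrite oppr_eq0 oner_eq0.
- have [p [q [pi pq qr]]] := opq i.
  apply/eqP => li; have h1' : chi (simple_cartan F r p) *+ 2 = 1.
    by have := chi_simple_cartan m1 v0 v_ext pi; rewrite chiE li ir eqxx.
  have q_r : q = r :> nat by rewrite pq pi.
  have := a2 _ (in_so_delta F p q) (u2 p q pq q_r h1').
  have -> : a = rev_ord p by apply/val_inj => /=; lia.
  have qq : rev_ord q = q by apply/val_inj => /=; lia.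
  rewrite /so_delta qq !mulmxBl => /matrixP/(_ p 0).
  have e (A B : 'cV[F]_N) : (A - B) p 0 = A p 0 - B p 0 by rewrite !mxE.
  have e' (A B : 'cV[F]_N) : (A - B) q 0 = A q 0 - B q 0 by rewrite !mxE.
  rewrite e !mul_delta_mxE e' !mul_delta_mxE !mxE !eqxx.
  have qp : (q == p) = false by rewrite -val_eqE /=; lia.
  have pp : (p == rev_ord p) = false by rewrite -val_eqE /=; lia.
  have pq' : (p == q) = false by rewrite eq_sym.
  have qp' : (q == rev_ord p) = false by rewrite -val_eqE /=; lia.
  rewrite ?(qp, pp, qp', pq').
  by rewrite /= => /eqP; rewrite !(mul0r, mulr0, mul1r, subr0,
    sub0r) oppr_eq0 oner_eq0.
Qed.

End Admissible.

(** * From the weight of the summand to the tuple l *)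

Section AdmissibleShape.
Variable r : nat.

Lemma sum_ord_eq (V : zmodType) (x : V) k :
  \sum_(j < r) x *+ (j == k :> nat) = x *+ (k < r)%N.
Proof.
have [kr|rk] := ltnP k r; last first.
  by rewrite big1 // => j _; rewrite (_ : _ == _ = false) //;
    have := ltn_ord j; lia.
rewrite (bigD1 (Ordinal kr)) //= eqxx big1 ?addr0 // => j jk.
by rewrite (_ : _ == _ = false) //; apply: contraNF jk => /eqP e;
  apply/eqP/val_inj.
Qed.

Definition ord_ext (l : 'I_r -> nat) (k : nat) : nat :=
  if insub k is Some i then l i else 0%N.

Lemma ord_extE (l : 'I_r -> nat) (i : 'I_r) : ord_ext l i = l i.
Proof. by rewrite /ord_ext valK. Qed.

Lemma root_form_diag (i : 'I_r) : root_form i i = if i.+1 == r then 2 else 4.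
Proof. by rewrite /root_form eqxx. Qed.

Lemma root_formE (j i : 'I_r) : j != i ->
  root_form j i = if (j.+1 == i) || (i.+1 == j) then - 2%:Z else 0.
Proof. by move=> ji; rewrite /root_form (negbTE ji). Qed.

(** A row of the Cartan matrix of type B_r; the entry -2 pairs alpha_(r-1) with the short coroot.
    [ord_ext] extends l by 0. *)
Lemma root_combE (l : 'I_r -> nat) (i : 'I_r) : let L k := (ord_ext l k)%:Z in
  root_comb l 0 i = 2 * L i
    - (if i.+1 == r then 2 else 1) * (L i.-1 *+ (0 < i)%N)
    - L i.+1 *+ (i.+1 < r)%N.
Proof.
move=> L; have ir := ltn_ord i; rewrite /root_comb summxE.
have termE (j : 'I_r) : (simple_root j *+ l j) 0 i =
    (2 * L i) *+ (j == i :> nat)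
    - ((if i.+1 == r then 2 else 1) * (L i.-1 *+ (0 < i)%N)) *+ (j == i.-1 :>
      nat)
    - L i.+1 *+ (j == i.+1 :> nat).
  have LE : (l j)%:Z = L j by rewrite /L ord_extE.
  have jr := ltn_ord j.
  rewrite mulmxnE mxE root_form_diag -[LHS]mulr_natr [(l j)%:R]natz LE.
  have [ji|ji] := eqVneq j i.
    rewrite ji root_form_diag eqxx.
    have -> : (i == i.-1 :> nat) = (i == 0%N :> nat) by lia.
    rewrite (_ : (i == i.+1 :> nat) = false); last lia.
    rewrite mulr0n subr0 mulr1n; case: (posnP i) => [i0|i_gt0].
      by rewrite mulr0n mulr0 mul0rn subr0; case: ifP.
    by rewrite mulr0n subr0; case: ifP.
  rewrite root_formE //; have ji' : (j == i :> nat) = false by rewrite val_eqE;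
    apply: negbTE.
  rewrite ji' mulr0n sub0r.
  have [ij|ij] := eqVneq j.+1 i.
    have -> : (j == i.-1 :> nat) by lia.
    have -> : (j == i.+1 :> nat) = false by lia.
    have -> : (0 < i)%N by lia.
    by rewrite /= !mulr1n subr0 -ij /=; case: ifP => _; rewrite ?mulNr.
  have [ij2|ij2] := eqVneq i.+1 j.
    rewrite -ij2; have -> : (i.+1 == i.-1)%N = false by lia.
    have -> : (i.+1 == r)%N = false by lia.
    have -> : ((2 * - 2%:Z) %/ 4)%Z = -1 by [].
    by rewrite mulr0n oppr0 sub0r mulr1n mulN1r.
  rewrite /= mulr0 div0z mul0r.
  rewrite subr0; case: (posnP i) => [i0|i_gt0];
    first by rewrite mulr0n mulr0 mul0rn oppr0.
  by have -> : (j == i.-1 :> nat) = false by lia.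
under eq_bigr => j _ do rewrite termE.
by rewrite !big_split /= !sumrN !sum_ord_eq ir (leq_ltn_trans (leq_pred _) ir)
  !mulr1n.
Qed.
End AdmissibleShape.

Section AdmissibleLength.
Variables (F : numFieldType) (r : nat).
Hypothesis r_ge2 : (2 <= r)%N.

(** The Cartan system alpha(l) = omega_1 - weight(e_a) is solved for l. With k counted from 0, the
    formula covers both (1,...,1,0,...,0) and (1,...,1,2,...,2). *)
Lemma admissible_shape (lambda : weight r) (l : 'I_r -> nat) :
  admissible F lambda l -> exists a : nat, [/\ (a <= 2 * r)%N,
      forall k : 'I_r, l k = ((k < a) + (2 * r - k <= a))%N,
      forall i : 'I_r, (a == i.+1) || (a + i == 2 * r)%N -> lambda 0 i != 0
    & forall i : 'I_r, i.+1 = r -> a = r.+1 -> lambda 0 i != 1].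
Proof.
move=> adm; have [a [aE a1 a2]] := admissible_weight r_ge2 adm.
have ar : (a <= 2 * r)%N by rewrite -ltnS.
exists a; split=> //.
pose L k := (ord_ext l k)%:Z.
have LE i : L (nat_of_ord i) = (l i)%:Z by rewrite /L ord_extE.
have eqn (i : nat) : (i < r)%N -> (i == 0)%N%:R - (2 * L i
    - (if i.+1 == r then 2 else 1) * (L i.-1 *+ (0 < i)%N)
    - L i.+1 *+ (i.+1 < r)%N) =
    (((a == i :> nat) : nat)%:Z - ((a + i == 2 * r)%N : nat)%:Z
   - ((a == i.+1 :> nat) : nat)%:Z + ((a + i.+1 == 2 * r)%N : nat)%:Z) *+ (if
     i.+1 == r then 2 else 1).
  move=> ir; have := aE (Ordinal ir); rewrite coroot_diagE -[RHS]mulrz_nat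
    -mulrzA.
  move=> /eqP; rewrite eqr_int => /eqP.
  have e (A B C : weight r) k : (A + B - C) 0 k = A 0 k + B 0 k - C 0 k by
    rewrite !mxE.
  rewrite e root_combE /=.
  have -> x y z : x + y - z - x = y - z :> int by ring.
  by rewrite mxE eqSS => ->; rewrite mulr_natr.
(* Induction from the short end: the equation of node [i.+2], at index [i.+1], expresses this
   difference by the next one. *)
have step (i : nat) : (i.+1 < r)%N -> L i.+1 - L i =
    ((i.+1 < a) + (2 * r - i.+1 <= a))%N%:Z - ((i < a) + (2 * r - i <= a))%N%:Z.
  move=> ir; have [m rE] : exists m, (i + m).+2 = r by exists (r - i.+2)%N; lia.
  elim: m i ir rE => [|m ih] i ir rE.
    have := eqn i.+1 ir; have -> : (i.+2 == r) by lia.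
    have -> : (i.+2 < r)%N = false by lia.
    rewrite /= mulr0n mulr1n subr0; lia.
  have ir' : (i.+2 < r)%N by lia.
  have := ih i.+1 ir' _; have := eqn i.+1 ir;
    rewrite ir' (_ : i.+2 == r = false); last lia.
  rewrite /= !mulr1n => h /(_ ltac:(lia)); lia.
have L0 : L 0%N = (((0 < a) + (2 * r - 0 <= a))%N)%:Z.
  have := eqn 0%N (ltnW r_ge2); have := step 0%N r_ge2.
  rewrite r_ge2 (_ : 1 == r = false); last lia.
  rewrite /= !mulr0n !mulr1n; have := ltn_ord a; lia.
have LA k : (k < r)%N -> L k = ((k < a) + (2 * r - k <= a))%N%:Z.
  by elim: k => // k ih kr; have := step k kr; rewrite (ih (ltnW kr)); lia.
by move=> k; have := LA k (ltn_ord k); rewrite LE => -[].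
Qed.
End AdmissibleLength.

(** * Reflections *)

Section Reflection.
Variable F : numFieldType.
Implicit Types a b c s p t u v w x : F.

(** Four zeros counted with multiplicity are too many for degree 3; the first combination isolates
    c3 (a - b)^3. *)
Lemma double_root_cubic (c0 c1 c2 c3 a b : F) : a != b ->
  c3 * a ^+ 3 + c2 * a ^+ 2 + c1 * a + c0 = 0 ->
  c3 * b ^+ 3 + c2 * b ^+ 2 + c1 * b + c0 = 0 ->
  3 * c3 * a ^+ 2 + 2 * c2 * a + c1 = 0 ->
  3 * c3 * b ^+ 2 + 2 * c2 * b + c1 = 0 ->
  [/\ c3 = 0, c2 = 0, c1 = 0 & c0 = 0].
Proof.
rewrite -subr_eq0 => ab Pa Pb Da Db.
have c3E : c3 = 0.
  have : c3 * (a - b) ^+ 3 = 0.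
    transitivity ((a - b) * (3 * c3 * a ^+ 2 + 2 * c2 * a + c1 + (3 * c3 * b ^+
      2 + 2 * c2 * b + c1))
      - 2 * (c3 * a ^+ 3 + c2 * a ^+ 2 + c1 * a + c0 - (c3 * b ^+ 3 + c2 * b ^+
        2 + c1 * b + c0))).
      by ring.
    by rewrite Pa Pb Da Db; ring.
  by move=> /eqP; rewrite mulf_eq0 expf_eq0 (negbTE ab) orbF => /eqP.
have c2E : c2 = 0.
  have : 2 * (c2 * (a - b)) = 0.
    transitivity (3 * c3 * a ^+ 2 + 2 * c2 * a + c1 - (3 * c3 * b ^+ 2 + 2 * c2
      * b + c1)).
      by rewrite c3E; ring.
    by rewrite Da Db subrr.
  by move=> /eqP; rewrite !mulf_eq0 pnatr_eq0 (negbTE ab) orbF => /eqP.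
have c1E : c1 = 0 by rewrite -Da c3E c2E; ring.
by split=> //; rewrite -Pa c3E c2E c1E; ring.
Qed.

(* With y = x^2 - s x + p and g = x^2 - s' x + p', the coefficients of        *)
(*   y (x z' + (w + 1) z) - x y' z = (x - u) g, where z = (x - u') / w,       *)
(* an instance of Wr(y, x^(w + 1) z) = x^w (x - u) g.                         *)
Definition reflection_rel (w u u' s p s' p' : F) : Prop :=
  [/\ (w + 1) * s + (w - 1) * u' = w * (u + s'),
      (w + 2) * p + w * s * u' = w * (p' + u * s')
    & (w + 1) * u' * p = w * u * p'].

Lemma reflection_relE w u u' s p s' p' x : reflection_rel w u u' s p s' p' ->
  (x ^+ 2 - s * x + p) * ((w + 2) * x - (w + 1) * u') - x * (2 * x - s) * (x -
    u')
  = w * (x - u) * (x ^+ 2 - s' * x + p').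
Proof.
move=> [e2 e1 e0].
transitivity (w * x ^+ 3 - ((w + 1) * s + (w - 1) * u') * x ^+ 2
  + ((w + 2) * p + w * s * u') * x - (w + 1) * u' * p); first by ring.
by rewrite e2 e1 e0; ring.
Qed.

(** The derivative in x of the identity in [reflection_relE]. *)
Lemma reflection_rel_derivE w u u' s p s' p' x : reflection_rel w u u' s p s'
  p' ->
  (w + 2) * (x ^+ 2 - s * x + p) + (2 * x - s) * w * (x - u') - 2 * x * (x - u')
  = w * (x ^+ 2 - s' * x + p' + (x - u) * (2 * x - s')).
Proof.
move=> [e2 e1 _].
transitivity (3 * w * x ^+ 2 - 2 * ((w + 1) * s + (w - 1) * u') * x
  + ((w + 2) * p + w * s * u')); first by ring.
by rewrite e2 e1; ring.
Qed.

(** At a root of g the logarithmic derivatives of y and x^(w + 1) z agree. This trades the quadratic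
    neighbour y for the linear z while raising the weight at 0 by w + 1. *)
Lemma reflection_inv_sum w u u' a b s' p' t :
  reflection_rel w u u' (a + b) (a * b) s' p' -> t ^+ 2 - s' * t + p' = 0 ->
  t != 0 -> t - u' != 0 -> t - a != 0 -> t - b != 0 ->
  (t - a)^-1 + (t - b)^-1 = (w + 1) / t + (t - u')^-1.
Proof.
move=> rel t0 tn0 tu ta tb.
have y0 : (t - a) * (t - b) != 0 by rewrite mulf_neq0.
apply: (mulIf y0); apply: (mulfI tn0); apply: (mulfI tu).
transitivity (t * (2 * t - (a + b)) * (t - u')); first by field; rewrite ta tb.
transitivity ((t ^+ 2 - (a + b) * t + a * b) * ((w + 2) * t - (w + 1) * u'));
  last first.
  by field; rewrite tu tn0.
apply/esym/eqP; rewrite -subr_eq0; apply/eqP.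
by rewrite (reflection_relE t rel) t0 mulr0.
Qed.

Section Step.
Variables (w u a b a' b' : F).
Hypotheses (w0 : w != 0) (a0 : a != 0) (b0 : b != 0) (ab : a - b != 0).
Hypotheses (au : a - u != 0) (bu : b - u != 0).
Hypotheses (aa' : a - a' != 0) (ab' : a - b' != 0).
Hypotheses (ba' : b - a' != 0) (bb' : b - b' != 0).

(** The equation y (x z' + (w + 1) z) - x y' z = G prescribes the values [ya] and [yb] of z at the
    roots of y, and [al * x + be] interpolates them. The error is a cubic vanishing at a and b; by
    the Bethe equations its derivative vanishes there too, so it is 0. *)
Lemma reflection :
  w / a + (a - u)^-1 + ((a - a')^-1 + (a - b')^-1) - 2 / (a - b) = 0 ->
  w / b + (b - u)^-1 + ((b - a')^-1 + (b - b')^-1) - 2 / (b - a) = 0 ->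
  exists u', [/\ reflection_rel w u u' (a + b) (a * b) (a' + b') (a' * b'),
                 a - u' != 0 & b - u' != 0].
Proof.
move=> eqa eqb.
pose G x := (x - u) * (x - a') * (x - b').
pose G' x := (x - a') * (x - b') + (x - u) * (x - b') + (x - u) * (x - a').
have ba : b - a != 0 by rewrite -oppr_eq0 opprB.
have Da : G' a = G a * (2 / (a - b) - w / a).
  transitivity (G a * ((a - u)^-1 + ((a - a')^-1 + (a - b')^-1))).
    by rewrite /G /G'; field; rewrite ab' aa' au.
  by congr (_ * _); apply/eqP; rewrite -subr_eq0 -eqa; apply/eqP; ring.
have Db : G' b = G b * (2 / (b - a) - w / b).
  transitivity (G b * ((b - u)^-1 + ((b - a')^-1 + (b - b')^-1))).
    by rewrite /G /G'; field; rewrite bb' ba' bu.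
  by congr (_ * _); apply/eqP; rewrite -subr_eq0 -eqb; apply/eqP; ring.
have Ga : G a != 0 by rewrite !mulf_neq0.
have Gb : G b != 0 by rewrite !mulf_neq0.
pose ya := G a / (a * (b - a)); pose yb := G b / (b * (a - b)).
have ya0 : ya != 0 by rewrite mulf_neq0 ?invr_eq0 ?mulf_neq0.
have yb0 : yb != 0 by rewrite mulf_neq0 ?invr_eq0 ?mulf_neq0.
have GaE : G a = - (a * (a - b)) * ya by rewrite /ya; field; rewrite ba a0.
have GbE : G b = - (b * (b - a)) * yb by rewrite /yb; field; rewrite ab b0.
have G'aE : G' a = w * (a - b) * ya - 2 * a * ya.
  by rewrite Da GaE; field; rewrite ab a0.
have G'bE : G' b = w * (b - a) * yb - 2 * b * yb.
  by rewrite Db GbE; field; rewrite ba b0.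
pose al := (ya - yb) / (a - b); pose be := ya - al * a.
have yaE : ya = al * a + be by rewrite /be; ring.
have ybE : yb = al * b + be by rewrite /be /al; field.
pose s := a + b; pose p := a * b; pose s' := a' + b'; pose p' := a' * b'.
have [] := @double_root_cubic ((w + 1) * p * be + u * p')
  ((w + 2) * p * al - w * s * be - (p' + u * s'))
  ((w - 1) * be - s * (w + 1) * al + u + s') (w * al - 1) a b.
- by rewrite -subr_eq0.
- transitivity (- (a * (a - b)) * ya - G a); last by rewrite GaE subrr.
  by rewrite yaE /G /s /p /s' /p'; ring.
- transitivity (- (b * (b - a)) * yb - G b); last by rewrite GbE subrr.
  by rewrite ybE /G /s /p /s' /p'; ring.
- transitivity (w * (a - b) * ya - 2 * a * ya - G' a);
  last by rewrite G'aE subrr.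
  by rewrite yaE /G' /s /p /s' /p'; ring.
- transitivity (w * (b - a) * yb - 2 * b * yb - G' b);
  last by rewrite G'bE subrr.
  by rewrite ybE /G' /s /p /s' /p'; ring.
move=> c3 c2 c1 c0.
have wal : w * al = 1 by apply/eqP; rewrite -subr_eq0 c3.
have hx x : x - (- (w * be)) = w * (al * x + be).
  by transitivity (w * al * x + w * be); [rewrite wal; ring | ring].
(* The leading coefficient forces [al = 1 / w], so this is the root of the interpolating
   polynomial. *)
exists (- (w * be)); split.
- split; apply/eqP; rewrite -subr_eq0; apply/eqP.
  + transitivity (- w * ((w - 1) * be - s * (w + 1) * al + u + s')
       - s * (w + 1) * (w * al - 1)); first by rewrite /s /s'; ring.
    by rewrite c2 wal subrr; ring.
  + transitivity (w * ((w + 2) * p * al - w * s * be - (p' + u * s'))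
       - (w + 2) * p * (w * al - 1)); first by rewrite /p /p' /s /s'; ring.
    by rewrite c1 wal subrr; ring.
  + transitivity (- w * ((w + 1) * p * be + u * p')); first by rewrite /p /p';
    ring.
    by rewrite c0 mulr0.
- by rewrite hx -yaE mulf_neq0.
- by rewrite hx -ybE mulf_neq0.
Qed.

End Step.

(** The difference of the two cleared equations is divisible by a - b and gives a + b; their sum
    then gives a b. *)
Lemma short_reflection w u a b : a - b != 0 -> a - u != 0 -> b - u != 0 ->
  a != 0 -> b != 0 ->
  w / a + (a - u)^-1 - 1 / (a - b) = 0 ->
  w / b + (b - u)^-1 - 1 / (b - a) = 0 ->
  2 * w * (a + b) = 2 * (2 * w - 1) * u /\
  (2 * w + 1) * (a * b) = (2 * w - 1) * u ^+ 2.
Proof.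
move=> ab au bu a0 b0 eqa eqb.
have ba : b - a != 0 by rewrite -oppr_eq0 opprB.
have ea : w * (a - u) * (a - b) - a * b + a * u = 0.
  rewrite -[RHS](mulr0 (a * (a - u) * (a - b))) -eqa; field.
  by rewrite ab au a0.
have eb : w * (b - u) * (b - a) - a * b + b * u = 0.
  rewrite -[RHS](mulr0 (b * (b - u) * (b - a))) -eqb; field.
  by rewrite ba bu b0.
have e1 : w * (a + b - 2 * u) + u = 0.
  apply: (mulfI ab); rewrite mulr0 -[RHS](subrr 0) -{1}ea -eb; ring.
have e1' : w * (a + b) = (2 * w - 1) * u.
  by apply/eqP; rewrite -subr_eq0 -e1; apply/eqP; ring.
split; first by rewrite -mulrA e1' mulrA.
have two : 2 != 0 :> F by rewrite pnatr_eq0.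
apply: (mulfI two).
have e3 : 2 * ((2 * w + 1) * (a * b)) = (a + b) * (w * (a + b) + u).
  apply/eqP; rewrite -subr_eq0 -oppr_eq0 -[X in _ == X](addr0 0) -{1}ea -eb.
  by apply/eqP; ring.
transitivity (2 * u * (w * (a + b))); last by rewrite e1'; ring.
by rewrite e3 [in LHS]e1'; ring.
Qed.

End Reflection.

Lemma succ_bounds k0 k r : (k0 <= k)%N && (k.+1 < r)%N ->
  [/\ (k0 < k.+1 < r)%N, (k0.+1 < k.+2 <= r)%N, (k0 < k.+2 <= r)%N,
      (k0 < k.+1 <= r)%N
    & [/\ (k0 <= k < r)%N, (k0 <= k.+1 < r)%N & (k.+1 == r) = false]].
Proof. by move=> h; do ?split; lia. Qed.

Lemma succ_bound k0 k r : (k0 <= k)%N && (k.+1 < r)%N -> k.+2 != r ->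
  (k0 < k.+2 < r)%N.
Proof. by move=> h1 h2; lia. Qed.

(** * Uniqueness of the quadratic polynomials *)

Section QuadraticChain.
Variables (F : numFieldType) (r k0 : nat) (w W a b : nat -> F).
Hypothesis k0r : (k0 < r)%N.

(** The logarithmic derivative of y_j at x. *)
Definition inv_sum (j : nat) (x : F) : F := (x - a j)^-1 + (x - b j)^-1.

(* The Bethe equation of colour j divided by 2, for the root t of the pair    *)
(* {t, s}; om stands for the weight at 0 and left for the contribution of the *)
(* colour j - 1.                                                              *)
Definition quad_eq (j : nat) (om left t s : F) : Prop :=
  om / t + left + (if j == r then 0 else inv_sum j.+1 t)
  - (if j == r then 1 else 2) / (t - s) = 0.

Hypothesis ab_neq : forall j, (k0 < j <= r)%N -> a j - b j != 0.
Hypothesis nbr_neq : forall j, (k0 < j < r)%N ->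
  [/\ a j - a j.+1 != 0, a j - b j.+1 != 0,
    b j - a j.+1 != 0 & b j - b j.+1 != 0].
Hypothesis w_neq0 : forall j, (k0.+1 < j <= r)%N -> w j != 0 ->
  a j != 0 /\ b j != 0.
Hypothesis w_ge0 : forall j, (k0.+1 < j <= r)%N -> 0 <= w j.
Hypothesis quad_eqs : forall j, (k0.+1 < j <= r)%N ->
  quad_eq j (w j) (inv_sum j.-1 (a j)) (a j) (b j) /\
  quad_eq j (w j) (inv_sum j.-1 (b j)) (b j) (a j).
Hypothesis W_rec : forall j, (k0 < j < r)%N -> W j.+1 = w j.+1 + W j + 1.
Hypothesis W_gt0 : 0 < W k0.+1.

Lemma W_pos j : (k0 < j <= r)%N -> 0 < W j.
Proof.
elim: j => // j ih /andP[k0j jr]; have [<-//|k0j'] := eqVneq k0 j.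
have k0_lt_j : (k0 < j)%N by lia.
rewrite W_rec ?k0_lt_j // addr_gt0 // ltr_wpDl //; first by apply: w_ge0; lia.
by apply: ih; lia.
Qed.

Lemma W_lt j : (k0 < j < r)%N -> W j + 1 <= W r.
Proof.
move=> /andP[k0j jr]; have [m rE] : exists m,
  r = (j + m).+1 by exists (r - j.+1)%N; lia.
have le i : (k0 < i < r)%N -> W i + 1 <= W i.+1.
  by move=> h; rewrite W_rec // -addrA lerDr; apply: w_ge0; lia.
suff h i : (j + i < r)%N -> W j + 1 <= W (j + i).+1.
  by rewrite [X in _ <= W X]rE; apply: h; lia.
elim: i => [|i ih] ir; first by rewrite addn0; apply: le; rewrite k0j.
apply: le_trans (ih _) _; first lia.
rewrite -addnS; apply: le_trans (le _ _); last by rewrite ir; lia.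
by rewrite lerDl.
Qed.

(** Each of the four pairs of roots t of y_j and s of y_i contributes t / (t - s) + s / (s - t) =
    1. *)
Lemma inv_sum_swap i j : a i - a j != 0 -> a i - b j != 0 -> b i - a j != 0 ->
  b i - b j != 0 -> a j * inv_sum i (a j) + b j * inv_sum i (b j) =
  4 - (a i * inv_sum j (a i) + b i * inv_sum j (b i)).
Proof.
move=> h1 h2 h3 h4; have opp x y : x - y != 0 -> y - x != 0 :> F.
  by rewrite -oppr_eq0 opprB.
have [g1 g2 g3 g4] := And4 (opp _ _ h1) (opp _ _ h2) (opp _ _ h3) (opp _ _ h4).
by rewrite /inv_sum; field; rewrite h1 h2 h3 h4 g1 g2 g3 g4.
Qed.

(** When om = 0 the quotient om / t is 0 even at t = 0, so t != 0 is required only for om != 0. *)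
Lemma quad_eq_mul j om left t s : (om != 0 -> t != 0) ->
  quad_eq j om left t s ->
  om + t * left + t * (if j == r then 0 else inv_sum j.+1 t)
  - (if j == r then 1 else 2) * (t / (t - s)) = 0.
Proof.
move=> om0 e; transitivity (t * 0); last by rewrite mulr0.
rewrite -[in t * 0]e.
have omE : t * (om / t) = om.
  have [->|/om0 t0] := eqVneq om 0; first by rewrite mul0r mulr0.
  by rewrite mulrC divfK.
set R := (if _ then 0 else _); set kap := (if _ then 1 else _).
by rewrite !mulrDr omE mulrN [t * (kap / _)]mulrCA.
Qed.

Lemma div_diff_sum x y : x - y != 0 -> x / (x - y) + y / (y - x) = 1 :> F.
Proof.
move=> xy; have yx : y - x != 0 by rewrite -oppr_eq0 opprB.
by field; rewrite xy yx.
Qed.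

Lemma quad_color_sum j om la lb : (k0 < j <= r)%N ->
  (om != 0 -> a j != 0 /\ b j != 0) ->
  quad_eq j om la (a j) (b j) -> quad_eq j om lb (b j) (a j) ->
  2 * om + (a j * la + b j * lb)
  + (if j == r then 0 else a j * inv_sum j.+1 (a j) + b j * inv_sum j.+1 (b j))
  = if j == r then 1 else 2.
Proof.
move=> hj om0 ea eb.
have comb (x y e1 e2 e3 : F) : e1 = 0 -> e2 = 0 -> e3 = 0 ->
    x - y = e1 + e2 + e3 -> x = y.
  by move=> -> -> -> /eqP; rewrite !addr0 subr_eq0 => /eqP.
have h : a j / (a j - b j) + b j / (b j - a j) - 1 = 0.
  by rewrite div_diff_sum ?subrr //; apply: ab_neq.
have h2 := congr1 ( *%R 2) h; rewrite mulr0 in h2.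
move: (quad_eq_mul (fun h => (om0 h).1) ea) (quad_eq_mul (fun h =>
  (om0 h).2) eb).
case: ifP => _ ea' eb'.
  by apply: (comb _ _ _ _ _ ea' eb' h); ring.
by apply: (comb _ _ _ _ _ ea' eb' h2); ring.
Qed.

(** Descending induction: summing the equations of colour j + 1 weighted by their roots, and
    applying [inv_sum_swap], changes the value by 2 (w_(j+1) + 1), the increment of 2 W. *)
Lemma right_sum j : (k0 < j < r)%N ->
  a j * inv_sum j.+1 (a j) + b j * inv_sum j.+1 (b j) = 2 * (W r - W j) + 1.
Proof.
move=> /andP[k0j jr]; have [m rE] : exists m,
  r = (j + m).+1 by exists (r - j.+1)%N; lia.
elim: m j k0j jr rE => [|m ih] j k0j jr rE;
  have hj : (k0.+1 < j.+1 <= r)%N by [lia];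
  have hj' : (k0 < j < r)%N by [rewrite k0j];
  have [ea eb] := quad_eqs hj; have [n1 n2 n3 n4] := nbr_neq hj';
  have hj'' : (k0 < j.+1 <= r)%N by [lia];
  have := quad_color_sum hj'' (w_neq0 hj) ea eb;
    have := inv_sum_swap n1 n2 n3 n4 => /= ->.
  have -> : j.+1 == r by lia.
  have <- : j.+1 = r by lia.
  rewrite W_rec // addr0 => h; set X := a j * inv_sum _ _ + _ in h *.
  have -> : X = 2 * w j.+1 + 4 - (2 * w j.+1 + (4 - X)) by ring.
  by rewrite h; ring.
have -> : j.+1 == r = false by lia.
rewrite (ih j.+1); [|lia|lia|lia]; rewrite W_rec // => h;
  set X := a j * inv_sum _ _ + _ in h *.
have -> : X = 2 * w j.+1 + 4 + (2 * (W r - (w j.+1 + W j + 1)) + 1)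
  - (2 * w j.+1 + (4 - X) + (2 * (W r - (w j.+1 + W j + 1)) + 1)) by ring.
by rewrite h; ring.
Qed.

(** The equations of colour [k.+1] once the quadratic colours up to k are reflected: the left
    neighbour is x - u and the weight at 0 has grown to [W k.+1]. *)
Definition state (k : nat) (u : F) : Prop :=
  [/\ a k.+1 - u != 0, b k.+1 - u != 0, a k.+1 != 0 /\ b k.+1 != 0,
      quad_eq k.+1 (W k.+1) (a k.+1 - u)^-1 (a k.+1) (b k.+1)
    & quad_eq k.+1 (W k.+1) (b k.+1 - u)^-1 (b k.+1) (a k.+1)].

(** The weighted sum of the reflected equations. The value depends neither on k nor on u, and being
    positive it shows that u != 0. *)
Lemma state_left_sum k u : (k0 <= k < r)%N -> state k u ->
  u * inv_sum k.+1 u = 2 * W r + 1.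
Proof.
move=> /andP[k0k kr] [au bu ab0 ea eb].
have hk : (k0 < k.+1 <= r)%N by lia.
have := quad_color_sum hk (fun _ => ab0) ea eb.
have -> : a k.+1 * (a k.+1 - u)^-1 + b k.+1 * (b k.+1 - u)^-1 = 2 - u * inv_sum
  k.+1 u.
  have ua : u - a k.+1 != 0 by rewrite -oppr_eq0 opprB.
  have ub : u - b k.+1 != 0 by rewrite -oppr_eq0 opprB.
  by rewrite /inv_sum; field; rewrite au ua bu ub.
set X := u * inv_sum _ _; case: eqP => [<-|/eqP kNr].
  rewrite addr0 => h; have -> : X = 2 * W k.+1 + 2 - (2 * W k.+1 + (2 - X)) by
    ring.
  by rewrite h; ring.
rewrite right_sum => [h|]; last by lia.
have -> : X = 2 * W k.+1 + 2 + (2 * (W r - W k.+1) + 1)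
  - (2 * W k.+1 + (2 - X) + (2 * (W r - W k.+1) + 1)) by ring.
by rewrite h; ring.
Qed.

Lemma inv_sumE j x : x - a j != 0 -> x - b j != 0 ->
  inv_sum j x * (x ^+ 2 - (a j + b j) * x + a j * b j) = 2 * x - (a j + b j).
Proof. by move=> h1 h2; rewrite /inv_sum; field; rewrite h1 h2. Qed.

Lemma state_neq0 k u : (k0 <= k < r)%N -> state k u -> u != 0.
Proof.
move=> hk st; have := state_left_sum hk st; apply: contra_eq_neq => ->.
rewrite mul0r eq_sym gt_eqF // addr_gt0 // mulr_gt0 // W_pos //; lia.
Qed.

Section NextState.
Variables (k : nat) (u u' : F).
Hypothesis hk : (k0 <= k)%N && (k.+1 < r)%N.
Hypothesis root_neq0 : a k.+1 != 0 /\ b k.+1 != 0.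
Hypothesis rel : reflection_rel (W k.+1) u u' (a k.+1 + b k.+1) (a k.+1 * b
  k.+1)
  (a k.+2 + b k.+2) (a k.+2 * b k.+2).

Let Wk_gt0 : 0 < W k.+1.
Proof. by have [_ _ _ h _] := succ_bounds hk; apply: W_pos. Qed.

Let nbr : [/\ a k.+1 - a k.+2 != 0, a k.+1 - b k.+2 != 0,
              b k.+1 - a k.+2 != 0 & b k.+1 - b k.+2 != 0].
Proof. by have [h _ _ _ _] := succ_bounds hk; apply: nbr_neq. Qed.

Let quad0 x : (x ^+ 2 - (a k.+1 + b k.+1) * x + a k.+1 * b k.+1) =
  (x - a k.+1) * (x - b k.+1).
Proof. by ring. Qed.

Let relE x : (x - a k.+2) * (x - b k.+2) = 0 ->
  (x - a k.+1) * (x - b k.+1) * ((W k.+1 + 2) * x - (W k.+1 + 1) * u')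
  = x * (2 * x - (a k.+1 + b k.+1)) * (x - u').
Proof.
move=> x0; apply/eqP; rewrite -subr_eq0 -quad0 (reflection_relE x rel).
have -> : x ^+ 2 - (a k.+2 + b k.+2) * x + a k.+2 * b k.+2 = 0.
  by rewrite -[RHS]x0; ring.
by rewrite mulr0.
Qed.

Variables t s : F.
Hypothesis ts : (t = a k.+2 /\ s = b k.+2) \/ (t = b k.+2 /\ s = a k.+2).

Let next_quad_eqs : quad_eq k.+2 (w k.+2) (inv_sum k.+1 t) t s /\
  quad_eq k.+2 (w k.+2) (inv_sum k.+1 s) s t.
Proof.
have [_ h _ _ _] := succ_bounds hk.
by have [e1 e2] := quad_eqs h; case: ts => -[-> ->]; split.
Qed.

Let t_nbr : t - a k.+1 != 0 /\ t - b k.+1 != 0.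
Proof.
have opp x y : x - y != 0 -> y - x != 0 :> F by rewrite -oppr_eq0 opprB.
by have [h1 h2 h3 h4] := nbr; case: ts => -[-> _]; split; apply: opp.
Qed.

Let s_nbr : s - a k.+1 != 0 /\ s - b k.+1 != 0.
Proof.
have opp x y : x - y != 0 -> y - x != 0 :> F by rewrite -oppr_eq0 opprB.
by have [h1 h2 h3 h4] := nbr; case: ts => -[_ ->]; split; apply: opp.
Qed.

(* A root t = 0 would force s g'(s)/g(s) = - W for the next colour, against   *)
(* the value of [right_sum].                                                  *)
Lemma next_root_neq0 : t != 0.
Proof.
apply/eqP => t0; have [a0 b0] := root_neq0.
have [_ hk2 hk3 _ _] := succ_bounds hk.
have ab2 : s - t != 0.
  by have := ab_neq hk3; case: ts => -[-> ->] //; rewrite -oppr_eq0 opprB.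
have s0 : s != 0 by move: ab2; rewrite t0 subr0.
have w0 : w k.+2 = 0.
  apply/eqP; apply: contraT => /(w_neq0 hk2)[ha hb].
  by case: ts => -[e _]; rewrite -e t0 eqxx in ha hb.
have p0 : a k.+2 * b k.+2 = 0.
  by case: ts => -[e _]; rewrite -e t0 ?mul0r ?mulr0.
have u'0 : u' = 0.
  have [_ _] := rel; rewrite p0 mulr0 => /eqP; rewrite !mulf_eq0.
  rewrite (negbTE a0) (negbTE b0) !orbF => /orP[|/eqP//].
  by rewrite gt_eqF // addr_gt0.
have [sa sb] := s_nbr.
have sE : (s - a k.+2) * (s - b k.+2) = 0.
  by case: ts => -[_ ->]; rewrite subrr ?mul0r ?mulr0.
have ls : s * inv_sum k.+1 s = W k.+1 + 2.
  have y0 : (s - a k.+1) * (s - b k.+1) != 0 by rewrite mulf_neq0.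
  have := relE sE; rewrite u'0 mulr0 !subr0 -(inv_sumE sa sb) quad0 => e.
  apply: (mulIf s0); apply: (mulIf y0); rewrite [RHS]mulrC [in RHS]e; ring.
have := quad_eq_mul (fun _ => s0) next_quad_eqs.2.
rewrite w0 ls t0 subr0 divff // add0r; case: eqP => [_|/eqP kNr].
  rewrite mulr0 addr0 mulr1 => /eqP.
  by rewrite -addrA gt_eqF // ltr_wpDr // subr_ge0 ler1n.
move=> e; have h := succ_bound hk kNr.
have := right_sum h.
have -> : a k.+2 * inv_sum k.+3 (a k.+2) + b k.+2 * inv_sum k.+3 (b k.+2) =
   s * inv_sum k.+3 s.
  by case: ts => -[<- <-]; rewrite t0 mul0r ?add0r ?addr0.
have -> : s * inv_sum k.+3 s = - W k.+1.
  by apply/eqP; rewrite -subr_eq0 -[X in _ == X]e; apply/eqP; ring.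
move=> /eqP; rewrite -subr_eq0 -oppr_eq0 opprB opprK gt_eqF //.
apply: ltr_wpDr; first exact: ltW.
rewrite ltr_wpDl // mulr_ge0 // subr_ge0; apply: le_trans (W_lt h).
by rewrite lerDl.
Qed.

(** At t = u' the relation would reduce to y(t) t = 0 with y(t) nonzero, y being the polynomial of
    colour [k.+1]. *)
Lemma next_root_neq : t - u' != 0.
Proof.
have t0 := next_root_neq0; apply: contra t0; rewrite subr_eq0 => /eqP tu.
have [ta tb] := t_nbr.
have tE : (t - a k.+2) * (t - b k.+2) = 0.
  by case: ts => -[-> _]; rewrite subrr ?mul0r ?mulr0.
have := relE tE; rewrite -tu subrr mulr0 => /eqP.
by rewrite !mulf_eq0 (negbTE ta) (negbTE tb) /= -mulrBl (_ : _ - _ = 1) ?mul1r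
  //; ring.
Qed.

Lemma next_quad_eq : quad_eq k.+2 (W k.+2) (t - u')^-1 t s.
Proof.
have t0 := next_root_neq0; have tu := next_root_neq.
have [ta tb] := t_nbr; have [e _] := next_quad_eqs.
have tE : (t - a k.+2) * (t - b k.+2) = 0.
  by case: ts => -[-> _]; rewrite subrr ?mul0r ?mulr0.
have [hk' _ _ _ _] := succ_bounds hk.
rewrite /quad_eq (W_rec hk'); rewrite /quad_eq in e.
have -> : (w k.+2 + W k.+1 + 1) / t + (t - u')^-1 = w k.+2 / t + inv_sum k.+1 t
  => //.
rewrite -[w _ + _ + 1]addrA mulrDl -addrA; congr (_ + _).
apply/esym/(reflection_inv_sum rel) => //.
by rewrite -[RHS]tE; ring.
Qed.

End NextState.

(** [reflection] supplies u'. Its ratio to u comes from the relation and its derivative at u', where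
    [state_left_sum] gives the logarithmic derivative of the next polynomial. *)
Lemma next_state k u : (k0 <= k)%N && (k.+1 < r)%N -> state k u ->
  exists u', [/\ state k.+1 u',
    reflection_rel (W k.+1) u u' (a k.+1 + b k.+1) (a k.+1 * b k.+1)
      (a k.+2 + b k.+2) (a k.+2 * b k.+2)
    & (2 * W r - W k.+1) * u' = (2 * W r - 1 - W k.+1) * u].
Proof.
move=> hk st; have [hk1 _ _ hk2 [hk' hk3 kr]] := succ_bounds hk.
have u0 := state_neq0 hk' st; have [au bu ab0 ea eb] := st.
have [n1 n2 n3 n4] := nbr_neq hk1; have W0 := lt0r_neq0 (W_pos hk2).
move: ea eb; rewrite /quad_eq kr.
move=> ea eb.
have [u' [rel au' bu']] := reflection W0 ab0.1 ab0.2 (ab_neq hk2) au bu n1 n2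
  n3 n4 ea eb.
have inl : (a k.+2 = a k.+2 /\ b k.+2 = b k.+2) \/ (a k.+2 = b k.+2 /\ b k.+2 =
  a k.+2).
  by left; split.
have inr : (b k.+2 = a k.+2 /\ a k.+2 = b k.+2) \/ (b k.+2 = b k.+2 /\ a k.+2 =
  a k.+2).
  by right; split.
have st' : state k.+1 u'.
  split; [exact: (next_root_neq hk ab0 rel inl)|exact: (next_root_neq hk ab0
    rel inr)| | |].
  - by split; [exact: (next_root_neq0 hk ab0 rel inl)|exact: (next_root_neq0 hk
    ab0 rel inr)].
  - exact: (next_quad_eq hk ab0 rel inl).
  - exact: (next_quad_eq hk ab0 rel inr).
exists u'; split=> //.
have [a2 b2 _ _ _] := st'.
have ua2 : u' - a k.+2 != 0 by rewrite -oppr_eq0 opprB.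
have ub2 : u' - b k.+2 != 0 by rewrite -oppr_eq0 opprB.
have z0 : (u' - a k.+2) * (u' - b k.+2) != 0 by rewrite mulf_neq0.
have X := state_left_sum hk3 st'.
have Y := inv_sumE ua2 ub2.
have E := reflection_relE u' rel; have := reflection_rel_derivE u' rel.
rewrite subrr !mulr0 addr0 subr0 => D.
set z := u' ^+ 2 - (a k.+2 + b k.+2) * u' + a k.+2 * b k.+2 in Y E D.
have zE : z = (u' - a k.+2) * (u' - b k.+2) by rewrite /z; ring.
rewrite -zE in z0.
apply: (mulfI W0); apply: (mulfI z0).
set y := u' ^+ 2 - (a k.+1 + b k.+1) * u' + a k.+1 * b k.+1 in E D.
have E' : y * u' = W k.+1 * (u' - u) * z by rewrite -E; ring.
have D' : (W k.+1 + 2) * (y * u') = W k.+1 * (z * u' + (u' - u) * ((2 * W r +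
  1) * z)).
  by rewrite mulrA D -X -[_ * _ * z]mulrA Y; ring.
rewrite E' in D'; apply/eqP; rewrite -subr_eq0.
apply/eqP; transitivity (W k.+1 * (z * u' + (u' - u) * ((2 * W r + 1) * z))
  - (W k.+1 + 2) * (W k.+1 * (u' - u) * z)); last by rewrite D' subrr.
by ring.
Qed.

(** u_j is the root of the linear left neighbour of y_j after the reflections and runs from left to
    right; v runs back from v_r = u_r. Starting from [short_reflection] at colour r, the reflection
    relation gives sum and product for j from those for j + 1. *)
Lemma quad_chain_unique (u v : nat -> F) : 1 < 2 * W r ->
  (forall j, (k0 < j < r)%N ->
     (2 * W r - W j) * u j.+1 = (2 * W r - 1 - W j) * u j) ->
  (forall j, (k0 < j < r)%N -> (W j + 1) * v j = W j * v j.+1) ->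
  v r = u r -> state k0 (u k0.+1) ->
  forall j, (k0 < j <= r)%N ->
    2 * W r * (a j + b j) = (2 * W r - 1) * (u j + v j) /\
    (2 * W r + 1) * (a j * b j) = (2 * W r - 1) * (u j * v j).
Proof.
move=> W1 uE vE vr st.
have n_sub_neq0 j : (k0 < j < r)%N -> 2 * W r - W j != 0.
  move=> h; rewrite gt_eqF // subr_gt0 (@lt_le_trans _ _ (W j + 1)) ?ltrDl //.
  apply: le_trans (W_lt h) _; rewrite mulr_natl mulr2n lerDl.
  by apply/ltW/W_pos; lia.
have st_all j : (k0 <= j < r)%N -> state j (u j.+1).
  elim: j => [|j ih] hj; first by have -> : 0%N = k0 by lia.
  have [<-//|k0j] := eqVneq k0 j.+1.
  have hj' : (k0 <= j)%N && (j.+1 < r)%N by lia.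
  have [|u' [st' _ u'E]] := next_state hj' (ih _); first by lia.
  suff <- : u' = u j.+2 by [].
  have h : (k0 < j.+1 < r)%N by lia.
  by apply: (mulfI (n_sub_neq0 _ h)); rewrite u'E uE.
have n_gt0 : 0 < 2 * W r by apply: lt_trans W1.
move=> j hj; have [m rE] : exists m, r = (j + m)%N by exists (r - j)%N; lia.
elim: m j hj rE => [|m ih] j hj rE.
  have {}rE : j = r by rewrite rE addn0.
  have [i iE] : exists i, r = i.+1 by exists r.-1; lia.
  have hi : (k0 <= i < r)%N by lia.
  have [] := st_all i hi; rewrite -iE /quad_eq eqxx => au bu [a0 b0].
  rewrite !addr0 => ea eb.
  have hr : (k0 < r <= r)%N by lia.
  rewrite rE vr; have [e1 e2] := short_reflection (ab_neq hr) au bu a0 b0 ea eb.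
  by rewrite e1 e2; split; ring.
have h1 : (k0 < j < r)%N by lia.
have hj1 : (k0 < j.+1 <= r)%N by lia.
have [|e1 e2] := ih j.+1 hj1; first by rewrite rE addnS.
have [i iE] : exists i, j = i.+1 by exists j.-1; lia.
have hi : (k0 <= i)%N && (i.+1 < r)%N by lia.
have hi' : (k0 <= i < r)%N by lia.
have hji : (k0 <= j < r)%N by lia.
have u1 := state_neq0 hji (st_all j hji).
have [u' [_ rel u'E]] := next_state hi (st_all i hi').
have := uE j h1; rewrite -iE in rel u'E * => uE'.
have uu' : u' = u j.+1.
  apply: (mulfI (n_sub_neq0 j h1)); by rewrite u'E uE'.
rewrite uu' in rel; have [r2 _ r0] := rel.
have W1_neq0 : W j + 1 != 0 by rewrite gt_eqF // addr_gt0 // W_pos.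
split; apply: (mulfI W1_neq0).
  apply/eqP; rewrite -subr_eq0; apply/eqP.
  transitivity (2 * W r * ((W j + 1) * (a j + b j) + (W j - 1) * u j.+1)
     - 2 * W r * (W j - 1) * u j.+1 - (2 * W r - 1) * ((W j + 1) * u j)
     - (2 * W r - 1) * ((W j + 1) * v j)); first by ring.
  rewrite r2 (vE j h1).
  transitivity (W j * (2 * W r * (a j.+1 + b j.+1)) + 2 * W r * W j * u j
     - 2 * W r * (W j - 1) * u j.+1 - (2 * W r - 1) * ((W j + 1) * u j)
     - (2 * W r - 1) * (W j * v j.+1)); first by ring.
  rewrite e1; transitivity ((2 * W r - W j) * u j.+1 - (2 * W r - 1 - W j) * u
    j).
    by ring.
  by rewrite uE' subrr.
apply: (mulfI u1).
transitivity ((2 * W r + 1) * ((W j + 1) * u j.+1 * (a j * b j)));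
  first by ring.
rewrite r0; transitivity (W j * u j * ((2 * W r + 1) * (a j.+1 * b j.+1))).
  by ring.
rewrite e2; transitivity (u j.+1 * (2 * W r - 1) * u j * (W j * v j.+1)).
  by ring.
by rewrite -(vE j h1); ring.
Qed.

End QuadraticChain.

Lemma mid_bounds k0 j r : (k0 < j < r)%N ->
  (k0 < j <= r)%N /\ (k0 < j.+1 <= r)%N.
Proof. by move=> h; split; lia. Qed.

Lemma pred_bounds k0 j r : (k0 < j.+1 <= r)%N -> k0 != j ->
  (k0 < j < r)%N /\ (k0 < j <= r)%N.
Proof. by move=> h1 h2; split; lia. Qed.

Lemma last_bound k0 j r : (k0 < j <= r)%N -> j != r -> (k0 < j < r)%N.
Proof. by move=> h1 h2; lia. Qed.

(** * The quadratic polynomials satisfy the equations *)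

Section ChainExistence.
Variables (F : numFieldType) (r k0 : nat) (n : F) (w W u v a b : nat -> F).
Hypothesis k0r : (k0 < r)%N.
Hypothesis nE : n = 2 * W r.
Hypothesis n_gt1 : 1 < n.
Hypothesis w_ge0 : forall j, (k0.+1 < j <= r)%N -> 0 <= w j.
Hypothesis W_rec : forall j, (k0 < j < r)%N -> W j.+1 = w j.+1 + W j + 1.
Hypothesis W_gt0 : 0 < W k0.+1.
Hypothesis u_gt0 : 0 < u k0.+1.
Hypothesis u_rec : forall j, (k0 < j < r)%N ->
  (n - W j) * u j.+1 = (n - 1 - W j) * u j.
Hypothesis v_rec : forall j, (k0 < j < r)%N -> (W j + 1) * v j = W j * v j.+1.
Hypothesis vr : v r = u r.
Hypothesis ab_sum : forall j, (k0 < j <= r)%N ->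
  n * (a j + b j) = (n - 1) * (u j + v j).
Hypothesis ab_prod : forall j, (k0 < j <= r)%N ->
  (n + 1) * (a j * b j) = (n - 1) * (u j * v j).

Let n_gt0 : 0 < n. Proof. exact: lt_trans n_gt1. Qed.
Let n_neq0 : n != 0. Proof. by rewrite gt_eqF. Qed.
Let n1_gt0 : 0 < n - 1. Proof. by rewrite subr_gt0. Qed.
Let n1_neq0 : n - 1 != 0. Proof. by rewrite gt_eqF. Qed.
Let n1'_gt0 : 0 < n + 1. Proof. by rewrite addr_gt0. Qed.
Let n1'_neq0 : n + 1 != 0. Proof. by rewrite gt_eqF. Qed.

Let Wj_gt0 j : (k0 < j <= r)%N -> 0 < W j.
Proof. exact: (W_pos k0r w_ge0 W_rec W_gt0). Qed.

Let n_sub_W j : (k0 < j < r)%N -> 1 <= n - 1 - 2 * W j.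
Proof.
move=> hj; have := W_lt k0r w_ge0 W_rec W_gt0 hj => h.
rewrite -subr_ge0 nE (_ : _ - _ = 2 * (W r - (W j + 1))); last by ring.
by rewrite mulr_ge0 // subr_ge0.
Qed.

Let n_sub_W1 j : (k0 < j < r)%N -> 0 < n - 1 - W j.
Proof.
move=> hj; have Wj : 0 < W j by apply: Wj_gt0; case: (mid_bounds hj).
rewrite (_ : n - 1 - W j = n - 1 - 2 * W j + W j); last by ring.
by rewrite addr_gt0 // (lt_le_trans _ (n_sub_W hj)).
Qed.

Let n_sub_W0 j : (k0 < j < r)%N -> 0 < n - W j.
Proof.
move=> hj; rewrite (_ : n - W j = n - 1 - W j + 1); last by ring.
by rewrite addr_gt0 // n_sub_W1.
Qed.

Lemma chain_u_gt0 j : (k0 < j <= r)%N -> 0 < u j.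
Proof.
elim: j => // j ih hj; have [<-//|k0j] := eqVneq k0 j.
have [hj' hj2] := pred_bounds hj k0j.
by rewrite -(pmulr_rgt0 _ (n_sub_W0 hj')) u_rec // mulr_gt0 // ?n_sub_W1 // ih.
Qed.

(* v_j / u_j < (n - 1) / (n + 1), the value for which y_j would have a double *)
(* root.                                                                      *)
Lemma chain_v_bounds j : (k0 < j <= r)%N ->
  0 < v j <= u j /\ ((j < r)%N -> (n + 1) * v j < (n - 1) * u j).
Proof.
move=> hj; have [m rE] : exists m, r = (j + m)%N.
  by exists (r - j)%N; rewrite subnKC //; case/andP: hj.
elim: m j hj rE => [|m ih] j hj rE.
  have {}rE : j = r by rewrite rE addn0.
  by rewrite rE vr lexx ltnn chain_u_gt0 ?k0r ?leqnn.
have jNr : j != r by rewrite rE -[X in X == _]addn0 eqn_add2l.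
have hj1 := last_bound hj jNr; have [_ hj2] := mid_bounds hj1.
have rE' : r = (j.+1 + m)%N by rewrite rE addnS.
have [/andP[v0 vu] _] := ih j.+1 hj2 rE'.
have uj := chain_u_gt0 hj2; have Wj := Wj_gt0 hj.
have A := n_sub_W1 hj1; have B := n_sub_W0 hj1; have C := n_sub_W hj1.
have W1 : 0 < W j + 1 by rewrite addr_gt0.
have vj : 0 < v j by rewrite -(pmulr_rgt0 _ W1) v_rec // mulr_gt0.
have key : (n + 1) * v j < (n - 1) * u j.
  rewrite -subr_gt0 -(pmulr_rgt0 _ (mulr_gt0 A W1)).
  rewrite [X in 0 < X](_ : _ = (n - 1) * (W j + 1) * ((n - 1 - W j) * u j)
     - (n - 1 - W j) * (n + 1) * ((W j + 1) * v j)); last by ring.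
  rewrite -u_rec // v_rec //.
  rewrite [X in 0 < X](_ : _ = (n * (n - 1 - 2 * W j) + 2 * W j ^+ 2 + 2 * W j)
    * u j.+1
    + (n - 1 - W j) * (n + 1) * W j * (u j.+1 - v j.+1)); last by ring.
  rewrite ltr_wpDr //.
    by apply: mulr_ge0; [apply: ltW; rewrite !mulr_gt0 | rewrite subr_ge0].
  have C' : 0 < n - 1 - 2 * W j by apply: lt_le_trans C.
  by rewrite mulr_gt0 // !addr_gt0 // mulr_gt0 // exprn_gt0.
split=> //; rewrite vj -(ler_pM2l n1'_gt0); apply: le_trans (ltW key) _.
rewrite ler_pM2r ?chain_u_gt0 // lerBlDr -addrA lerDl.
by rewrite addr_ge0.
Qed.

Let u_neq0 j : (k0 < j <= r)%N -> u j != 0.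
Proof. by move=> hj; rewrite gt_eqF // chain_u_gt0. Qed.

Let v_neq0 j : (k0 < j <= r)%N -> v j != 0.
Proof. by move=> hj; have [/andP[v0 _] _] := chain_v_bounds hj;
  rewrite gt_eqF. Qed.

Let sumE j : (k0 < j <= r)%N -> a j + b j = (n - 1) * (u j + v j) / n.
Proof. by move=> hj; rewrite -ab_sum // [RHS]mulrC mulKf. Qed.

Let prodE j : (k0 < j <= r)%N -> a j * b j = (n - 1) * (u j * v j) / (n + 1).
Proof. by move=> hj; rewrite -ab_prod // [RHS]mulrC mulKf. Qed.

Lemma chain_root_neq0 j : (k0 < j <= r)%N -> a j != 0 /\ b j != 0.
Proof.
move=> hj; have : a j * b j != 0.
  by rewrite prodE // !mulf_neq0 ?invr_eq0 ?u_neq0 ?v_neq0.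
by rewrite mulf_eq0 negb_or => /andP.
Qed.

(** The counterpart of [state_left_sum] for the explicit values: u_j y_j'(u_j) = (n + 1)
    y_j(u_j). *)
Lemma chain_quad_u j : (k0 < j <= r)%N ->
  (n + 1) * ((u j - a j) * (u j - b j)) = u j * (2 * u j - (a j + b j)).
Proof.
move=> hj; rewrite (_ : (u j - a j) * _ = u j ^+ 2 - (a j + b j) * u j + a j *
  b j).
  by rewrite prodE // sumE //; field; rewrite n1'_neq0 n_neq0.
by ring.
Qed.

(** If y_j vanished at u_j, so would its derivative by [chain_quad_u]; but a_j + b_j < 2 u_j because
    v_j <= u_j. *)
Lemma chain_root_neq_u j : (k0 < j <= r)%N -> u j - a j != 0 /\ u j - b j != 0.
Proof.
move=> hj; suff : (u j - a j) * (u j - b j) != 0.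
  by rewrite mulf_eq0 negb_or => /andP.
apply: (contraNneq _ (u_neq0 hj)) => h.
have := chain_quad_u hj; rewrite h mulr0 => /esym/eqP; rewrite mulf_eq0 =>
  /orP[//|].
rewrite sumE // (_ : _ - _ = ((n + 1) * u j - (n - 1) * v j) / n);
  last by field.
rewrite mulf_eq0 invr_eq0 (negbTE n_neq0) orbF gt_eqF // subr_gt0.
have [/andP[v0 vu] _] := chain_v_bounds hj.
apply: (@le_lt_trans _ _ ((n - 1) * u j)); first by rewrite ler_pM2l.
rewrite ltr_pM2r ?chain_u_gt0 // ltrBlDr -addrA ltrDl.
by rewrite addr_gt0.
Qed.

Lemma chain_reflection j : (k0 < j < r)%N ->
  reflection_rel (W j) (u j) (u j.+1) (a j + b j) (a j * b j)
    (a j.+1 + b j.+1) (a j.+1 * b j.+1).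
Proof.
move=> hj; have [hj1 hj2] := mid_bounds hj.
have Wj := lt0r_neq0 (Wj_gt0 hj1); have B := lt0r_neq0 (n_sub_W0 hj).
have W1 : W j + 1 != 0 by rewrite gt_eqF // addr_gt0 // Wj_gt0.
have uE : u j.+1 = (n - 1 - W j) * u j / (n - W j) by rewrite -u_rec //
  [RHS]mulrC mulKf.
have vE : v j = W j * v j.+1 / (W j + 1) by rewrite -v_rec // [RHS]mulrC mulKf.
split; rewrite ?sumE ?prodE // vE uE; field;
  by rewrite ?n_neq0 ?n1'_neq0 ?B ?W1.
Qed.

Let quadE j x : x ^+ 2 - (a j + b j) * x + a j * b j = (x - a j) * (x - b j).
Proof. by ring. Qed.

Let neq_opp x y : x - y != 0 -> y - x != 0 :> F.
Proof. by rewrite -oppr_eq0 opprB. Qed.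

(** For j = r the discriminant is computed. For j < r a double root of y_j kills the left side of
    the reflection relation and is therefore a root of y_(j+1); eliminating it leaves (n - 1) u_j =
    (n + 1) v_j, against [chain_v_bounds]. *)
Lemma chain_roots_distinct j : (k0 < j <= r)%N -> a j - b j != 0.
Proof.
move=> hj; have uj := u_neq0 hj; have vj := v_neq0 hj.
apply/negP => /eqP/subr0_eq ab.
have s2 := sumE hj; have p2 := prodE hj; rewrite -ab in s2 p2.
have [jr|jr] := eqVneq j r.
  have : n ^+ 2 * (n + 1) * ((a j + a j) ^+ 2 - 4 * (a j * a j)) = 0 by ring.
  rewrite s2 p2 (_ : v j = u j) ?jr // (_ : _ * _ = - 4 * (n - 1) * u r ^+ 2).
    by move=> /eqP; rewrite !mulf_eq0 oppr_eq0 pnatr_eq0 (negbTE n1_neq0) -jr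
      (negbTE uj).
  by field; rewrite n1'_neq0 n_neq0.
have hj1 := last_bound hj jr; have [_ hj2] := mid_bounds hj1.
have rel := chain_reflection hj1.
have Wj := lt0r_neq0 (Wj_gt0 hj); have B := lt0r_neq0 (n_sub_W0 hj1).
have W1 : W j + 1 != 0 by rewrite gt_eqF // addr_gt0 // Wj_gt0.
have := reflection_relE (a j) rel; rewrite quadE -ab subrr mul0r mul0r.
rewrite (_ : 2 * a j - (a j + a j) = 0) ?mulr0 ?mul0r ?subr0; last by ring.
move=> /esym/eqP; rewrite !mulf_eq0 (negbTE Wj) /=.
have [hua _] := chain_root_neq_u hj; rewrite (negbTE (neq_opp hua)) /= => /eqP.
have [a0 _] := chain_root_neq0 hj.
have := ab_sum hj; have := ab_prod hj; rewrite -ab.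
move: (a j) a0 => t t0 p1 s1 e.
have := congr1 (fun x => n * (n + 1) * W j * (n - W j) * x) e; rewrite mulr0.
rewrite (_ : _ * _ = n * (n + 1) * W j * (n - W j) * t ^+ 2
   - (n + 1) * W j * (n - W j) * t * (n * (a j.+1 + b j.+1))
   + n * W j * (n - W j) * ((n + 1) * (a j.+1 * b j.+1))); last by ring.
rewrite ab_sum // ab_prod //.
rewrite (_ : _ + _ = n * (n + 1) * W j * (n - W j) * t ^+ 2
   - (n + 1) * (n - 1) * t * (W j * ((n - W j) * u j.+1) + (n - W j) * (W j * v
     j.+1))
   + n * (n - 1) * ((n - W j) * u j.+1) * (W j * v j.+1)); last by ring.
rewrite u_rec // -v_rec //.
rewrite (_ : _ + _ = n * (n + 1) * W j * (n - W j) * t ^+ 2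
   - (n + 1) * (n - 1) * t * (W j * ((n - 1 - W j) * u j) + (n - W j) * ((W j +
     1) * v j))
   + n * (n - 1 - W j) * (W j + 1) * ((n - 1) * (u j * v j))); last by ring.
rewrite -p1 => e1.
have : (n + 1) * t * ((n - 1) * ((n - 1) * u j - (n + 1) * v j)) = 0.
  transitivity ((n + 1) * t * (
    (W j * (n - W j) + (n - 1 - W j) * (W j + 1)) * ((n - 1) * (u j + v j))
    - 2 * (n - 1) * (W j * ((n - 1 - W j) * u j) + (n - W j) * ((W j + 1) * v
      j)))).
    by ring.
  by rewrite -s1 -[RHS](mulr0 2) -e1; ring.
move=> /eqP; rewrite !mulf_eq0 (negbTE n1'_neq0) (negbTE n1_neq0) (negbTE t0)
  /=.
rewrite gt_eqF // subr_gt0; have [_] := chain_v_bounds hj; apply.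
by case/andP: hj1.
Qed.

Let u_succ_neq j : (k0 < j < r)%N -> u j.+1 - u j != 0.
Proof.
move=> hj; have [hj1 hj2] := mid_bounds hj.
apply/negP => /eqP/subr0_eq e; have := u_rec hj; rewrite e =>
  /(mulIf (u_neq0 hj1)).
move=> /eqP; rewrite -subr_eq0 (_ : _ - _ = 1) ?oner_eq0 //; ring.
Qed.

Let root_neq_u_succ j : (k0 < j < r)%N ->
  u j.+1 - a j != 0 /\ u j.+1 - b j != 0.
Proof.
move=> hj; have [hj1 hj2] := mid_bounds hj; have rel := chain_reflection hj.
have [z1 z2] := chain_root_neq_u hj2.
suff : (u j.+1 - a j) * (u j.+1 - b j) != 0.
  by rewrite mulf_eq0 negb_or => /andP.
have Wj := lt0r_neq0 (Wj_gt0 hj1).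
have := reflection_relE (u j.+1) rel; rewrite !quadE subrr mulr0 subr0.
apply: contra_eq_neq => ->; rewrite mul0r eq_sym.
by rewrite !mulf_neq0 // u_succ_neq.
Qed.

(** At a root t of y_j the relation reads - t y_j'(t) (t - u_(j+1)) = W_j (t - u_j) y_(j+1)(t), and
    the left side is nonzero. *)
Let no_common_root j t : (k0 < j < r)%N -> (t - a j) * (t - b j) = 0 ->
  (t - a j.+1) * (t - b j.+1) != 0.
Proof.
move=> hj t0; have [hj1 hj2] := mid_bounds hj; have rel := chain_reflection hj.
have := reflection_relE t rel; rewrite !quadE t0 mul0r sub0r.
apply: contra_eq_neq => ->; rewrite mulr0 oppr_eq0.
have [ua ub] := root_neq_u_succ hj; have [a0 b0] := chain_root_neq0 hj1.
have ab := chain_roots_distinct hj1.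
move/eqP: t0; rewrite mulf_eq0 => /orP[] /eqP/subr0_eq ->.
  rewrite (_ : 2 * _ - _ = a j - b j); last by ring.
  by rewrite !mulf_neq0 // neq_opp.
rewrite (_ : 2 * _ - _ = b j - a j); last by ring.
by rewrite !mulf_neq0 // neq_opp.
Qed.

Lemma chain_nbr_neq j : (k0 < j < r)%N ->
  [/\ a j - a j.+1 != 0, a j - b j.+1 != 0,
    b j - a j.+1 != 0 & b j - b j.+1 != 0].
Proof.
move=> hj; have ha : (a j - a j) * (a j - b j) = 0 by rewrite subrr mul0r.
have hb : (b j - a j) * (b j - b j) = 0 by rewrite subrr mulr0.
have := no_common_root hj ha; have := no_common_root hj hb.
by rewrite !mulf_eq0 !negb_or => /andP[? ?] /andP[? ?].
Qed.

(** For j < r the reflected equation follows by comparing the relation and its derivative at a root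
    of y_j; for j = r from the sum and product alone. *)
Lemma chain_quad_eq j t s : (k0 < j <= r)%N ->
  (t = a j /\ s = b j) \/ (t = b j /\ s = a j) ->
  quad_eq r a b j (W j) (t - u j)^-1 t s.
Proof.
move=> hj ts.
have sE : t + s = a j + b j by case: ts => -[-> ->] //; rewrite addrC.
have pE : t * s = a j * b j by case: ts => -[-> ->] //; rewrite mulrC.
have st : t - s != 0.
  by have ab := chain_roots_distinct hj; case: ts => -[-> ->] //;
    apply: neq_opp.
have t0 : t != 0 by have [a0 b0] := chain_root_neq0 hj; case: ts => -[-> _].
have tu : t - u j != 0.
  by have [a0 b0] := chain_root_neq_u hj; case: ts => -[-> _]; apply: neq_opp.
rewrite /quad_eq; case: eqP => [jr|/eqP jr].
  have s1 := ab_sum hj; have p1 := ab_prod hj.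
  rewrite -sE -pE jr vr -jr in s1 p1.
  have e : W j * (t - u j) * (t - s) + t * (t - s) - t * (t - u j) = 0.
    have two : 2 != 0 :> F by rewrite pnatr_eq0.
    apply: (mulfI two); rewrite mulr0.
    transitivity (t * (n * (t + s) - 2 * (n - 1) * u j) + u j * (n * (t + s))
      - 2 * ((n + 1) * (t * s))); first by rewrite nE -jr; ring.
    by rewrite s1 p1; ring.
  rewrite addr0; transitivity ((W j * (t - u j) * (t - s) + t * (t - s) - t *
    (t - u j))
    / (t * (t - u j) * (t - s))); first by field; rewrite st tu t0.
  by rewrite e mul0r.
have hj1 := last_bound hj jr; have rel := chain_reflection hj1.
have tj : (t - a j) * (t - b j) = 0 by case: ts => -[-> _];
  rewrite subrr ?mul0r ?mulr0.
have z0 := no_common_root hj1 tj.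
have /andP[za zb] : (t - a j.+1 != 0) && (t - b j.+1 != 0).
  by move: z0; rewrite mulf_eq0 negb_or.
have := reflection_relE t rel; have := reflection_rel_derivE t rel.
rewrite !quadE tj mulr0 mul0r add0r sub0r -sE => D E.
have Wj := lt0r_neq0 (Wj_gt0 hj).
have e : W j * (t - u j) * (t - s) * ((t - a j.+1) * (t - b j.+1))
    + t * (t - s) * ((t - a j.+1) * (t - b j.+1) + (t - u j) * (2 * t - (a j.+1
      + b j.+1)))
    - 2 * t * (t - u j) * ((t - a j.+1) * (t - b j.+1)) = 0.
  apply: (mulfI Wj); rewrite mulr0.
  transitivity (W j * (t - s) * (W j * (t - u j) * ((t - a j.+1) * (t - b
    j.+1)))
     + t * (t - s) * (W j * ((t - a j.+1) * (t - b j.+1) + (t - u j) * (2 * t -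
       (a j.+1 + b j.+1))))
     - 2 * t * (W j * (t - u j) * ((t - a j.+1) * (t - b j.+1))));
       first by ring.
  by rewrite -E -D; ring.
rewrite /inv_sum; transitivity ((W j * (t - u j) * (t - s) * ((t - a j.+1) * (t
  - b j.+1))
    + t * (t - s) * ((t - a j.+1) * (t - b j.+1) + (t - u j) * (2 * t - (a j.+1
      + b j.+1)))
    - 2 * t * (t - u j) * ((t - a j.+1) * (t - b j.+1)))
  / (t * (t - u j) * (t - s) * ((t - a j.+1) * (t - b j.+1)))).
  by field; rewrite st tu t0 za zb.
by rewrite e mul0r.
Qed.

(** Undoes the reflection: [reflection_inv_sum] replaces the linear neighbour and the weight W_(j+1)
    by y_j and w_(j+1). *)
Lemma chain_quad_eq_left j t s : (k0 < j < r)%N ->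
  (t = a j.+1 /\ s = b j.+1) \/ (t = b j.+1 /\ s = a j.+1) ->
  quad_eq r a b j.+1 (w j.+1) (inv_sum a b j t) t s.
Proof.
move=> hj ts; have [hj1 hj2] := mid_bounds hj; have rel := chain_reflection hj.
have := chain_quad_eq hj2 ts; rewrite /quad_eq (W_rec hj).
have t0 : t != 0 by have [a0 b0] := chain_root_neq0 hj2; case: ts => -[-> _].
have tu : t - u j.+1 != 0.
  by have [a0 b0] := chain_root_neq_u hj2; case: ts => -[-> _]; apply: neq_opp.
have tj : (t - a j.+1) * (t - b j.+1) = 0.
  by case: ts => -[-> _]; rewrite subrr ?mul0r ?mulr0.
have [h1 h2 h3 h4] := chain_nbr_neq hj.
have ta : t - a j != 0 by case: ts => -[-> _]; apply: neq_opp.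
have tb : t - b j != 0 by case: ts => -[-> _]; apply: neq_opp.
rewrite /inv_sum (reflection_inv_sum rel _ t0 tu ta tb) ?quadE //.
by rewrite -[w _ + _ + 1]addrA mulrDl -[w _ / t + _ / t + _]addrA.
Qed.

Lemma chain_left_sum : u k0.+1 * inv_sum a b k0.+1 (u k0.+1) = n + 1.
Proof.
have h : (k0 < k0.+1 <= r)%N by rewrite ltnSn.
have [h1 h2] := chain_root_neq_u h.
have y0 : (u k0.+1 - a k0.+1) * (u k0.+1 - b k0.+1) != 0 by rewrite mulf_neq0.
apply: (mulIf y0); rewrite chain_quad_u // -inv_sumE // quadE; ring.
Qed.

End ChainExistence.

(** * Chains of linear polynomials *)

Section LinearChain.
Variables (F : numFieldType) (K : nat) (w A tau : nat -> F) (ext eps : F).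
Hypothesis A_gt0 : forall j, (0 < j <= K)%N -> 0 < A j.
Hypothesis A_last : A K = w K + eps.
Hypothesis A_rec : forall j, (0 < j < K)%N -> A j = w j + A j.+1 + 1.
Hypothesis ext_eps : ext * tau K = eps.

(** [ext] is the contribution of the colour after K: 0 if there is none, otherwise the logarithmic
    derivative of the first quadratic polynomial. It enters the solution only through
    [eps = ext * tau K]. *)
Definition linear_eq (j : nat) : Prop :=
  w j / tau j + (tau j - tau j.-1)^-1
  + (if j == K then ext else (tau j - tau j.+1)^-1) = 0.

(** Descending induction: the relation for j + 1 gives tau_j / (tau_j - tau_(j+1)) = A_(j+1) + 1,
    after which the equation of colour j is linear in tau_j and tau_(j-1). *)
Lemma linear_chain_unique :
  (forall j, (0 < j <= K)%N -> w j != 0 -> tau j != 0) ->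
  (forall j, (0 < j <= K)%N -> tau j - tau j.-1 != 0) ->
  (forall j, (0 < j <= K)%N -> linear_eq j) ->
  forall j, (0 < j <= K)%N -> (A j + 1) * tau j = A j * tau j.-1.
Proof.
move=> w_neq0 nbr eqs j hj; have [m KE] : exists m, K = (j + m)%N.
  by exists (K - j)%N; rewrite subnKC //; case/andP: hj.
elim: m j hj KE => [|m ih] j hj KE.
  have {}KE : j = K by rewrite KE addn0.
  (* If tau_K = 0 then eps = 0, so w_K = A_K > 0, and a nonzero weight requires tau_K != 0. *)
  have tK : tau j != 0.
    apply/eqP => t0; have := A_gt0 hj; rewrite KE A_last -ext_eps -KE t0 mulr0
      addr0.
    have [->|/(w_neq0 j hj)] := eqVneq (w j) 0; first by rewrite ltxx.
    by rewrite t0 eqxx.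
  have jK : j == K by rewrite KE.
  have := eqs j hj; rewrite /linear_eq jK => e.
  have d := nbr j hj; apply/eqP; rewrite -subr_eq0; apply/eqP.
  rewrite KE A_last -KE -ext_eps -KE.
  transitivity (tau j * (tau j - tau j.-1) * (w j / tau j + (tau j - tau
    j.-1)^-1 + ext)).
    by field; rewrite d tK.
  by rewrite e mulr0.
have hj1 : (0 < j.+1 <= K)%N by rewrite KE addnS ltn0Sn ltnS leq_addr.
have hj2 : (0 < j < K)%N by case/andP: hj => -> _; case/andP: hj1.
have KE1 : K = (j.+1 + m)%N by rewrite KE addnS.
have r1 := ih j.+1 hj1 KE1; rewrite /= in r1.
have d := nbr j hj; have d1 := nbr j.+1 hj1; rewrite /= in d1.
have tj : tau j != 0.
  apply: contra d1 => /eqP t0; rewrite t0 mulr0 in r1; rewrite t0 subr0.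
  move/eqP: r1; rewrite mulf_eq0 => /orP[|//].
  by rewrite gt_eqF // addr_gt0 // A_gt0.
have d1' : tau j - tau j.+1 != 0 by rewrite -oppr_eq0 opprB.
have := eqs j hj; rewrite /linear_eq (_ : j == K = false); last first.
  by case/andP: hj2 => _; rewrite ltn_neqAle => /andP[/negbTE].
move=> e.
have i1 : tau j * (tau j - tau j.+1)^-1 = A j.+1 + 1.
  apply: (mulIf d1'); rewrite divfK // mulrBr r1; ring.
apply/eqP; rewrite -subr_eq0 A_rec //; apply/eqP.
transitivity (tau j * (tau j - tau j.-1) * (w j / tau j + (tau j - tau j.-1)^-1
    + (tau j - tau j.+1)^-1)); last by rewrite e mulr0.
transitivity ((w j + (tau j * (tau j - tau j.+1)^-1)) * (tau j - tau j.-1) +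
  tau j).
  by rewrite i1; ring.
by field; rewrite d1' d tj.
Qed.

Hypothesis tau0 : tau 0 != 0.
Hypothesis tau_rec : forall j, (0 < j <= K)%N ->
  (A j + 1) * tau j = A j * tau j.-1.

Lemma linear_chain_neq0 j : (j <= K)%N -> tau j != 0.
Proof.
elim: j => // j ih jK; have h : (0 < j.+1 <= K)%N by rewrite jK.
have := tau_rec h; apply: contra_eq_neq => ->.
by rewrite mulr0 eq_sym mulf_neq0 ?ih ?(ltnW jK) // gt_eqF // A_gt0.
Qed.

Lemma linear_chain_nbr j : (0 < j <= K)%N -> tau j - tau j.-1 != 0.
Proof.
move=> hj; have := tau_rec hj; apply: contra_eq_neq => /subr0_eq e.
rewrite mulrDl mul1r e -subr_eq0 addrAC subrr add0r -e linear_chain_neq0 //.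
by case/andP: hj.
Qed.

Lemma linear_chain_eq j : (0 < j <= K)%N -> linear_eq j.
Proof.
move=> hj; have d := linear_chain_nbr hj; have h : (j <= K)%N by case/andP: hj.
have tj := linear_chain_neq0 h; rewrite /linear_eq.
have i2 : tau j * (tau j - tau j.-1)^-1 = - A j.
  apply: (mulIf d); rewrite divfK //; apply/eqP; rewrite -subr_eq0; apply/eqP.
  transitivity ((A j + 1) * tau j - A j * tau j.-1); first by ring.
  by rewrite tau_rec // subrr.
apply: (mulfI tj); rewrite mulr0.
have w1 : tau j * (w j / tau j) = w j by rewrite mulrC divfK.
case: eqP => [jK|/eqP jK].
  by rewrite !mulrDr w1 i2 jK A_last mulrC ext_eps; ring.
have hj' : (0 < j < K)%N by case/andP: hj => -> jK' /=; rewrite ltn_neqAle jK.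
have hj1 : (0 < j.+1 <= K)%N by case/andP: hj'.
have d1 : tau j - tau j.+1 != 0 by rewrite -oppr_eq0 opprB;
  exact: (linear_chain_nbr hj1).
have i1 : tau j * (tau j - tau j.+1)^-1 = A j.+1 + 1.
  apply: (mulIf d1); rewrite divfK // mulrBr (tau_rec hj1) /=; ring.
by rewrite !mulrDr w1 i2 i1 A_rec //; ring.
Qed.

End LinearChain.

(** * Normalization of the Bethe equations *)

Section Normalization.
Variables (F : numFieldType) (r : nat).
Variable lambda : weight r.
Local Notation lam := (weight_coord F lambda).

(** The number (alpha_k, lambda) / 2. *)
Definition half_weight (k : nat) : F := if k == r then lam r / 2 else lam k.

(* All y in s contribute: the junk value 0^-1 = 0 takes care of y = x.        *)
Definition inv_diff_sum (s : seq F) (x : F) : F := \sum_(y <- s) (x - y)^-1.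

(* The Bethe ansatz equation divided by 2, for the sets V k of roots of the   *)
(* y_k, 0 < k <= r; the weight omega_1 at 1 plays the role of y_0 = x - 1.    *)
Definition normalized_solution (w : nat -> F) (V : nat -> seq F) : Prop :=
  forall k, (0 < k <= r)%N -> uniq (V k) /\ forall x, x \in V k ->
    [/\ w k != 0 -> x != 0,
        forall y, y \in V k.-1 -> x - y != 0
      & w k / x + inv_diff_sum (V k.-1) x + inv_diff_sum (V k.+1) x
        - (if k == r then 1 else 2) * inv_diff_sum (V k) x = 0].

Variables (m : nat) (c : 'I_m -> 'I_r).

Definition color_class (k : nat) : seq 'I_m := [seq x <- enum 'I_m | (c x).+1
  == k].

Definition root_seq (t : 'I_m -> F) (k : nat) : seq F :=
  if k is 0 then [:: 1] else [seq t x | x <- color_class k].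

Lemma mem_color_class k x : (x \in color_class k) = ((c x).+1 == k).
Proof. by rewrite mem_filter mem_enum andbT. Qed.

Lemma uniq_color_class k : uniq (color_class k).
Proof. by rewrite filter_uniq // enum_uniq. Qed.

Lemma root_seqP t k y : (0 < k)%N ->
  reflect (exists2 j, (c j).+1 = k & y = t j) (y \in root_seq t k).
Proof.
case: k => // k _; apply: (iffP mapP) => -[j].
  by rewrite mem_color_class => /eqP cj ->; exists j.
by move=> cj ->; exists j; rewrite // mem_color_class cj.
Qed.

Lemma inv_diff_sum_root_seq t k x : (0 < k)%N ->
  inv_diff_sum (root_seq t k) x = \sum_(j | (c j).+1 == k) (x - t j)^-1.
Proof.
by case: k => // k _; rewrite /inv_diff_sum /root_seq big_map big_filter
  big_enum_cond.
Qed.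

Lemma ypoly_root_seq t (k : 'I_r) :
  ypoly c t k = \prod_(y <- root_seq t k.+1) ('X - y%:P).
Proof.
rewrite /ypoly /root_seq big_map big_filter big_enum_cond.
by apply: eq_bigl => j; rewrite eqSS.
Qed.

Lemma size_color_class (l : 'I_r -> nat) (k : 'I_r) : is_coloring l c ->
  size (color_class k.+1) = l k.
Proof.
move=> [_ cl]; rewrite -cl cardsE cardE /color_class enumT !size_filter.
by apply: eq_count => x; rewrite /= eqSS.
Qed.

Lemma size_root_seq t (l : 'I_r -> nat) (k : 'I_r) : is_coloring l c ->
  size (root_seq t k.+1) = l k.
Proof. by move=> cl; rewrite size_map (size_color_class _ cl). Qed.

Lemma root_seq_succ t : root_seq t r.+1 = [::].
Proof.
apply/eqP; rewrite -size_eq0 size_map size_eq0 -[_ == _]negbK -has_filter.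
by apply/hasPn => x _; rewrite eqSS ltn_eqF.
Qed.

Lemma exists_root_seq (v : nat -> seq F) (l : 'I_r -> nat) : is_coloring l c ->
  (forall k : 'I_r, size (v k.+1) = l k) ->
  exists t, forall k : 'I_r, root_seq t k.+1 = v k.+1.
Proof.
move=> cl sv; exists (fun x => nth 0 (v (c x).+1) (index x (color_class (c
  x).+1))).
move=> k; have szv : size (color_class k.+1) = size (v k.+1).
  by rewrite sv (size_color_class _ cl).
apply: (@eq_from_nth _ 0) => [|i]; rewrite size_map // => ik.
have [x0] : exists x0 : 'I_m, true.
  by case: (color_class k.+1) ik => // x0 s _; exists x0.
rewrite (nth_map x0) // => _; set x := nth x0 _ i.
have : x \in color_class k.+1 by apply: mem_nth.
by rewrite mem_color_class => /eqP ->; rewrite index_uniq // uniq_color_class.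
Qed.

(** Equal polynomials have equal multisets of roots, so the families of pairs (colour, root) differ
    by a permutation of indices. *)
Lemma same_solutionP (t t' : 'I_m -> F) : (forall k,
  ypoly c t k = ypoly c t' k) ->
  same_solution c t t'.
Proof.
move=> yE; pose f (s : 'I_m -> F) := [tuple (c j, s j) | j < m].
have /tuple_permP[s sE] : perm_eq (f t') (f t).
  apply/allP => -[k x] _ /=; rewrite -!/(count_mem _ _).
  have count_f u : count_mem (k, x) (f u) = count_mem x (root_seq u k.+1).
    rewrite /= !count_map count_filter enumT; apply: eq_count => j /=.
    by rewrite xpair_eqE eqSS andbC.
  have pE : perm_eq (root_seq t' k.+1) (root_seq t k.+1).
  by apply: prod_XsubC_eq; rewrite -!ypoly_root_seq yE.
  by rewrite !count_f; apply/eqP/(seq.permP pE).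
exists s => i; have := congr1 (fun T : m.-tuple _ => tnth T i) (val_inj sE).
by rewrite !tnth_mktuple => -[-> ->].
Qed.

End Normalization.

Lemma uniq_map_inj (T U : eqType) (f : T -> U) (s : seq T) :
  uniq (map f s) -> {in s &, injective f}.
Proof.
elim: s => //= x s ih /andP[fx un] y z; rewrite !inE.
move=> /predU1P[->|ys] /predU1P[->|zs] // e.
- by rewrite e map_f in fx.
- by rewrite -e map_f in fx.
- exact: ih.
Qed.

Section BetheNormalized.
Variables (F : numFieldType) (r : nat).
Hypothesis r_ge2 : (2 <= r)%N.
Variable lambda : weight r.
Local Notation hw := (half_weight F lambda).

Lemma weight_coordE (i : 'I_r) : weight_coord F lambda i.+1 = (lambda 0 i)%:~R.
Proof. by rewrite /weight_coord /= valK. Qed.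

Lemma root_weight_formE (mu : weight r) (i : 'I_r) :
  root_weight_form i mu = mu 0 i * (if i.+1 == r then 1 else 2).
Proof. by rewrite /root_weight_form root_form_diag; case: ifP. Qed.

Lemma root_weight_form_lambda (i : 'I_r) :
  (root_weight_form i lambda)%:~R = 2 * hw i.+1 :> F.
Proof.
rewrite root_weight_formE /half_weight; case: eqP => [ir|_].
  have -> : weight_coord F lambda r = (lambda 0 i)%:~R by rewrite
    -weight_coordE ir.
  by rewrite mulr1 mulrC divfK // pnatr_eq0.
by rewrite weight_coordE rmorphM /= mulrC.
Qed.

Lemma root_weight_form_omega1 (i : 'I_r) :
  (root_weight_form i (fundamental_weight r 1))%:~R = (2 * (i == 0%N :>
    nat)%:R) :> F.
Proof.
rewrite root_weight_formE mxE eqSS; case: (eqVneq (i : nat) 0%N) => [->|_].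
  have -> : (1 == r) = false by lia.
  by rewrite mulr1.
by rewrite mul0r mulr0.
Qed.

Variables (m : nat) (c : 'I_m -> 'I_r) (t : 'I_m -> F).
Local Notation V := (root_seq c t).

Lemma bethe_weight_sum (i : 'I_m) :
  \sum_(s < 2 | root_weight_form (c i) (tnth [tuple lambda;
    fundamental_weight r 1] s) != 0)
    (root_weight_form (c i) (tnth [tuple lambda; fundamental_weight r 1] s))%:~R
      / (t i - tnth [tuple (0 : F); 1] s)
  = 2 * (hw (c i).+1 / t i + (c i == 0%N :> nat)%:R * (t i - 1)^-1).
Proof.
rewrite big_mkcond !big_ord_recl big_ord0 !(tnth_nth 0) /=.
have e (z : int) (y : F) : (if z != 0 then z%:~R / y else 0) = z%:~R / y.
  by case: eqP => [->|]; rewrite //= mul0r.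
rewrite !e root_weight_form_lambda root_weight_form_omega1 subr0 addr0; ring.
Qed.

Lemma bethe_root_sum (i : 'I_m) :
  \sum_(j < m | (j != i) && (root_form (c i) (c j) != 0))
     (root_form (c i) (c j))%:~R / (t i - t j)
  = 2 * ((if (c i).+1 == r then 1 else 2) * inv_diff_sum (V (c i).+1) (t i)
    - \sum_(j | (c j).+1 == c i :> nat) (t i - t j)^-1
    - inv_diff_sum (V (c i).+2) (t i)).
Proof.
rewrite !inv_diff_sum_root_seq // big_mkcond /= mulrBr mulrBr !mulr_sumr
  -!sumrN.
rewrite [X in X + _ + _]big_mkcond [X in _ + X + _]big_mkcond [X in _ + _ +
  X]big_mkcond.
rewrite -!big_split /=; apply: eq_bigr => j _.
have [->|ji] := eqVneq j i.
  rewrite subrr invr0 /= eqxx !(mulr0, oppr0).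
  by do ![case: ifP => _]; rewrite !addr0.
rewrite /= eqSS; have [cij|cij] := eqVneq (c i) (c j).
  rewrite -cij eqxx (_ : (c i).+1 == c i = false); last lia.
  rewrite (_ : (c i).+1 == (c i).+2 = false); last lia.
  rewrite !addr0 root_form_diag.
  by case: ((c i).+1 == r); rewrite /= [RHS]mulrA; congr (_ / _); ring.
have cji : (c j == c i :> nat) = false by rewrite val_eqE eq_sym; apply: negbTE.
rewrite root_formE // cji add0r.
rewrite eqSS [(c j : nat) == _]eq_sym.
have [ij|ij] := eqVneq (c i).+1 (c j).
  have -> : ((c j).+1 == c i) = false by rewrite -ij; lia.
  by rewrite add0r /= mulNr.
by case: ((c j).+1 == c i); rewrite addr0 //= mulNr.
Qed.

Lemma inv_diff_sum_pred (i : 'I_m) : inv_diff_sum (V (c i)) (t i) =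
  (c i == 0%N :> nat)%:R * (t i - 1)^-1 + \sum_(j | (c j).+1 == c i :> nat) (t
    i - t j)^-1.
Proof.
have [ci|ci] := posnP (c i).
  rewrite ci /inv_diff_sum /= big_seq1 mul1r big_pred0 ?addr0 //.
by rewrite inv_diff_sum_root_seq // mul0r add0r.
Qed.

(** Each Bethe equation is -2 times the normalized one. The [uniq] condition is the nonvanishing of
    denominators between roots of the same colour. *)
Lemma bethe_normalized :
  bethe_solution c [tuple lambda; fundamental_weight r 1] [tuple 0; 1] t <->
  normalized_solution r hw V.
Proof.
have eqE (i : 'I_m) : - \sum_(s < 2 | root_weight_form (c i) (tnth [tuple
  lambda; fundamental_weight r 1] s) != 0)
    (root_weight_form (c i) (tnth [tuple lambda; fundamental_weight r 1] s))%:~R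
      / (t i - tnth [tuple (0 : F); 1] s) +
  \sum_(j < m | (j != i) && (root_form (c i) (c j) != 0))
     (root_form (c i) (c j))%:~R / (t i - t j) =
  - 2 * (hw (c i).+1 / t i + inv_diff_sum (V (c i)) (t i) + inv_diff_sum (V (c
    i).+2) (t i)
        - (if (c i).+1 == r then 1 else 2) * inv_diff_sum (V (c i).+1) (t i)).
  rewrite bethe_weight_sum bethe_root_sum inv_diff_sum_pred.
  by case: ifP => _; ring.
have two0 : - 2 != 0 :> F by rewrite oppr_eq0 pnatr_eq0.
have lam0 (i : 'I_m) : (root_weight_form (c i) lambda != 0) = (hw (c i).+1 !=
  0).
  by rewrite -(intr_eq0 F) root_weight_form_lambda mulf_eq0 pnatr_eq0.
have om0 (i : 'I_m) : (root_weight_form (c i) (fundamental_weight r 1) != 0) =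
  (c i == 0%N :> nat).
  rewrite -(intr_eq0 F) root_weight_form_omega1 mulf_eq0 pnatr_eq0 /= pnatr_eq0.
  by rewrite eqb0 negbK.
split=> [sol k hk|sol i].
  case: k hk => // k hk; split=> [|x].
    rewrite map_inj_in_uniq ?uniq_color_class // => j j'.
    rewrite !mem_color_class => /eqP cj /eqP cj' e; apply/eqP/negPn/negP =>
      /negP jj.
    have jj' : j' != j by rewrite eq_sym; apply/negP.
    have cjj : c j' = c j by apply/val_inj => /=; case: cj' => ->;
      case: cj => ->.
    have [_ /(_ j' jj') h _] := sol j.
    have : t j - t j' != 0 by apply: h; rewrite cjj root_form_diag; case: ifP.
    by rewrite e subrr eqxx.
  move=> /root_seqP-/(_ isT)[i ci ->]; have [h1 h2] := sol i.
  rewrite eqE -ci /= => /eqP; rewrite mulf_eq0 (negbTE two0) /= => /eqP h3.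
  split=> //.
    by have := h1 ord0; rewrite !(tnth_nth 0) /= subr0 lam0.
  move=> y; have [c0|c0] := posnP (c i).
    rewrite c0 inE => /eqP->; have := h1 (lift ord0 ord0);
      rewrite !(tnth_nth 0) /=.
    by rewrite om0 c0; apply.
  move=> /root_seqP-/(_ c0)[j cj ->]; apply: h2.
    by apply: contra_eq_neq cj => ->; rewrite neq_ltn ltnSn orbT.
  rewrite root_formE; last by rewrite -val_eqE /= -cj; lia.
  by rewrite cj eqxx orbT.
have hk : (0 < (c i).+1 <= r)%N by rewrite ltn_ord.
have [un h] := sol _ hk.
have iV : t i \in V (c i).+1 by apply/root_seqP => //; exists i.
have [h1 h2 h3] := h _ iV; split.
- move=> [[|[|//]] si]; rewrite !(tnth_nth 0) /=; first by rewrite lam0 subr0.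
  by rewrite om0 => /eqP c0; apply: h2; rewrite /= c0 inE.
- move=> j ji; have [cij _|cij] := eqVneq (c i) (c j).
    apply: contra ji; rewrite subr_eq0 => /eqP tij.
    by apply/eqP; apply: (uniq_map_inj un); rewrite ?mem_color_class ?cij.
  rewrite root_formE //; case: ifP => // /orP[] /eqP cE _.
    have hj : (0 < (c j).+1 <= r)%N by rewrite ltn_ord.
    have [_ /(_ (t j)) hj'] := sol _ hj.
    have jV : t j \in V (c j).+1 by apply/root_seqP => //; exists j.
    have [_ nj _] := hj' jV; rewrite -oppr_eq0 opprB; apply: nj.
    by apply/root_seqP; rewrite /= -cE //; exists i.
  apply: h2; rewrite /=; apply/root_seqP; first by rewrite -cE.
  by exists j.
- by rewrite eqE h3 mulr0.
Qed.

End BetheNormalized.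

(** * Equations with polynomials of degree at most 1 *)

Section NormalizedLinear.
Variables (F : numFieldType) (r K : nat) (w tau : nat -> F) (V : nat -> seq F).
Hypothesis Kr : (K <= r)%N.
Hypothesis V_linear : forall k, (k <= K)%N -> V k = [:: tau k].
Hypothesis V_nil : forall k, (K < k <= r.+1)%N -> V k = [::].
Hypothesis tau0 : tau 0 != 0.
Hypothesis w_ge0 : forall k, (0 < k <= K)%N -> 0 <= w k.
Hypothesis w_last : (0 < K)%N -> 0 < w K.

(** The solution of A_K = w_K, A_k = w_k + A_(k+1) + 1; it gives the numerators in [c_short] and
    [c_mid]. *)
Definition linear_A (k : nat) : F := \sum_(k <= i < K.+1) w i + K%:R - k%:R.

Lemma linear_A_last : linear_A K = w K + 0.
Proof. by rewrite /linear_A big_nat1 addrK addr0. Qed.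

Lemma linear_A_rec k : (0 < k < K)%N -> linear_A k = w k + linear_A k.+1 + 1.
Proof.
move=> /andP[_ kK]; rewrite /linear_A big_nat_recl ?(ltnW kK) //.
rewrite [in RHS]big_add1 -natr1; ring.
Qed.

Lemma linear_A_gt0 k : (0 < k <= K)%N -> 0 < linear_A k.
Proof.
move=> /andP[k0 kK]; rewrite /linear_A -addrA -natrB //.
rewrite ltr_wpDr // big_nat_recr //=; rewrite ltr_wpDl ?w_last ?(leq_trans k0)
  //.
rewrite big_nat_cond sumr_ge0 // => i /andP[/andP[ki iK] _]; apply: w_ge0.
by rewrite (leq_trans k0 ki) ltnW.
Qed.

Lemma normalized_linear : normalized_solution r w V <->
  forall k, (0 < k <= K)%N -> (linear_A k + 1) * tau k = linear_A k * tau k.-1.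
Proof.
have e0 : 0 * tau K = 0 by rewrite mul0r.
have pK k : (k <= K)%N -> (k.-1 <= K)%N by apply: leq_trans; exact: leq_pred.
have ext k : (0 < k <= K)%N -> inv_diff_sum (V k.+1) (tau k) =
    if k == K then 0 else (tau k - tau k.+1)^-1.
  move=> /andP[k0 kK]; case: eqP => [->|/eqP kNK].
    by rewrite V_nil ?ltnSn ?ltnS // /inv_diff_sum big_nil.
  by rewrite V_linear ?ltn_neqAle ?kNK // /inv_diff_sum big_seq1.
have self k : inv_diff_sum [:: tau k] (tau k) = 0.
  by rewrite /inv_diff_sum big_seq1 subrr invr0.
split=> [sol|rel].
  have prem k : (0 < k <= K)%N -> [/\ w k != 0 -> tau k != 0,
    tau k - tau k.-1 != 0
     & linear_eq K w tau 0 k].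
    move=> hk; have /andP[k0 kK] := hk.
    have hkr : (0 < k <= r)%N by rewrite k0 (leq_trans kK).
    have [_ h] := sol k hkr; have := h (tau k); rewrite V_linear // inE eqxx.
    rewrite V_linear ?pK // ext // self mulr0 subr0.
    move=> /(_ isT)[h1 h2 h3]; split=> //; first by apply: h2; rewrite inE.
    by move: h3; rewrite /inv_diff_sum big_seq1.
  apply: (linear_chain_unique linear_A_gt0 linear_A_last linear_A_rec e0) =>
    k hk;
    by have [] := prem k hk.
move=> k /andP[k0 kr]; have [kK|Kk] := leqP k K; last first.
  by rewrite V_nil ?Kk ?(leqW kr).
have hk : (0 < k <= K)%N by rewrite k0.
rewrite V_linear //; split=> // x; rewrite inE => /eqP->.
rewrite V_linear ?pK // ext // self mulr0 subr0; split.
- by move=> _; apply: (linear_chain_neq0 linear_A_gt0 tau0 rel).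
- by move=> y; rewrite inE => /eqP->; apply: (linear_chain_nbr linear_A_gt0
  tau0 rel).
- rewrite /inv_diff_sum big_seq1.
  exact: (linear_chain_eq linear_A_gt0 linear_A_last linear_A_rec e0 tau0 rel).
Qed.

End NormalizedLinear.

(** * Equations with linear polynomials followed by quadratic ones *)

Section NormalizedQuadratic.
Variables (F : numFieldType) (r k0 : nat) (w tau a b : nat -> F) (V : nat ->
  seq F).
Hypothesis k0r : (k0 < r)%N.
Hypothesis V_linear : forall k, (k <= k0)%N -> V k = [:: tau k].
Hypothesis V_pair : forall k, (k0 < k <= r)%N -> V k = [:: a k; b k].
Hypothesis V_nil : V r.+1 = [::].
Hypothesis tau0 : tau 0 != 0.
Hypothesis w_ge0 : forall k, (0 < k <= r)%N -> 0 <= w k.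

(** The weight at 0 accumulated by the reflections, starting from w_(k0+1). *)
Definition quad_W (k : nat) : F := \sum_(k0.+1 <= i < k.+1) w i + k%:R -
  k0.+1%:R.
Local Notation n := (2 * quad_W r).

Hypothesis w_first : 0 < w k0.+1.
Hypothesis n_gt1 : 1 < n.

(** The analogue of [linear_A] with boundary term n + 1, contributed by y_(k0+1). *)
Definition quad_A (k : nat) : F :=
  \sum_(k <= i < k0.+1) w i + k0%:R - k%:R + n + 1.

Variables u v : nat -> F.
Hypothesis u_first : u k0.+1 = tau k0.
Hypothesis u_rec : forall j, (k0 < j < r)%N ->
  (n - quad_W j) * u j.+1 = (n - 1 - quad_W j) * u j.
Hypothesis v_rec : forall j, (k0 < j < r)%N ->
  (quad_W j + 1) * v j = quad_W j * v j.+1.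
Hypothesis vr : v r = u r.

Lemma quad_W_first : quad_W k0.+1 = w k0.+1.
Proof. by rewrite /quad_W big_nat1 addrK. Qed.

Lemma quad_W_rec j : (k0 < j < r)%N -> quad_W j.+1 = w j.+1 + quad_W j + 1.
Proof.
move=> /andP[k0j _]; rewrite /quad_W big_nat_recr ?(leq_trans k0j) //=.
by rewrite -natr1; ring.
Qed.

Let w_ge0' j : (k0.+1 < j <= r)%N -> 0 <= w j.
Proof. by move=> /andP[h1 h2]; apply: w_ge0;
  rewrite h2 andbT (leq_trans _ h1). Qed.

Let W_gt0 : 0 < quad_W k0.+1. Proof. by rewrite quad_W_first. Qed.

Lemma quad_A_gt0 k : (0 < k <= k0)%N -> 0 < quad_A k.
Proof.
move=> /andP[kp kk]; rewrite /quad_A -[_ + k0%:R - _]addrA -natrB // -addrA.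
rewrite ltr_wpDl //; last by rewrite addr_gt0 // (lt_trans _ n_gt1).
rewrite addr_ge0 // big_nat_cond sumr_ge0 // => i /andP[/andP[ki ik] _].
apply: w_ge0; rewrite (leq_trans kp ki) /=.
by rewrite (leq_trans _ (ltnW k0r)).
Qed.

Lemma quad_A_last : quad_A k0 = w k0 + (n + 1).
Proof. by rewrite /quad_A big_nat1 addrK addrA. Qed.

Lemma quad_A_rec k : (0 < k < k0)%N -> quad_A k = w k + quad_A k.+1 + 1.
Proof.
move=> /andP[_ kK]; rewrite /quad_A big_nat_recl ?(ltnW kK) //.
rewrite [in RHS]big_add1 -[k.+1%:R]natr1; ring.
Qed.

Let sum_linear k x : (k <= k0)%N -> inv_diff_sum (V k) x = (x - tau k)^-1.
Proof. by move=> kk; rewrite V_linear // /inv_diff_sum big_seq1. Qed.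

Let sum_pair k x : (k0 < k <= r)%N -> inv_diff_sum (V k) x = inv_sum a b k x.
Proof. by move=> kk; rewrite V_pair // /inv_diff_sum big_cons big_seq1. Qed.

Let sum_right k x : (k0 < k <= r)%N -> inv_diff_sum (V k.+1) x =
  if k == r then 0 else inv_sum a b k.+1 x.
Proof.
move=> /andP[k0k kr]; case: eqP => [->|/eqP kNr].
  by rewrite V_nil /inv_diff_sum big_nil.
by rewrite sum_pair // (ltnW (_ : (k0.+1 < k.+1)%N)) // ltn_neqAle kNr.
Qed.

Let sum_right_linear k x : (k <= k0)%N -> inv_diff_sum (V k.+1) x =
  if k == k0 then inv_sum a b k0.+1 x else (x - tau k.+1)^-1.
Proof.
move=> kk; case: eqP => [->|/eqP kN]; first by rewrite sum_pair // ltnSn.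
by rewrite sum_linear // ltn_neqAle kN.
Qed.

Let self_linear (x : F) : inv_diff_sum [:: x] x = 0.
Proof. by rewrite /inv_diff_sum big_seq1 subrr invr0. Qed.

Let self_pair1 (x y : F) : inv_diff_sum [:: x; y] x = (x - y)^-1.
Proof. by rewrite /inv_diff_sum big_cons big_seq1 subrr invr0 add0r. Qed.

Let self_pair2 (x y : F) : inv_diff_sum [:: y; x] x = (x - y)^-1.
Proof. by rewrite /inv_diff_sum big_cons big_seq1 subrr invr0 addr0. Qed.

Definition quad_values : Prop := forall j, (k0 < j <= r)%N ->
  n * (a j + b j) = (n - 1) * (u j + v j) /\
  (n + 1) * (a j * b j) = (n - 1) * (u j * v j).

Definition linear_values : Prop := forall k, (0 < k <= k0)%N ->
  (quad_A k + 1) * tau k = quad_A k * tau k.-1.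

Let pred_le k : (k <= k0)%N -> (k.-1 <= k0)%N.
Proof. by apply: leq_trans; exact: leq_pred. Qed.

Let k0S : (k0 < k0.+1 <= r)%N. Proof. by rewrite ltnSn. Qed.

(** Colour k0 + 1 starts the reflections with u = tau_(k0), and [state_left_sum] there supplies the
    boundary term of the linear chain. *)
Lemma normalized_quad_values : normalized_solution r w V ->
  quad_values /\ linear_values.
Proof.
move=> sol.
have pairP k : (k0 < k <= r)%N -> [/\ a k - b k != 0, w k != 0 ->
  a k != 0 /\ b k != 0,
    (forall y, y \in V k.-1 -> a k - y != 0 /\ b k - y != 0),
    quad_eq r a b k (w k) (inv_diff_sum (V k.-1) (a k)) (a k) (b k)
  & quad_eq r a b k (w k) (inv_diff_sum (V k.-1) (b k)) (b k) (a k)].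
  move=> hk; have kp : (0 < k)%N by case/andP: hk => /(leq_ltn_trans (leq0n _)).
  have hk' : (0 < k <= r)%N by case/andP: hk; rewrite kp.
  have [un h] := sol k hk'; have := h (a k); have := h (b k).
  move: un; rewrite V_pair //= !inE !eqxx orbT andbT => ab.
  move=> /(_ isT)[b1 b2 b3] /(_ isT)[a1 a2 a3]; split.
  - by rewrite subr_eq0.
  - by move=> w0; rewrite a1 ?b1.
  - by move=> y yV; rewrite a2 ?b2.
  - by move: a3; rewrite self_pair1 sum_right.
  - by move: b3; rewrite self_pair2 sum_right.
have ab_neq j : (k0 < j <= r)%N -> a j - b j != 0 by move=> /pairP[].
have nbr_neq j : (k0 < j < r)%N ->
    [/\ a j - a j.+1 != 0, a j - b j.+1 != 0,
      b j - a j.+1 != 0 & b j - b j.+1 != 0].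
  move=> hj; have [hj1 hj2] := mid_bounds hj; have [_ _ h _ _] := pairP _ hj2.
  have [|h1 h2] := h (a j); first by rewrite V_pair // inE eqxx.
  have [|h3 h4] := h (b j); first by rewrite V_pair // !inE eqxx orbT.
  by split; rewrite -oppr_eq0 opprB.
have wn0 j : (k0.+1 < j <= r)%N -> w j != 0 -> a j != 0 /\ b j != 0.
  by move=> /andP[h1 h2]; have [] := pairP j _; rewrite ?h2 ?(ltnW h1).
have qe j : (k0.+1 < j <= r)%N ->
    quad_eq r a b j (w j) (inv_sum a b j.-1 (a j)) (a j) (b j) /\
    quad_eq r a b j (w j) (inv_sum a b j.-1 (b j)) (b j) (a j).
  move=> /andP[h1 h2]; have hj : (k0 < j <= r)%N by rewrite h2 (ltnW h1).
  have hj1 : (k0 < j.-1 <= r)%N.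
    by case: j h1 h2 {hj} => //= j h1 h2; rewrite (ltnW h2) andbT.
  by have [_ _ _] := pairP j hj; rewrite !sum_pair.
have st : state r quad_W a b k0 (tau k0).
  have [h1 h2 h3 h4 h5] := pairP _ k0S; have [|a1 b1] := h3 (tau k0).
    by rewrite V_linear // inE.
  split=> //; first by apply: h2; rewrite gt_eqF.
    by move: h4; rewrite sum_linear // quad_W_first.
  by move: h5; rewrite sum_linear // quad_W_first.
have hk0 : (k0 <= k0 < r)%N by rewrite leqnn.
have ls := state_left_sum k0r ab_neq nbr_neq wn0 qe quad_W_rec W_gt0 hk0 st.
split.
  rewrite -u_first in st.
  exact: (quad_chain_unique k0r ab_neq nbr_neq wn0 w_ge0' qe quad_W_rec W_gt0
    n_gt1
    u_rec v_rec vr st).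
rewrite mulrC in ls.
have prem k : (0 < k <= k0)%N -> [/\ w k != 0 -> tau k != 0,
  tau k - tau k.-1 != 0
   & linear_eq k0 w tau (inv_sum a b k0.+1 (tau k0)) k].
  move=> hk; have /andP[kp kK] := hk.
  have hkr : (0 < k <= r)%N by rewrite kp (leq_trans kK (ltnW k0r)).
  have [_ h] := sol k hkr; have := h (tau k); rewrite V_linear // inE eqxx.
  rewrite V_linear ?pred_le // sum_right_linear // self_linear mulr0 subr0.
  move=> /(_ isT)[h1 h2 h3]; split=> //; first by apply: h2; rewrite inE.
  by move: h3; rewrite /linear_eq /inv_diff_sum big_seq1; case: eqP => [->|].
by apply: (linear_chain_unique quad_A_gt0 quad_A_last quad_A_rec ls) => k hk;
  have [] := prem k hk.
Qed.

Lemma quad_values_normalized : 0 < tau k0 -> quad_values -> linear_values ->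
  normalized_solution r w V.
Proof.
move=> tau_gt0 qv lv.
have ab_sum j : (k0 < j <= r)%N -> n * (a j + b j) = (n - 1) * (u j + v j).
  by move=> /qv[].
have ab_prod j : (k0 < j <= r)%N -> (n + 1) * (a j * b j) = (n - 1) * (u j * v
  j).
  by move=> /qv[].
have u_gt0 : 0 < u k0.+1 by rewrite u_first.
have rd := chain_roots_distinct k0r erefl n_gt1 w_ge0' quad_W_rec W_gt0 u_gt0
  u_rec
  v_rec vr ab_sum ab_prod.
have r0 := chain_root_neq0 k0r erefl n_gt1 w_ge0' quad_W_rec W_gt0 u_gt0 u_rec
  v_rec vr ab_prod.
have ru := chain_root_neq_u k0r erefl n_gt1 w_ge0' quad_W_rec W_gt0 u_gt0 u_rec
  v_rec vr ab_sum ab_prod.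
have nb := chain_nbr_neq k0r erefl n_gt1 w_ge0' quad_W_rec W_gt0 u_gt0 u_rec
  v_rec vr ab_sum ab_prod.
have qe := chain_quad_eq k0r erefl n_gt1 w_ge0' quad_W_rec W_gt0 u_gt0 u_rec
  v_rec vr ab_sum ab_prod.
have qel := chain_quad_eq_left k0r erefl n_gt1 w_ge0' quad_W_rec W_gt0 u_gt0
  u_rec
  v_rec vr ab_sum ab_prod.
have ls := chain_left_sum k0r erefl n_gt1 w_ge0' quad_W_rec W_gt0 u_gt0 u_rec
  v_rec vr ab_sum ab_prod.
rewrite u_first mulrC in ls.
move=> k /andP[kp kr]; have [kk|k0k] := leqP k k0.
  have hk : (0 < k <= k0)%N by rewrite kp.
  rewrite V_linear //; split=> // x; rewrite inE => /eqP->.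
  rewrite V_linear ?pred_le // sum_right_linear // self_linear mulr0 subr0;
    split.
  - by move=> _; apply: (linear_chain_neq0 quad_A_gt0 tau0 lv).
  - by move=> y; rewrite inE => /eqP->; apply: (linear_chain_nbr quad_A_gt0
    tau0 lv).
  - have := linear_chain_eq quad_A_gt0 quad_A_last quad_A_rec ls tau0 lv hk.
    by rewrite /linear_eq /inv_diff_sum big_seq1; case: eqP => [->|].
have hk : (k0 < k <= r)%N by rewrite k0k.
have [a0 b0] := r0 k hk; have ab := rd k hk; have [ua ub] := ru k hk.
have opp x y : x - y != 0 -> y - x != 0 :> F by rewrite -oppr_eq0 opprB.
rewrite V_pair //; split; first by rewrite /= inE -subr_eq0 ab.
have inl : (a k = a k /\ b k = b k) \/ (a k = b k /\ b k = a k) by left.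
have inr : (b k = a k /\ a k = b k) \/ (b k = b k /\ a k = a k) by right.
have [kE|kN] := eqVneq k k0.+1.
  subst k; have vl : V k0 = [:: tau k0] by rewrite V_linear.
  have := qe k0.+1 _ _ hk inl; have := qe k0.+1 _ _ hk inr.
  rewrite /quad_eq quad_W_first u_first => eb ea; rewrite u_first in ua ub.
  move=> x; rewrite !inE => /orP[]/eqP->; split=> //=.
  - by move=> y; rewrite vl inE => /eqP ->; apply: opp.
  - by rewrite self_pair1 sum_right // vl /inv_diff_sum big_seq1.
  - by move=> y; rewrite vl inE => /eqP ->; apply: opp.
  - by rewrite self_pair2 sum_right // vl /inv_diff_sum big_seq1.
case: k => // k in kp kr k0k hk a0 b0 ab ua ub inl inr kN *.
have hj : (k0 < k < r)%N by rewrite kr andbT ltn_neqAle -eqSS eq_sym kN -ltnS.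
have [hj1 _] := mid_bounds hj.
have [n1 n2 n3 n4] := nb k hj.
have := qel k _ _ hj inl; have := qel k _ _ hj inr; rewrite /quad_eq => eb ea.
move=> x; rewrite !inE => /orP[]/eqP->; split=> //=.
- by move=> y; rewrite V_pair // !inE => /orP[]/eqP->; apply: opp.
- by rewrite self_pair1 sum_right // sum_pair.
- by move=> y; rewrite V_pair // !inE => /orP[]/eqP->; apply: opp.
- by rewrite self_pair2 sum_right // sum_pair.
Qed.

End NormalizedQuadratic.

(** * The explicit solution *)

Section Formulas.
Variables (F : numFieldType) (r : nat) (lambda : weight r).
Hypothesis lambda_dom : dominant lambda.
Local Notation lam := (weight_coord F lambda).
Local Notation w := (half_weight F lambda).

Lemma weight_coord_ge0 k : (0 < k <= r)%N -> 0 <= lam k.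
Proof.
case: k => // k /= kr; have := weight_coordE F lambda (Ordinal kr).
by rewrite /= => ->; rewrite ler0z; apply: lambda_dom.
Qed.

Lemma half_weight_ge0 k : (0 < k <= r)%N -> 0 <= w k.
Proof.
move=> hk; rewrite /half_weight; case: eqP => [_|_];
  last exact: weight_coord_ge0.
by rewrite divr_ge0 // weight_coord_ge0 // leqnn andbT; case/andP: hk =>
  ? /(leq_trans _)->.
Qed.

Lemma half_weight_gt0 (i : 'I_r) : lambda 0 i != 0 -> 0 < w i.+1.
Proof.
move=> li; have h : (0 < i.+1 <= r)%N by rewrite ltn_ord.
rewrite lt0r half_weight_ge0 // andbT /half_weight.
have e : lam i.+1 != 0 by rewrite weight_coordE intr_eq0.
case: ifP => [/eqP ir|//]; have -> : lam r = lam i.+1 by rewrite ir.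
by rewrite mulf_neq0 // invr_eq0 pnatr_eq0.
Qed.

Lemma sum_half_weight lo hi : (hi <= r)%N ->
  \sum_(lo <= i < hi) w i = \sum_(lo <= i < hi) lam i.
Proof.
move=> hr; apply: eq_big_nat => i /andP[_ ih].
by rewrite /half_weight ltn_eqF // (leq_trans ih).
Qed.

Lemma sum_half_weight_last lo : (lo <= r)%N ->
  \sum_(lo <= i < r.+1) w i = \sum_(lo <= i < r) lam i + lam r / 2.
Proof.
by move=> lr; rewrite big_nat_recr //= sum_half_weight // /half_weight eqxx.
Qed.

Lemma c_shortE K k : (K < r)%N ->
  c_short K lam k = \prod_(1 <= i < k.+1) (linear_A K w i / (linear_A K w i +
    1)).
Proof. by move=> Kr; apply: eq_bigr => i _;
  rewrite /linear_A sum_half_weight. Qed.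

Lemma c_midE k : (k <= r)%N ->
  c_mid r lam k = \prod_(1 <= i < k.+1) (linear_A r w i / (linear_A r w i + 1)).
Proof.
move=> kr; apply: eq_big_nat => i /andP[_ ik].
by rewrite /linear_A sum_half_weight_last // (leq_trans _ kr).
Qed.

Section Long.
Variable L : nat.
Hypothesis L_bounds : (r < L <= 2 * r)%N.
Local Notation k0 := (2 * r - L)%N.
Local Notation n := (2 * quad_W k0 w r).

Lemma k0_lt_r : (k0 < r)%N. Proof. by lia. Qed.

Lemma natr_L : L%:R = 2 * r%:R - k0%:R :> F.
Proof. by rewrite natrB ?natrM; [ring | case/andP: L_bounds]. Qed.

Lemma quad_nE : n = 2 * (\sum_(k0.+1 <= i < r) lam i) + lam r + 2 * r%:R - 2 *
  k0%:R - 2.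
Proof.
rewrite /quad_W sum_half_weight_last ?k0_lt_r // -[k0.+1%:R]natr1.
have two : 2 != 0 :> F by rewrite pnatr_eq0.
by field.
Qed.

Lemma M_E : M_ r L lam = n + 2.
Proof. by rewrite quad_nE /M_ natr_L; ring. Qed.

Lemma p_E j : (0 < j <= k0)%N -> p_ r L lam j = quad_A r k0 w j.
Proof.
move=> _; rewrite /p_ /quad_A quad_nE natr_L sum_half_weight ?k0_lt_r //; ring.
Qed.

Lemma q_E j : (k0 < j < r)%N -> q_ r L lam j = n - 1 - quad_W k0 w j.
Proof.
move=> /andP[k0j jr]; rewrite /q_ quad_nE /quad_W sum_half_weight //
  natr_L -[k0.+1%:R]natr1.
rewrite [\sum_(k0.+1 <= i < r) _](@big_cat_nat _ _ _ j.+1) ?(leq_trans k0j) //=.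
by ring.
Qed.

Lemma rho_E j : (k0 < j < r)%N -> rho_ r L lam (r - j) = quad_W k0 w j.
Proof.
move=> /andP[k0j jr]; rewrite /rho_ /quad_W subKn ?(ltnW jr) //.
rewrite sum_half_weight // natr_L [(r - j)%:R]natrB ?(ltnW jr) //.
rewrite -[k0.+1%:R]natr1; ring.
Qed.

Hypothesis w_first : 0 < w k0.+1.
Hypothesis n_gt1 : 1 < n.
Variable T : F.
(** [chain_u] and [chain_v] are the sequences u and v in closed form; T stands for the root of
    y_(k0). *)
Definition chain_u (j : nat) : F := T * prodQ r L lam j.-1.
Definition chain_v (j : nat) : F := T * prodQ r L lam r.-1 * prodR r L lam (r -
  j).

Lemma chain_u_first : chain_u k0.+1 = T.
Proof. by rewrite /chain_u /prodQ big_geq ?mulr1. Qed.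

Let w0 i : (k0.+1 < i <= r)%N -> 0 <= w i.
Proof.
by move=> /andP[h1 h2]; apply: half_weight_ge0;
  rewrite h2 andbT (leq_ltn_trans _ h1).
Qed.

Let Wr i : (k0 < i < r)%N -> quad_W k0 w i.+1 = w i.+1 + quad_W k0 w i + 1.
Proof. by move=> hi; apply: quad_W_rec hi. Qed.

Let W1 : 0 < quad_W k0 w k0.+1.
Proof. by rewrite quad_W_first. Qed.

Let W_pos' j : (k0 < j <= r)%N -> 0 < quad_W k0 w j.
Proof. by move=> hj; apply: (W_pos k0_lt_r w0 Wr W1 hj). Qed.

Lemma chain_u_rec j : (k0 < j < r)%N ->
  (n - quad_W k0 w j) * chain_u j.+1 = (n - 1 - quad_W k0 w j) * chain_u j.
Proof.
move=> hj; have /andP[k0j jr] := hj.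
rewrite /chain_u /=; have -> : prodQ r L lam j = prodQ r L lam j.-1 *
  succ_ratio (q_ r L lam j).
  by rewrite /prodQ big_nat_recr //= prednK // (leq_ltn_trans _ k0j).
rewrite /succ_ratio q_E //.
have n0 : n - quad_W k0 w j != 0.
  have := W_lt k0_lt_r w0 Wr W1 hj => h.
  rewrite gt_eqF // (_ : _ - _ = quad_W k0 w r - (quad_W k0 w j + 1) + quad_W
    k0 w r + 1); last by ring.
  rewrite addr_gt0 // ltr_wpDl ?subr_ge0 // W_pos' // k0_lt_r leqnn //.
have -> : n - 1 - quad_W k0 w j + 1 = n - quad_W k0 w j by ring.
set nn := n - _ in n0 *; set W := n - 1 - _; by field.
Qed.

Lemma chain_v_rec j : (k0 < j < r)%N ->
  (quad_W k0 w j + 1) * chain_v j = quad_W k0 w j * chain_v j.+1.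
Proof.
move=> hj; have /andP[k0j jr] := hj.
rewrite /chain_v; have -> : (r - j = (r - j.+1).+1)%N by rewrite subnSK.
have -> : prodR r L lam (r - j.+1).+1 =
    prodR r L lam (r - j.+1) * succ_ratio (rho_ r L lam (r - j.+1).+1).
  by rewrite /prodR big_nat_recr.
rewrite subnSK // /succ_ratio rho_E //.
have : quad_W k0 w j + 1 != 0 by rewrite gt_eqF // addr_gt0 // W_pos' //
  k0j ltnW.
by move: (quad_W k0 w j) => W Wn; field.
Qed.

Lemma chain_v_last : chain_v r = chain_u r.
Proof. by rewrite /chain_v /chain_u subnn /prodR big_geq // mulr1. Qed.

Lemma ab_sumE k : T = prodP r L lam k0 ->
  ab_sum r L lam k = (n - 1) / n * (chain_u k + chain_v k).
Proof.
rewrite /ab_sum M_E /chain_u /chain_v => ->.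
have -> : n + 2 - 3 = n - 1 by ring.
have -> : n + 2 - 2 = n by ring.
by rewrite -!mulrA -mulrDr.
Qed.

Lemma ab_prodE k : T = prodP r L lam k0 ->
  ab_prod r L lam k = (n - 1) / (n + 1) * (chain_u k * chain_v k).
Proof.
rewrite /ab_prod M_E /chain_u /chain_v => ->.
have -> : n + 2 - 3 = n - 1 by ring.
have -> : n + 2 - 1 = n + 1 by ring.
by ring.
Qed.

End Long.
End Formulas.

(** * Solutions for a tuple of admissible shape *)

Section Solution.
Variables (F : numClosedFieldType) (r : nat) (lambda : weight r).
Hypothesis lambda_dom : dominant lambda.
Local Notation lam := (weight_coord F lambda).
Local Notation w := (half_weight F lambda).

Variables (l : 'I_r -> nat) (L : nat).
Hypothesis L_le : (L <= 2 * r)%N.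
Hypothesis l_shape : forall k : 'I_r, l k = ((k < L) + (2 * r - k <= L))%N.

Lemma sum_shape : (\sum_k l k = L)%N.
Proof.
rewrite (eq_bigr _ (fun k _ => l_shape k)).
suff h q : (q <= r)%N -> (\sum_(k < q) ((k < L) + (2 * r - k <= L)) =
    minn q L + (q - (2 * r - L)))%N by rewrite h //; lia.
elim: q => [|q ih] qr; first by rewrite big_ord0; lia.
by rewrite big_ord_recr /= ih ?(ltnW qr) //; lia.
Qed.

Variables (m : nat) (c : 'I_m -> 'I_r).
Hypothesis c_col : is_coloring l c.
Local Notation solution := (bethe_solution c [tuple lambda;
  fundamental_weight r 1] [tuple (0 : F); 1]).

Lemma root_seq_bounds (t : 'I_m -> F) k : (0 < k <= r)%N ->
  size (root_seq c t k) = ((k <= L) + (2 * r - k.-1 <= L))%N.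
Proof.
case: k => // k /= kr; have := size_root_seq t (Ordinal kr) c_col.
by rewrite l_shape.
Qed.

Hypothesis r_ge2 : (2 <= r)%N.

Section Short.
Hypothesis L_le_r : (L <= r)%N.
Hypothesis w_last : (0 < L)%N -> 0 < w L.

Definition short_root (k : nat) : F :=
  \prod_(1 <= i < k.+1) (linear_A L w i / (linear_A L w i + 1)).

Let V_size (t : 'I_m -> F) k : (0 < k <= r)%N ->
  size (root_seq c t k) = (k <= L)%N.
Proof. by move=> hk; rewrite root_seq_bounds //; lia. Qed.

Let w_ge0 k : (0 < k <= L)%N -> 0 <= w k.
Proof.
by move=> /andP[k0 kL]; apply: half_weight_ge0 => //; rewrite k0 (leq_trans kL).
Qed.

Let A_gt0 k : (0 < k <= L)%N -> 0 < linear_A L w k.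
Proof. exact: linear_A_gt0. Qed.

Lemma short_root0 : short_root 0 = 1.
Proof. by rewrite /short_root big_geq. Qed.

Lemma short_root_rec k : (0 < k <= L)%N ->
  (linear_A L w k + 1) * short_root k = linear_A L w k * short_root k.-1.
Proof.
case: k => // k hk; rewrite /short_root big_nat_recr //=.
have : linear_A L w k.+1 + 1 != 0 by rewrite gt_eqF // addr_gt0 // A_gt0.
by move: (linear_A L w k.+1) => A An; field.
Qed.

Lemma short_solution_roots (t : 'I_m -> F) : solution t -> forall k : 'I_r,
  root_seq c t k.+1 = if (k < L)%N then [:: short_root k.+1] else [::].
Proof.
move=> /(bethe_normalized r_ge2) sol k.
pose V := root_seq c t; pose tau k := head 0 (V k).
have VE j : (j <= L)%N -> V j = [:: tau j].
  case: j => [//|j] jL; have := @V_size t j.+1; rewrite jL (leq_trans jL) //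
    => /(_ isT).
  by rewrite /tau /V; case: root_seq => [|x []].
have Vnil j : (L < j <= r.+1)%N -> V j = [::].
  move=> /andP[Lj]; rewrite leq_eqVlt => /orP[/eqP->|jr];
    first exact: root_seq_succ.
  have hj : (0 < j <= r)%N by rewrite (leq_ltn_trans _ Lj) // -ltnS.
  by apply/eqP; rewrite -size_eq0 V_size // leqNgt Lj.
have /(normalized_linear L_le_r VE Vnil _ w_ge0 w_last) rel := sol.
have tau0 : tau 0 != 0 by rewrite /tau oner_eq0.
have tauE j : (j <= L)%N -> tau j = short_root j.
  elim: j => [|j ih] jL; first by rewrite short_root0.
  have hj : (0 < j.+1 <= L)%N by rewrite jL.
  have An : linear_A L w j.+1 + 1 != 0 by rewrite gt_eqF // addr_gt0 // A_gt0.
  apply: (mulfI An); rewrite (rel tau0) // short_root_rec //= ih //;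
    exact: ltnW.
case: ltnP => kL; first by rewrite -/V VE // tauE.
by rewrite -/V Vnil // ltnS kL ltnS ltnW.
Qed.

Lemma short_solution_exists : exists t, solution t.
Proof.
pose v j := if (j <= L)%N then [:: short_root j] else [::].
have [k|t tE] := @exists_root_seq _ _ _ c v l c_col.
  by rewrite /v l_shape; case: ltnP => kL /=; have := ltn_ord k; lia.
exists t; apply/(bethe_normalized r_ge2).
have VE j : (j <= L)%N -> root_seq c t j = [:: short_root j].
  case: j => [|j] jL; first by rewrite short_root0.
  by rewrite (tE (Ordinal (leq_trans jL L_le_r))) /v jL.
have Vnil j : (L < j <= r.+1)%N -> root_seq c t j = [::].
  move=> /andP[Lj]; rewrite leq_eqVlt => /orP[/eqP->|];
    first exact: root_seq_succ.
  case: j Lj => // j Lj jr; rewrite ltnS in jr.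
  by rewrite (tE (Ordinal jr)) /v leqNgt Lj.
apply/(normalized_linear L_le_r VE Vnil _ w_ge0 w_last);
  last exact: short_root_rec.
by rewrite short_root0 oner_eq0.
Qed.

End Short.

Section Long.
Hypothesis L_gt_r : (r < L)%N.
Local Notation k0 := (2 * r - L)%N.
Local Notation n := (2 * quad_W k0 w r).
Hypothesis w_first : 0 < w k0.+1.
Hypothesis n_gt1 : 1 < n.

Let L_bounds : (r < L <= 2 * r)%N. Proof. by rewrite L_gt_r. Qed.
Let k0r : (k0 < r)%N. Proof. exact: k0_lt_r. Qed.

Let V_size (t : 'I_m -> F) k : (0 < k <= r)%N ->
  size (root_seq c t k) = (if (k <= k0)%N then 1 else 2)%N.
Proof. by move=> hk; rewrite root_seq_bounds //; case: (leqP k k0); lia. Qed.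

Let w_ge0 k : (0 < k <= r)%N -> 0 <= w k.
Proof. exact: half_weight_ge0. Qed.

Let A_gt0 k : (0 < k <= k0)%N -> 0 < quad_A r k0 w k.
Proof. exact: quad_A_gt0. Qed.

Let n_neq0 : n != 0. Proof. by rewrite gt_eqF // (lt_trans _ n_gt1). Qed.
Let n1_neq0 : n + 1 != 0. Proof. by rewrite gt_eqF // addr_gt0 //
  (lt_trans _ n_gt1). Qed.

Lemma prodP0 : prodP r L lam 0 = 1.
Proof. by rewrite /prodP big_geq. Qed.

Lemma prodP_rec k : (0 < k <= k0)%N ->
  (quad_A r k0 w k + 1) * prodP r L lam k = quad_A r k0 w k * prodP r L lam
    k.-1.
Proof.
case: k => // k hk; rewrite /prodP big_nat_recr //= /succ_ratio p_E //.
have : quad_A r k0 w k.+1 + 1 != 0 by rewrite gt_eqF // addr_gt0 // A_gt0.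
by move: (quad_A r k0 w k.+1) => A An; field.
Qed.

Lemma prodP_gt0 k : (k <= k0)%N -> 0 < prodP r L lam k.
Proof.
elim: k => [|k ih] hk; first by rewrite prodP0.
have h : (0 < k.+1 <= k0)%N by rewrite hk.
have A1 : 0 < quad_A r k0 w k.+1 + 1 by rewrite addr_gt0 // A_gt0.
by rewrite -(pmulr_rgt0 _ A1) prodP_rec // mulr_gt0 ?A_gt0 // ih // ltnW.
Qed.

Local Notation u := (chain_u lambda L).
Local Notation v := (chain_v lambda L).

Let values T (x y : F) j : T = prodP r L lam k0 ->
  (n * (x + y) = (n - 1) * (u T j + v T j) /\
   (n + 1) * (x * y) = (n - 1) * (u T j * v T j)) <->
  (x * y = ab_prod r L lam j /\ x + y = ab_sum r L lam j).
Proof.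
move=> TE; rewrite (ab_sumE L_bounds j TE) (ab_prodE L_bounds j TE).
move: n n_neq0 n1_neq0 => N N0 N1; split=> -[e1 e2]; split.
- by apply: (mulfI N1); rewrite e2; field.
- by apply: (mulfI N0); rewrite e1; field.
- by rewrite e2; field.
- by rewrite e1; field.
Qed.

Lemma long_solution_roots (t : 'I_m -> F) : solution t -> forall k : 'I_r,
  if (k < k0)%N then root_seq c t k.+1 = [:: prodP r L lam k.+1]
  else exists x y, [/\ root_seq c t k.+1 = [:: x; y],
    x * y = ab_prod r L lam k.+1 & x + y = ab_sum r L lam k.+1].
Proof.
move=> /(bethe_normalized r_ge2) sol k.
pose V := root_seq c t; pose tau k := nth 0 (V k) 0; pose y k := nth 0 (V k) 1.
have VE j : (j <= k0)%N -> V j = [:: tau j].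
  case: j => [//|j] jL; have := @V_size t j.+1; rewrite jL => h.
  have {h} := h (leq_trans jL (ltnW k0r)).
  by rewrite /tau /V; case: root_seq => [|x []].
have Vpair j : (k0 < j <= r)%N -> V j = [:: tau j; y j].
  move=> /andP[k0j jr]; have := @V_size t j;
    rewrite jr (leq_ltn_trans _ k0j) // leqNgt k0j.
  by move=> /(_ isT); rewrite /tau /y /V; case: root_seq => [|x [|z []]].
have Vnil : V r.+1 = [::] := root_seq_succ _ _.
have tau0 : tau 0 != 0 by rewrite /tau oner_eq0.
have [qv lv] := normalized_quad_values k0r VE Vpair Vnil w_ge0 w_first n_gt1
  (chain_u_first lambda L (tau k0)) (chain_u_rec lambda_dom L_bounds w_first
    (tau k0))
  (chain_v_rec lambda_dom L_bounds w_first (tau k0)) (chain_v_last lambda L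
    (tau k0)) sol.
have tauE j : (j <= k0)%N -> tau j = prodP r L lam j.
  elim: j => [|j ih] jL; first by rewrite prodP0.
  have hj : (0 < j.+1 <= k0)%N by rewrite jL.
  have An : quad_A r k0 w j.+1 + 1 != 0 by rewrite gt_eqF // addr_gt0 // A_gt0.
  by apply: (mulfI An); rewrite lv // prodP_rec //= ih // ltnW.
case: ltnP => kL; first by rewrite -/V VE // tauE.
have hk : (k0 < k.+1 <= r)%N by rewrite ltnS kL ltn_ord.
exists (tau k.+1), (y k.+1).
have /(values _ _ _ (tauE _ (leqnn _)))[-> ->] := qv k.+1 hk.
by split=> //; rewrite -/V Vpair.
Qed.

Lemma long_solution_exists : exists t, solution t.
Proof.
pose S := ab_sum r L lam; pose P := ab_prod r L lam.
(* The field is algebraically closed, so a quadratic with prescribed sum and product of roots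
   splits. *)
pose D k := sqrtC (S k ^+ 2 - 4 * P k).
pose x k := (S k + D k) / 2; pose y k := (S k - D k) / 2.
have two : 2 != 0 :> F by rewrite pnatr_eq0.
have xy k : x k * y k = P k /\ x k + y k = S k.
  split; last by rewrite /x /y; field.
  transitivity ((S k ^+ 2 - D k ^+ 2) / 4); first by rewrite /x /y; field.
  by rewrite sqrtCK; field.
pose V j := if (j <= k0)%N then [:: prodP r L lam j] else [:: x j; y j].
have [k|t tE] := @exists_root_seq _ _ _ c V l c_col.
  by rewrite /V l_shape; case: (leqP k.+1 k0) => kL /=; have := ltn_ord k; lia.
exists t; apply/(bethe_normalized r_ge2).
have VE j : (j <= k0)%N -> root_seq c t j = [:: prodP r L lam j].
  case: j => [|j] jL; first by rewrite prodP0.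
  by rewrite (tE (Ordinal (leq_trans jL (ltnW k0r)))) /V jL.
have Vpair j : (k0 < j <= r)%N -> root_seq c t j = [:: x j; y j].
  by case: j => // j /andP[k0j jr]; rewrite (tE (Ordinal jr)) /V leqNgt k0j.
apply: (quad_values_normalized k0r VE Vpair (root_seq_succ _ _) _ w_ge0 w_first
  n_gt1
  (chain_u_first lambda L (prodP r L lam k0))
  (chain_u_rec lambda_dom L_bounds w_first (prodP r L lam k0))
  (chain_v_rec lambda_dom L_bounds w_first (prodP r L lam k0))
  (chain_v_last lambda L (prodP r L lam k0))).
- by rewrite prodP0 oner_eq0.
- exact: prodP_gt0.
- by move=> j hj; apply/(values _ _ _ erefl)/xy.
- exact: prodP_rec.
Qed.

End Long.
End Solution.

(** * Existence and uniqueness for admissible tuples *)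

Section SolutionExistsUnique.
Variables (F : numClosedFieldType) (r : nat) (lambda : weight r).
Hypothesis r_ge2 : (2 <= r)%N.
Hypothesis lambda_dom : dominant lambda.
Local Notation w := (half_weight F lambda).

(** The admissibility conditions become positivity: for L = r + 1 one has n = lambda_r > 1, and
    otherwise W_r >= W_(k0+1) + 1 > 1. *)
Lemma quad_W_gt1 L : (r < L <= 2 * r)%N ->
  (forall i : 'I_r, (L + i == 2 * r)%N -> lambda 0 i != 0) ->
  (forall i : 'I_r, i.+1 = r -> L = r.+1 -> lambda 0 i != 1) ->
  0 < w (2 * r - L).+1 /\ 1 < 2 * quad_W (2 * r - L) w r.
Proof.
move=> hL h0 h1; have k0r := k0_lt_r hL.
have l0 : lambda 0 (Ordinal k0r) != 0 by apply: h0 => /=; lia.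
have w0 : 0 < w (2 * r - L).+1 := half_weight_gt0 F lambda_dom l0.
split=> //; have [kr|kr] := eqVneq (2 * r - L).+1 r.
  rewrite -[X in quad_W _ _ X]kr quad_W_first /half_weight kr eqxx.
  have -> : weight_coord F lambda r = (lambda 0 (Ordinal k0r))%:~R.
    by rewrite -weight_coordE /= kr.
  rewrite mulrC divfK ?pnatr_eq0 // ltr1z.
  have l1 : lambda 0 (Ordinal k0r) != 1 by apply: h1 => //; lia.
  by have := lambda_dom (Ordinal k0r); lia.
have hk : (2 * r - L < (2 * r - L).+1 < r)%N by rewrite ltnSn ltn_neqAle kr.
have W_ge0 i : ((2 * r - L).+1 < i <= r)%N -> 0 <= w i.
  by move=> /andP[hi ir]; apply: half_weight_ge0; rewrite //
    ir (leq_ltn_trans _ hi).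
have W1 : 0 < quad_W (2 * r - L) w (2 * r - L).+1 by rewrite quad_W_first.
have := W_lt k0r W_ge0 (fun i hi => quad_W_rec w hi) W1 hk.
set W := quad_W _ _ r => hW; have W_gt1 : 1 < W by rewrite (lt_le_trans _ hW)
  // ltrDr.
by rewrite mulr_natl mulr2n (lt_trans W_gt1) // ltrDl (lt_trans _ W_gt1).
Qed.

Lemma bethe_solution_exists_unique (l : 'I_r -> nat) (m : nat) (c : 'I_m ->
  'I_r) :
  admissible F lambda l -> is_coloring l c ->
  let L := (\sum_i l i)%N in
  let lam := weight_coord F lambda in
  let solution := bethe_solution c [tuple lambda; fundamental_weight r 1]
                    [tuple (0 : F); 1] in
  (L <= 2 * r)%N /\
  exists t : 'I_m -> F,
    [/\ solution t,
        forall t', solution t' -> same_solution c t t',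
        (L <= r - 1)%N -> forall k : 'I_r,
          ypoly c t k =
            if (k.+1 <= L)%N then 'X - (c_short L lam k.+1)%:P else 1,
        L = r -> forall k : 'I_r,
          ypoly c t k = 'X - (c_mid r lam k.+1)%:P
      & (r + 1 <= L <= 2 * r)%N -> forall k : 'I_r,
          if (k.+1 <= 2 * r - L)%N then
            ypoly c t k = 'X - (prodP r L lam k.+1)%:P
          else exists a b : F,
            [/\ ypoly c t k = ('X - a%:P) * ('X - b%:P),
                a * b = ab_prod r L lam k.+1
              & a + b = ab_sum r L lam k.+1]].
Proof.
move=> adm col L lam solution.
have [a [ar shape adm0 adm1]] := admissible_shape r_ge2 adm.
have LE : L = a := sum_shape ar shape.
rewrite {}LE; split=> //; have [a_le_r|r_lt_a] := leqP a r.
  have w_last : (0 < a)%N -> 0 < w a.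
    case: a a_le_r {ar shape adm1} adm0 => // i ir h _.
    by apply: (half_weight_gt0 F lambda_dom (i := Ordinal ir)); apply: h;
      rewrite eqxx.
  have roots := short_solution_roots lambda_dom ar shape col r_ge2 a_le_r
    w_last.
  have [t sol] := short_solution_exists lambda_dom ar shape col r_ge2 a_le_r
    w_last.
  have yE t' k : solution t' -> ypoly c t' k =
      if (k < a)%N then 'X - (short_root F lambda a k.+1)%:P else 1.
    move=> sol'; rewrite ypoly_root_seq roots //.
    by case: ifP => _; rewrite ?big_seq1 ?big_nil.
  exists t; split=> //.
  - by move=> t' sol'; apply: same_solutionP => k; rewrite !yE.
  - by move=> ar1 k; rewrite yE // c_shortE //; lia.
  - by move=> ar1 k; rewrite yE // ar1 ltn_ord c_midE // /short_root ar1.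
  - by lia.
have hL : (r < a <= 2 * r)%N by rewrite r_lt_a.
have [w_first n_gt1] := quad_W_gt1 hL (fun i e =>
  adm0 i (introT orP (or_intror e))) adm1.
have roots := long_solution_roots lambda_dom ar shape col r_ge2 r_lt_a w_first
  n_gt1.
have [t sol] := long_solution_exists lambda_dom ar shape col r_ge2 r_lt_a
  w_first n_gt1.
have quadE (x y : F) : ('X - x%:P) * ('X - y%:P) = 'X ^+ 2 - (x + y)%:P * 'X +
  (x * y)%:P.
  by rewrite polyCD polyCM; ring.
exists t; split=> //; try by lia.
- move=> t' sol'; apply: same_solutionP => k; rewrite !ypoly_root_seq.
  have := roots t sol k; have := roots t' sol' k; case: ifP => _;
    first by move=> -> ->.
  move=> [x' [y' [-> p' s']]] [x [y [-> p s]]].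
  by rewrite !big_cons !big_nil !mulr1 !quadE p s p' s'.
- move=> _ k; have := roots t sol k; case: ifP => _; rewrite ypoly_root_seq.
    by move=> ->; rewrite big_seq1.
  move=> [x [y [-> p s]]]; exists x, y; split=> //.
  by rewrite !big_cons big_nil mulr1.
Qed.

End SolutionExistsUnique.

Theorem corollary3p10 (R : realType) (r : nat) (r_ge2 : (2 <= r)%N)
    (lambda : weight r) (lambda_dom : dominant lambda)
    (l : 'I_r -> nat) (l_adm : admissible (complex R) lambda l)
    (c : 'I_(\sum_i l i) -> 'I_r) (c_col : is_coloring l c) :
  let L := (\sum_i l i)%N in
  let lam := weight_coord (complex R) lambda in
  let solution := bethe_solution c [tuple lambda; fundamental_weight r 1]
                    [tuple (0 : complex R); 1] in
  (L <= 2 * r)%N /\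
  exists t : 'I_(\sum_i l i) -> complex R,
    [/\ solution t,
        forall t', solution t' -> same_solution c t t',
        (L <= r - 1)%N -> forall k : 'I_r,
          ypoly c t k =
            if (k.+1 <= L)%N then 'X - (c_short L lam k.+1)%:P else 1,
        L = r -> forall k : 'I_r,
          ypoly c t k = 'X - (c_mid r lam k.+1)%:P
      & (r + 1 <= L <= 2 * r)%N -> forall k : 'I_r,
          if (k.+1 <= 2 * r - L)%N then
            ypoly c t k = 'X - (prodP r L lam k.+1)%:P
          else exists a b : complex R,
            [/\ ypoly c t k = ('X - a%:P) * ('X - b%:P),
                a * b = ab_prod r L lam k.+1
              & a + b = ab_sum r L lam k.+1]].
Proof. exact: bethe_solution_exists_unique. Qed.
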